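(* Let $V$ be a simple Euclidean Jordan algebra and let $C=\{x^2 : x\in V\}$ be the symmetric cone of all squares of $V$. Then $\mathfrak{s}(C)=\mathrm{End}(C)+\mathfrak{g}(C)$ if and only if $\mathrm{rank}\, V\le 2$.
   Context: A Euclidean Jordan algebra is a finite-dimensional real Jordan algebra $V$ (commutative product $\circ$ satisfying the Jordan identity) with identity element, equipped with a scalar product $\langle\cdot,\cdot\rangle$ satisfying $\langle x\circ y,z\rangle=\langle y,x\circ z\rangle$ for all $x,y,z$. It is simple if it has no nontrivial ideals. Here $x^2=x\circ x$. The rank of $V$ is the largest possible degree of the minimal polynomial of an element of $V$. $\mathrm{End}(V)$ is the space of all linear maps $V\to V$. For the closed cone $C$: - $\mathrm{End}(C)=\{A\in\mathrm{End}(V): A(C)\subseteq C\}$; - $G(C)$ is the group of bijective linear maps $A:V\to V$ with $A(C)=C$; - $\mathfrak{g}(C)=\{A\in\mathrm{End}(V): e^{tA}\in G(C)\text{ for all }t\in\mathbb{R}\}$; - $\mathfrak{s}(C)=\{A\in\mathrm{End}(V): e^{tA}\in\mathrm{End}(C)\text{ for all }t\ge 0\}$. The sum $\mathrm{End}(C)+\mathfrak{g}(C)$ is the set of all $A_1+A_2$ with $A_1\in\mathrm{End}(C)$, $A_2\in\mathfrak{g}(C)$. *)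

(* Defs.v *)
From HB Require Import structures.
From mathcomp Require Import all_boot all_order all_algebra.
From mathcomp Require Import all_classical all_reals all_analysis.

Set Implicit Arguments.
Unset Strict Implicit.
Unset Printing Implicit Defensive.

Import Order.TTheory GRing.Theory Num.Theory.
Import numFieldNormedType.Exports passmx.

Local Open Scope classical_set_scope.
Local Open Scope ring_scope.

Record euclideanJordanAlgebra (R : realType) (V : vectType R) :=
  EuclideanJordanAlgebra {
    jmul : {bilinear V -> V -> V};
    jone : V;
    jdot : {dot V for idfun};
    jmulC : commutative jmul;
    jmul_jordan : forall x y,
      jmul (jmul x x) (jmul x y) = jmul x (jmul (jmul x x) y);
    jmul1x : left_id jone jmul;
    jdot_assoc : forall x y z, jdot (jmul x y) z = jdot y (jmul x z) }.

Section JordanAlgebra.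
Variables (R : realType) (V : vectType R) (J : euclideanJordanAlgebra V).

(* One-sided, hence two-sided, because the product is commutative. *)
Definition jideal (I : {vspace V}) : Prop :=
  forall x y, y \in I -> jmul J x y \in I.

Definition jsimple : Prop :=
  forall I : {vspace V}, jideal I -> I = 0%VS \/ I = fullv.

Definition jsquares : set V := range (fun x => jmul J x x).

Definition jpow (x : V) (n : nat) : V := iter n (jmul J x) (jone J).

Definition jhorner (p : {poly R}) (x : V) : V :=
  \sum_(i < size p) p`_i *: jpow x i.

Definition jminpoly (x : V) (p : {poly R}) : Prop :=
  [/\ p \is monic, jhorner p x = 0 &
      forall q, q != 0 -> jhorner q x = 0 -> (size p <= size q)%N].

Definition jminpoly_degree (d : nat) : bool :=
  `[< exists x p, jminpoly x p /\ size p = d.+1 >].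

Lemma jhorner_annihilator x : exists p : {poly R},
  [/\ p != 0, (size p <= (\dim {:V}).+1)%N & jhorner p x = 0].
Proof.
pose n := (\dim {:V}).+1.
pose s : n.-tuple V := [tuple jpow x i | i < n].
have nfree : ~~ free s.
  apply/negP => fs; have := dimvS (subvf (span s)).
  by rewrite (eqP fs) size_tuple ltnn.
have [k k0 [i ki]] : exists2 k : 'I_n -> R,
    \sum_(i < n) k i *: s`_i = 0 & exists i, k i != 0.
  apply: contrapT => nk; move/negP: nfree; apply; apply/freeP => k k0 i.
  by apply: contrapT => /eqP ki; apply: nk; exists k => //; exists i.
pose p := \poly_(j < n) k (inord j).
have pE (j : 'I_n) : p`_j = k j by rewrite coef_poly ltn_ord inord_val.
exists p; split.
- by apply: contra ki => /eqP p0; rewrite -pE p0 coef0.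
- exact: size_poly.
- rewrite /jhorner -[RHS]k0.
  rewrite (big_ord_widen n (fun j => p`_j *: jpow x j)) ?size_poly //.
  rewrite big_mkcond; apply: eq_bigr => j _.
  rewrite -pE -tnth_nth tnth_mktuple; case: ltnP => // hj.
  by rewrite nth_default ?scale0r.
Qed.

Lemma jhornerZ a p x : a != 0 -> jhorner (a *: p) x = a *: jhorner p x.
Proof.
move=> a0; rewrite /jhorner size_scale // scaler_sumr.
by apply: eq_bigr => i _; rewrite coefZ scalerA.
Qed.

Lemma jminpoly_exists x : exists p, jminpoly x p.
Proof.
pose P n := `[< exists p : {poly R}, [/\ p != 0, size p = n & jhorner p x = 0] >].
have exP : exists n, P n.
  by have [p [p0 _ px]] := jhorner_annihilator x; exists (size p); apply/asboolP; exists p.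
case: (ex_minnP exP) => n /asboolP [p [p0 <- px]] minp.
have lp : (lead_coef p)^-1 != 0 by rewrite invr_eq0 lead_coef_eq0.
exists ((lead_coef p)^-1 *: p); split.
- by rewrite monicE lead_coefZ mulVf // lead_coef_eq0.
- by rewrite jhornerZ // px scaler0.
- by move=> q q0 qx; rewrite size_scale //; apply: minp; apply/asboolP; exists q.
Qed.

Lemma jminpoly_degree_exists : exists d, jminpoly_degree d.
Proof.
have [p pP] := jminpoly_exists 0; exists (size p).-1; apply/asboolP; exists 0, p.
by split=> //; rewrite prednK // size_poly_gt0 monic_neq0 //; case: pP.
Qed.

Lemma jminpoly_degree_bounded d : jminpoly_degree d -> (d <= \dim {:V})%N.
Proof.
move=> /asboolP [x [p [[_ _ minp] sp]]].
have [q [q0 sq qx]] := jhorner_annihilator x.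
by have := leq_trans (minp q q0 qx) sq; rewrite sp.
Qed.

Definition jrank : nat :=
  ex_maxn jminpoly_degree_exists jminpoly_degree_bounded.

End JordanAlgebra.

(* The limit of the exponential series in End(V), computed entrywise on the
   matrix of [A] in a basis of [V]. *)
Definition expEnd (R : realType) (V : vectType R) (A : 'End(V)) : 'End(V) :=
  let e := vbasis {:V} in
  hommx e e (limn (series (fun k => k`!%:R^-1 *: mxof e e A ^+ k))).

Section Cone.
Variables (R : realType) (V : vectType R) (C : set V).

Definition coneEnd : set 'End(V) := [set A : 'End(V) | A @` C `<=` C].

Definition coneG : set 'End(V) := [set A : 'End(V) | bijective A /\ A @` C = C].

Definition cone_g : set 'End(V) :=
  [set A : 'End(V) | forall t : R, coneG (expEnd (t *: A))].

Definition cone_s : set 'End(V) :=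
  [set A : 'End(V) | forall t : R, 0 <= t -> coneEnd (expEnd (t *: A))].

End Cone.

(* Main.v *)
From HB Require Import structures.
Require Import Defs.
From mathcomp Require Import all_boot all_order all_algebra.
From mathcomp Require Import all_classical all_reals all_analysis.
From mathcomp Require Import ring lra zify.
From mathcomp Require complex.

(** Write <x, y> for the scalar product, L(x) for multiplication by x, e for
    the unit. The first half of the proof turns the exponentials into pairings.
    Functional calculus for a single element (lemma spectral_decomposition)
    shows that C is self-dual. An operator A is in s(C) exactly when it is
    cross-positive: <A p, q> >= 0 for all orthogonal p, q in C (lemma cone_sE);
    necessity is differentiation at t = 0, sufficiency comes from
    exp A = lim (1 - A/n)^(-n), since the resolvents preserve C. Applied to A and
    -A, this says that g(C) consists of the cross-zero operators, those with
    <A p, q> = 0 for the same pairs (lemma cone_gE). So End(C) + g(C) is always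
    contained in s(C), and the question is whether every cross-positive operator
    is the sum of an operator of End(C) and a cross-zero one.

    In rank at most two the square of a vector orthogonal to e is a multiple of e,
    so C is a Lorentz cone, and two orthogonal boundary vectors are, up to scaling,
    a null vector and its conjugate under the reflection sig that fixes e. The
    part of A that is skew for the form <., sig .> is therefore cross-zero, and so
    is the identity; the symmetric part S becomes an operator of End(C) once a
    large multiple of the identity is added. For the last claim it is enough to look at null vectors
    x, where the component w of S x transverse to x and sig x has to be controlled
    by the component along sig x; moving x along a curve of null vectors in
    the direction of w gives that control (lemma spin_null_image).

    In rank at least three there is a counterexample. Replace the scalar product
    by the trace form <x, y> = tr L(xy), for which the squared norms of
    idempotents are halves of integers, so that some nonzero idempotent has a least
    squared norm N. Simplicity and the Peirce rules then produce a copy of the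
    real symmetric 3x3 matrices, spanned by orthogonal idempotents c1, c2, c3 of
    squared norm N and by connecting elements u12, u13, u23 (lemma
    triangle_exists); here e may be larger than c1 + c2 + c3. Put c3' = e - c1 - c2.
    The operator of the counterexample is
      A x = <x,c1> c3' + <x,c3'> c2 + 2 <x,c2> c1 - 12 N c1 (c2 x).
    It is cross-positive (lemma twist_cross_positive): for orthogonal p, q in C the
    negative term is a multiple of the pairing s of the (1,2) Peirce components,
    compressing p to the Peirce blocks bounds s by the diagonal pairings, which
    are at most products of traces divided by N, and the arithmetic-geometric mean
    inequality for three terms concludes. It is not a sum A1 + A2 (lemma
    twist_not_sum): on rank one matrices of the copy, averaged over signs,
    the form <A2 p, q> depends on three numbers a1, a2, a3 only; positivity of
    <(A - A2) p, q> forces a1 = a2 = a3 =: a on matrices supported on two indices,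
    and then fails for the vectors (1, 1, x) and (1, 1, -x) with x^2 slightly less
    than 2, where it reads a (2 - x^2)^2 <= N^2 (2 x^2 - 4). *)

Set Implicit Arguments.
Unset Strict Implicit.
Unset Printing Implicit Defensive.

Import Order.TTheory GRing.Theory Num.Theory.
Import numFieldNormedType.Exports passmx.

Local Open Scope classical_set_scope.
Local Open Scope ring_scope.

(** * Elementary identities and the linearized Jordan identity *)

Section Basics.
Variables (R : realType) (V : vectType R) (J : euclideanJordanAlgebra V).

Local Notation "x ∘ y" := (jmul J x y) (at level 40, left associativity).
Local Notation "''[' x , y ]" := (jdot J x y).
Local Notation e := (jone J).

Lemma jmulDl x y z : (x + y) ∘ z = x ∘ z + y ∘ z. Proof. exact: linearDl. Qed.
Lemma jmulDr x y z : x ∘ (y + z) = x ∘ y + x ∘ z. Proof. exact: linearDr. Qed.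
Lemma jmulNl x z : (- x) ∘ z = - (x ∘ z). Proof. exact: linearNl. Qed.
Lemma jmulNr x y : x ∘ (- y) = - (x ∘ y). Proof. exact: linearNr. Qed.
Lemma jmulZl a x z : (a *: x) ∘ z = a *: (x ∘ z). Proof. exact: linearZl_LR. Qed.
Lemma jmulZr a x y : x ∘ (a *: y) = a *: (x ∘ y). Proof. exact: linearZr_LR. Qed.
Lemma jmul0l x : 0 ∘ x = 0. Proof. exact: linear0l. Qed.
Lemma jmul0r x : x ∘ 0 = 0. Proof. exact: linear0r. Qed.
Lemma jmulx1 x : x ∘ e = x. Proof. by rewrite jmulC jmul1x. Qed.
Definition jmulE := (jmulDl, jmulDr, jmulNl, jmulNr, jmulZl, jmulZr, jmul0l,
  jmul0r, jmul1x, jmulx1).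

Lemma dotDl x y z : '[x + y, z] = '[x, z] + '[y, z]. Proof. exact: linearDl. Qed.
Lemma dotDr x y z : '[x, y + z] = '[x, y] + '[x, z]. Proof. exact: linearDr. Qed.
Lemma dotNl x z : '[- x, z] = - '[x, z]. Proof. exact: linearNl. Qed.
Lemma dotNr x y : '[x, - y] = - '[x, y]. Proof. exact: linearNr. Qed.
Lemma dotZl a x z : '[a *: x, z] = a * '[x, z]. Proof. exact: linearZl_LR. Qed.
Lemma dotZr a x y : '[x, a *: y] = a * '[x, y].
Proof. by rewrite linearZr_LR. Qed.
Lemma dot0l x : '[0, x] = 0. Proof. exact: linear0l. Qed.
Lemma dot0r x : '[x, 0] = 0. Proof. exact: linear0r. Qed.
Definition dotE := (dotDl, dotDr, dotNl, dotNr, dotZl, dotZr, dot0l, dot0r).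

Lemma dot_suml I (r : seq I) (P : pred I) (F : I -> V) x :
  '[\sum_(i <- r | P i) F i, x] = \sum_(i <- r | P i) '[F i, x].
Proof. by rewrite linear_sumlz. Qed.

Lemma dot_sumr I (r : seq I) (P : pred I) (F : I -> V) x :
  '[x, \sum_(i <- r | P i) F i] = \sum_(i <- r | P i) '[x, F i].
Proof. by rewrite linear_sumr. Qed.

Lemma dotC x y : '[x, y] = '[y, x].
Proof. by rewrite (@hermC _ false idfun) expr0 mul1r. Qed.

Lemma dot_gt0 x : x != 0 -> 0 < '[x, x].
Proof. exact: neq0_dnorm_gt0. Qed.

Lemma dot_ge0 x : 0 <= '[x, x].
Proof.
by have [->|/dot_gt0/ltW//] := eqVneq x 0; rewrite dot0l.
Qed.

Lemma dot_eq0 x : '[x, x] = 0 -> x = 0.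
Proof.
by move=> x0; apply/eqP; apply: contraTT (lexx ('[x, x])) => /dot_gt0; rewrite x0 ltxx.
Qed.

(** Nondegeneracy of the scalar product. It reduces identities between vectors to
    polynomial identities and inequalities between real numbers. *)
Lemma dot_ext x y : (forall q, '[x, q] = '[y, q]) -> x = y.
Proof.
move=> h; apply/eqP; rewrite -subr_eq0; apply/eqP/dot_eq0.
by rewrite dotDl dotNl h subrr.
Qed.

Lemma dot_le0 x : '[x, x] <= 0 -> x = 0.
Proof. by move=> h; apply: dot_eq0; apply/eqP; rewrite eq_le h dot_ge0. Qed.

Lemma dotM x y z : '[x ∘ y, z] = '[y, x ∘ z]. Proof. exact: jdot_assoc. Qed.

Lemma dotMr x y z : '[y, x ∘ z] = '[x ∘ y, z]. Proof. by rewrite dotM. Qed.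

Lemma cauchy_schwarz x y : '[x, y] ^+ 2 <= '[x, x] * '[y, y].
Proof.
have [->|/dot_gt0 x0] := eqVneq x 0; first by rewrite !dotE expr2 !mul0r.
have := dot_ge0 ('[x, x] *: y - '[x, y] *: x).
rewrite !dotE (dotC y x) => h.
rewrite -subr_ge0 -(pmulr_rge0 _ x0).
move: h; set a := '[x, x]; set b := '[x, y]; set c := '[y, y] => h; nra.
Qed.

(** The alternating sum of the values at the partial sums of a, b, c isolates the
    part of T that is linear in each of them. *)
Lemma trilinear_polarization (T : V -> V -> V -> R) :
  (forall x y z t, T (x + y) z t = T x z t + T y z t) ->
  (forall x y z t, T z (x + y) t = T z x t + T z y t) ->
  (forall x y z t, T z t (x + y) = T z t x + T z t y) ->
  (forall x, T x x x = 0) ->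
  forall a b c, T a b c + T a c b + T b a c + T b c a + T c a b + T c b a = 0.
Proof.
move=> D1 D2 D3 T0 a b c.
have := T0 (a + b + c); have := T0 (a + b); have := T0 (a + c); have := T0 (b + c).
rewrite !D1 !D2 !D3 !T0; lra.
Qed.

(** The complete polarization in x of (x^2 d) x = x^2 (x d). Power associativity
    and the Peirce rules are obtained by specializing it. *)
Lemma jordan_lin a b c d :
  ((a ∘ b) ∘ d) ∘ c + ((b ∘ c) ∘ d) ∘ a + ((c ∘ a) ∘ d) ∘ b =
  (a ∘ b) ∘ (c ∘ d) + (b ∘ c) ∘ (a ∘ d) + (c ∘ a) ∘ (b ∘ d).
Proof.
apply: dot_ext => q.
pose T a b c := '[((a ∘ b) ∘ d) ∘ c, q] - '[(a ∘ b) ∘ (c ∘ d), q].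
have T1 x y z t : T (x + y) z t = T x z t + T y z t.
  by rewrite /T !jmulE !dotE; lra.
have T2 x y z t : T z (x + y) t = T z x t + T z y t.
  by rewrite /T !jmulE !dotE; lra.
have T3 x y z t : T z t (x + y) = T z t x + T z t y.
  by rewrite /T !jmulE !dotE; lra.
have T0 x : T x x x = 0.
  by rewrite /T jmul_jordan (jmulC J _ x) (jmulC J _ d) subrr.
have := trilinear_polarization T1 T2 T3 T0 a b c; rewrite /T.
rewrite (jmulC J b a) (jmulC J c a) (jmulC J c b) !dotDl; lra.
Qed.
End Basics.

(** * Functional calculus of one element *)

Section PolyFacts.
Variable R : realType.

Lemma interpolation (rs : seq R) (phi : R -> R) : uniq rs ->
  exists p : {poly R}, forall r, r \in rs -> p.[r] = phi r.
Proof.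
elim: rs => [|r rs IH] /=; first by exists 0.
case/andP => rrs /IH [p pP].
pose q : {poly R} := \prod_(s <- rs) ('X - s%:P).
have qr : q.[r] != 0 by have := root_prod_XsubC rs r; rewrite (negbTE rrs) /root => ->.
exists (p + ((phi r - p.[r]) / q.[r]) *: q) => s; rewrite inE hornerD hornerZ.
have [-> _|sr /= srs] := eqVneq s r; first by rewrite divfK // addrC subrK.
have /rootP -> : root q s by rewrite root_prod_XsubC.
by rewrite mulr0 addr0 pP.
Qed.

(** The real form of a nonreal root: when m = (k1 + i k2) (X - a - i b) over the
    complex numbers, the two equations are the real and the imaginary part, and
    they involve real polynomials only. *)
Lemma real_poly_complex_root (m : {poly R}) : m \is monic -> (1 < size m)%N ->
  (forall r, ~~ root m r) ->
  exists k1 k2 : {poly R}, exists a b, [/\ b != 0,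
    m = k1 * ('X - a%:P) + b *: k2, k2 * ('X - a%:P) = b *: k1,
    (size k1 < size m)%N & (size k2 < size m)%N].
Proof.
Import complex.
move=> mm sm mr.
have ReS (a b : R) (x y : R[i]) :
    Re (x - y * Complex a b) = Re x - Re y * a + Im y * b.
  by case: x => x1 x2; case: y => y1 y2 /=; ring.
have ImS (a b : R) (x y : R[i]) :
    Im (x - y * Complex a b) = Im x - Im y * a - Re y * b.
  by case: x => x1 x2; case: y => y1 y2 /=; ring.
pose mC := map_poly (real_complex R) m.
have smC : size mC = size m by rewrite size_map_poly.
have [z zm] : exists z, root mC z by apply/closed_rootP; rewrite smC gtn_eqF.
have [k mk] := factor_theorem mC z zm.
pose k1 := \poly_(i < size k) Re k`_i; pose k2 := \poly_(i < size k) Im k`_i.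
have k1E i : k1`_i = Re k`_i.
  by rewrite coef_poly; case: ltnP => // h; rewrite nth_default.
have k2E i : k2`_i = Im k`_i.
  by rewrite coef_poly; case: ltnP => // h; rewrite nth_default.
case: z => a b in zm mk *.
have Hc i : (m`_i)%:C%C = (if i is j.+1 then k`_j else 0) - k`_i * (Complex a b).
  have := congr1 (fun p : {poly _} => p`_i) mk.
  rewrite coef_map /= => ->; rewrite mulrBr coefB coefMX coefMC.
  by case: i.
have b0 : b != 0.
  apply/eqP => b0; case/negP: (mr a); move: zm.
  by rewrite b0 [Complex a 0]complexr0 fmorph_root.
have k0 : k != 0.
  apply/eqP => k0; move: mk; rewrite k0 mul0r => /eqP.
  by rewrite -size_poly_eq0 smC; case: (size m) sm.
have sk : (size k < size m)%N.
  by rewrite -smC mk size_Mmonic ?monicXsubC // size_XsubC addn2.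
exists k1, k2, a, b; split=> //.
- apply/polyP => i; rewrite coefD coefZ mulrBr coefB coefMX coefMC !k1E k2E.
  rewrite -[LHS]/(Re (m`_i)%:C%C) Hc ReS; congr (_ - _ + _); last exact: mulrC.
  by case: i.
- apply/polyP => i; rewrite coefZ mulrBr coefB coefMX coefMC k1E !k2E.
  have := congr1 (@Im R) (Hc i); rewrite ImS [LHS]/= => h.
  apply/eqP; rewrite -subr_eq0 [b * _]mulrC; apply/eqP; rewrite [RHS]h.
  congr (_ - _ - _).
  by clear h; case: i.
- exact: leq_ltn_trans (size_poly _ _) sk.
- exact: leq_ltn_trans (size_poly _ _) sk.
Qed.
End PolyFacts.

Section Calculus.
Variables (R : realType) (V : vectType R) (J : euclideanJordanAlgebra V).

Local Notation "x ∘ y" := (jmul J x y) (at level 40, left associativity).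
Local Notation "''[' x , y ]" := (jdot J x y).
Local Notation e := (jone J).

(** As an identity between operators applied to b, this writes L((ca)d) in terms
    of products of multiplications by shorter monomials. It is responsible both
    for power associativity and for the associativity of the trace form. *)
Lemma jmul_formula a b c d :
  ((c ∘ a) ∘ d) ∘ b = (c ∘ d) ∘ (a ∘ b) + (a ∘ d) ∘ (c ∘ b) + (c ∘ a) ∘ (d ∘ b)
    - c ∘ (d ∘ (a ∘ b)) - a ∘ (d ∘ (c ∘ b)).
Proof.
have := jordan_lin J a b c d.
rewrite (jmulC J (a ∘ b ∘ d) c) (jmulC J (b ∘ c ∘ d) a).
rewrite (jmulC J (a ∘ b) d) (jmulC J (b ∘ c) d) (jmulC J b c) (jmulC J b d).
rewrite (jmulC J (a ∘ b) (c ∘ d)) (jmulC J (c ∘ b) (a ∘ d)) => h.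
apply: (@dot_ext _ _ J) => q; have := congr1 (jdot J ^~ q) h.
rewrite /= !dotE; lra.
Qed.

Lemma jpowS x n : jpow J x n.+1 = x ∘ jpow J x n. Proof. by []. Qed.

(** By jmul_formula, multiplication by x^(k+2) is a polynomial in the
    multiplications by x^2, x^(k+1), x^k and x, and the Jordan identity says that
    the first of them commutes with multiplication by x. The others do by
    induction. *)
Lemma jpow_comm x k y : x ∘ (jpow J x k ∘ y) = jpow J x k ∘ (x ∘ y).
Proof.
elim/ltn_ind: k y => -[|[|k]] IH y; first by rewrite !jmul1x.
  by rewrite /jpow /= jmulx1.
have IH0 z := IH k (ltnW (ltnSn k.+1)) z.
have IH1 z := IH k.+1 (ltnSn _) z.
have xx z : x ∘ ((x ∘ x) ∘ z) = (x ∘ x) ∘ (x ∘ z) by rewrite jmul_jordan.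
have E z : jpow J x k.+2 ∘ z = (x ∘ x) ∘ (jpow J x k ∘ z)
   + 2 *: (jpow J x k.+1 ∘ (x ∘ z)) - x ∘ (x ∘ (jpow J x k ∘ z))
   - jpow J x k ∘ (x ∘ (x ∘ z)).
  rewrite [jpow J x k.+2]jpowS (jmulC J x (jpow J x k.+1)) [in LHS]jpowS.
  rewrite jmul_formula (jmulC J (jpow J x k) x) -[jpow J x k.+1]/(x ∘ jpow J x k).
  by rewrite scaler_nat mulr2n !addrA.
rewrite !E !jmulE xx !IH0 -!IH1 -!IH0 //.
Qed.

Lemma jhornerE n (p : {poly R}) x : (size p <= n)%N ->
  jhorner J p x = \sum_(i < n) p`_i *: jpow J x i.
Proof.
move=> sp; rewrite /jhorner (big_ord_widen n (fun i => p`_i *: jpow J x i)) //.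
rewrite big_mkcond; apply: eq_bigr => i _; case: ltnP => // h.
by rewrite nth_default ?scale0r.
Qed.

Lemma jhornerD p q x : jhorner J (p + q) x = jhorner J p x + jhorner J q x.
Proof.
pose n := maxn (size p) (size q).
rewrite !(@jhornerE n) ?leq_maxl ?leq_maxr ?size_polyD // -big_split.
by apply: eq_bigr => i _; rewrite coefD scalerDl.
Qed.

Lemma jhorner_scale a p x : jhorner J (a *: p) x = a *: jhorner J p x.
Proof.
rewrite !(@jhornerE (size p)) ?size_scale_leq // scaler_sumr.
by apply: eq_bigr => i _; rewrite coefZ scalerA.
Qed.

Lemma jhornerN p x : jhorner J (- p) x = - jhorner J p x.
Proof. by rewrite -scaleN1r jhorner_scale scaleN1r. Qed.

Lemma jhornerB p q x : jhorner J (p - q) x = jhorner J p x - jhorner J q x.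
Proof. by rewrite jhornerD jhornerN. Qed.

Lemma jhornerC c x : jhorner J c%:P x = c *: e.
Proof. by rewrite (@jhornerE 1) ?size_polyC_leq1 // big_ord1 coefC. Qed.

Lemma jhorner0 x : jhorner J 0 x = 0.
Proof. by rewrite /jhorner size_poly0 big_ord0. Qed.

Lemma jhorner1 x : jhorner J 1 x = e.
Proof. by rewrite jhornerC scale1r. Qed.

Lemma jhornerMX p x : jhorner J (p * 'X) x = x ∘ jhorner J p x.
Proof.
rewrite (@jhornerE (size p).+1); last first.
  by rewrite (leq_trans (size_polyMleq _ _)) // size_polyX addn2.
rewrite big_ord_recl coefMX eqxx scale0r add0r /jhorner linear_sumr.
by apply: eq_bigr => i _; rewrite coefMX /= jmulZr.
Qed.

Lemma jhornerX x : jhorner J 'X x = x.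
Proof. by rewrite -['X]mul1r jhornerMX jhorner1 jmulx1. Qed.

Lemma jhorner_comm p x y : x ∘ (jhorner J p x ∘ y) = jhorner J p x ∘ (x ∘ y).
Proof.
rewrite /jhorner !linear_sumlz linear_sumr; apply: eq_bigr => i _.
by rewrite !jmulE jpow_comm.
Qed.

(** Power associativity, in the form in which it is used. *)
Lemma jhornerM p q x : jhorner J (p * q) x = jhorner J p x ∘ jhorner J q x.
Proof.
elim/poly_ind: q => [|q c IH]; first by rewrite mulr0 jhorner0 jmul0r.
rewrite mulrDr mulrA !jhornerD !jhornerMX jmulDr jhornerC [p * c%:P]mulrC mul_polyC.
by rewrite jhorner_scale IH jhorner_comm jmulZr jmulx1.
Qed.

Lemma dot_jhorner p q x : '[jhorner J p x, jhorner J q x] = '[jhorner J (p * q) x, e].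
Proof. by rewrite mulrC jhornerM dotM jmulx1. Qed.

(** Definiteness of the scalar product excludes nilpotents: |p(x)|^2 is the
    pairing of p^2(x) with the unit. *)
Lemma jhorner_sq_eq0 p x : jhorner J (p * p) x = 0 -> jhorner J p x = 0.
Proof. by move=> h; apply: (@dot_eq0 _ _ J); rewrite dot_jhorner h dot0l. Qed.

Lemma jhorner_exp_eq0 p n x : jhorner J (p ^+ n) x = 0 -> jhorner J p x = 0.
Proof.
have [m] := ubnP n; elim: m n => // m IH n; rewrite ltnS => nm.
case: n nm => [|[|n]] nm h; last first.
- apply: (IH n.+1); first exact: leq_trans nm.
  apply: jhorner_sq_eq0; rewrite -exprD addSnnS addnC exprD jhornerM h.
  by rewrite jmul0l.
- by rewrite -[p]expr1.
- by rewrite -[p]mulr1 -[X in p * X](expr0 p) jhornerM h jmul0r.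
Qed.

(** The minimal polynomial of x has distinct real roots. A nonreal root a + i b
    would give nonzero y1, y2 with (x - a) y1 = - b y2 and (x - a) y2 = b y1, and
    since multiplication by x - a is symmetric, |y1|^2 + |y2|^2 = 0. Repeated
    roots are excluded by jhorner_sq_eq0. *)
Lemma spectrum x : exists rs : seq R, uniq rs /\
  forall p, jhorner J p x = 0 <-> all (root p) rs.
Proof.
have [m [mm m0 mmin]] := jminpoly_exists J x.
have mnz : m != 0 by exact: monic_neq0.
have m_dvd (p : {poly R}) : jhorner J p x = 0 -> m %| p.
  move=> p0; rewrite /dvdp; apply: contraT => r0.
  have := mmin (p %% m) r0; rewrite leqNgt ltn_modp mnz => /(_ _)/negP h.
  exfalso; apply: h => //; have := p0.
  by rewrite [p in jhorner _ p _](divp_eq p m) jhornerD jhornerM m0 jmul0r add0r.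
have small (p : {poly R}) : (size p < size m)%N -> jhorner J p x = 0 -> p = 0.
  move=> sp p0; apply/eqP; apply: contraTT sp => pn0.
  by rewrite -leqNgt; apply: mmin.
have real_root (q : {poly R}) : q %| m -> q \is monic -> (1 < size q)%N -> exists r, root q r.
  move=> /dvdpP [h mq] qm sq; apply: contrapT => nr.
  have hr r : ~~ root q r by apply/negP => qr; apply: nr; exists r.
  have [k1 [k2 [a [b [b0 qE kE sk1 sk2]]]]] := real_poly_complex_root qm sq hr.
  have h0 : h != 0 by apply/eqP => h0; rewrite mq h0 mul0r eqxx in mnz.
  have sm (k : {poly R}) : (size k < size q)%N -> (size (h * k)%R < size m)%N.
    move=> sk; rewrite mq (size_Mmonic h0 qm).
    apply: leq_ltn_trans (size_polyMleq h k) _.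
    have : (0 < size h)%N by rewrite size_poly_gt0.
    move: sk sq; move: (size h) (size k) (size q) => a1 a2 a3; lia.
  have E1 : jhorner J (h * k1 * ('X - a%:P)) x = - b *: jhorner J (h * k2) x.
    apply/eqP; rewrite scaleNr -addr_eq0 -jhorner_scale -jhornerD.
    by rewrite scalerAr -mulrA -mulrDr -qE -mq m0.
  have E2 : jhorner J (h * k2 * ('X - a%:P)) x = b *: jhorner J (h * k1) x.
    by rewrite -mulrA kE -scalerAr jhorner_scale.
  have E : '[jhorner J (h * k1 * ('X - a%:P)) x, jhorner J (h * k2) x] =
           '[jhorner J (h * k2 * ('X - a%:P)) x, jhorner J (h * k1) x].
    by rewrite !dot_jhorner; congr ('[jhorner _ _ _, _]); ring.
  move: E; rewrite E1 E2 !dotZl => /eqP.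
  rewrite mulNr eq_sym -addr_eq0 -mulrDr mulf_eq0 (negbTE b0) /=.
  rewrite paddr_eq0 ?dot_ge0 // => /andP [/eqP/dot_eq0 y1 /eqP/dot_eq0 y2].
  have := small _ (sm _ sk1) y1; have := small _ (sm _ sk2) y2.
  move=> /eqP; rewrite mulf_eq0 (negbTE h0) /= => /eqP k20.
  move=> /eqP; rewrite mulf_eq0 (negbTE h0) /= => /eqP k10.
  by move: (monic_neq0 qm); rewrite qE k10 k20 mul0r scaler0 addr0 eqxx.
have [rs mE] : exists rs : seq R, m = \prod_(r <- rs) ('X - r%:P).
  suff: forall n q, q %| m -> q \is monic -> (size q <= n)%N ->
      exists rs : seq R, q = \prod_(r <- rs) ('X - r%:P).
    by move=> /(_ _ m (dvdpp _) mm (leqnn _)).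
  elim=> [|n IH] q qm qmon sq.
    by move: (monic_neq0 qmon); rewrite -size_poly_eq0 -leqn0 sq.
  have [sq1|sq1] := leqP (size q) 1.
    exists [::]; rewrite big_nil; have /size1_polyC qc := sq1.
    by move: qmon; rewrite qc monicE lead_coefC => /eqP ->.
  have [r /factor_theorem [k qE]] := real_root q qm qmon sq1.
  have kmon : k \is monic by move: qmon; rewrite qE monicMr ?monicXsubC.
  have [] := IH k _ kmon _.
  - by apply: dvdp_trans qm; rewrite qE dvdp_mulr.
  - by move: sq; rewrite qE size_Mmonic ?monicXsubC ?monic_neq0 // size_XsubC addn2.
  - by move=> rs kE; exists (r :: rs); rewrite big_cons mulrC -kE.
exists (undup rs); split; first exact: undup_uniq.
pose g : {poly R} := \prod_(r <- undup rs) ('X - r%:P).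
have g0 : jhorner J g x = 0.
  apply: (@jhorner_exp_eq0 _ (size rs)).
  suff /dvdpP [h ->] : m %| g ^+ size rs by rewrite jhornerM m0 jmul0r.
  rewrite mE; have : {subset rs <= rs} by [].
  elim: {1 3 4}rs => [|r s IH] sr; first by rewrite big_nil dvd1p.
  rewrite big_cons exprS dvdp_mul //; last first.
    by apply: IH => t ts; apply: sr; rewrite inE ts orbT.
  by rewrite dvdp_XsubCl root_prod_XsubC mem_undup sr // mem_head.
move=> p; split=> [p0|pr].
  apply/allP => r; rewrite mem_undup => rrs.
  have /dvdpP [h ->] := m_dvd p p0.
  by rewrite rootM mE root_prod_XsubC rrs orbT.
have /dvdpP [h ->] : g %| p by apply: uniq_roots_dvdp; rewrite ?uniq_rootsE ?undup_uniq.
by rewrite jhornerM g0 jmul0r.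
Qed.
End Calculus.

(** * Spectral decomposition and the self-dual cone of squares *)

Section SquareCone.
Variables (R : realType) (V : vectType R) (J : euclideanJordanAlgebra V).

Local Notation "x ∘ y" := (jmul J x y) (at level 40, left associativity).
Local Notation "''[' x , y ]" := (jdot J x y).
Local Notation e := (jone J).
Local Notation C := (jsquares J).

(** The idempotents are the values at x of the Lagrange polynomials of the
    spectrum. *)
Lemma spectral_decomposition x : exists (rs : seq R) (g : R -> V),
  [/\ uniq rs, forall r, r \in rs -> g r != 0,
      forall r s, r \in rs -> s \in rs -> g r ∘ g s = if r == s then g r else 0 &
      forall p, jhorner J p x = \sum_(r <- rs) p.[r] *: g r].
Proof.
have [rs [urs rsP]] := spectrum J x.
pose ind (r : R) := fun s => if r == s then 1 else 0 : R.
pose l r := projT1 (cid (interpolation (ind r) urs)).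
have lP r s (sr : s \in rs) : (l r).[s] = ind r s := projT2 (cid (interpolation (ind r) urs)) s sr.
have ev p q : (forall s, s \in rs -> p.[s] = q.[s]) -> jhorner J p x = jhorner J q x.
  move=> pq; apply/eqP; rewrite -subr_eq0 -jhornerB; apply/eqP/rsP/allP => s sr.
  by rewrite /root !hornerE pq // subrr.
exists rs, (fun r => jhorner J (l r) x); split=> //.
- move=> r rr; apply/eqP => /rsP /allP /(_ r rr).
  by rewrite /root lP // /ind eqxx oner_eq0.
- move=> r s rr sr; rewrite -jhornerM; case: eqVneq => [<-|rs'].
    by apply: ev => t tr; rewrite hornerM !lP // /ind; case: eqP; rewrite ?mulr1 ?mulr0.
  rewrite -[RHS](jhorner0 J x); apply: ev => t tr.
  rewrite hornerM !lP // /ind horner0; case: eqVneq => [rt|]; last by rewrite mul0r.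
  by rewrite -rt eq_sym (negbTE rs') mulr0.
- move=> p; under eq_bigr do rewrite -jhorner_scale.
  transitivity (jhorner J (\sum_(r <- rs) p.[r] *: l r) x); last first.
    elim: {1 2}rs => [|r s IH]; first by rewrite !big_nil jhorner0.
    by rewrite !big_cons jhornerD IH.
  apply: ev => s sr; rewrite horner_sum (bigD1_seq s) //= hornerZ lP // /ind eqxx.
  rewrite mulr1 big_seq_cond big1 ?addr0 // => r /andP [rr rs'].
  by rewrite hornerZ lP // /ind (negbTE rs') mulr0.
Qed.

(** The relation L (2 L - 1) (L - 1) = 0 for L = L(c): the possible eigenvalues
    are 0, 1/2 and 1, and V is the sum of the Peirce spaces V_0, V_1/2, V_1 of c. *)
Lemma idempotent_cubic c y : c ∘ c = c ->
  c ∘ (c ∘ (c ∘ y)) = 2^-1 *: (3 *: (c ∘ (c ∘ y)) - c ∘ y).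
Proof.
move=> cc; have := jmul_formula J c y c c; rewrite !cc => h.
apply: (@dot_ext _ _ J) => q; have := congr1 (jdot J ^~ q) h.
rewrite /= !dotE; lra.
Qed.

(** The cubic relation gives L = L^2 + 4 (L - L^2)^2 for L = L(c). *)
Lemma idempotent_psd c y : c ∘ c = c -> 0 <= '[c ∘ y, y].
Proof.
move=> cc; have := dot_ge0 J (c ∘ y); have := dot_ge0 J (c ∘ y - c ∘ (c ∘ y)).
have E2 : '[c ∘ y, c ∘ y] = '[c ∘ (c ∘ y), y] by rewrite dotMr.
have E3 : '[c ∘ y, c ∘ (c ∘ y)] = '[c ∘ (c ∘ (c ∘ y)), y] by rewrite -!dotMr.
have E4 : '[c ∘ (c ∘ y), c ∘ (c ∘ y)] = '[c ∘ (c ∘ (c ∘ (c ∘ y))), y].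
  by rewrite -!dotMr.
rewrite !dotE (dotC J (c ∘ (c ∘ y)) (c ∘ y)) E2 E3 E4.
rewrite (idempotent_cubic (c ∘ y) cc) (idempotent_cubic y cc) !dotE; lra.
Qed.

Lemma sum_psd (rs : seq R) (g : R -> V) (f : R -> R) y :
  (forall r, r \in rs -> g r ∘ g r = g r) -> (forall r, r \in rs -> 0 <= f r) ->
  0 <= '[(\sum_(r <- rs) f r *: g r) ∘ y, y].
Proof.
move=> gg f0; rewrite linear_sumlz dot_suml big_seq sumr_ge0 // => r rr.
by rewrite /= jmulZl dotZl mulr_ge0 ?f0 // idempotent_psd // gg.
Qed.

Lemma jsquares_psd q y : C q -> 0 <= '[q ∘ y, y].
Proof.
move=> [a _ <-]; have [rs [g [urs _ gg gE]]] := spectral_decomposition a.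
have := gE ('X * 'X); rewrite jhornerM !jhornerX => ->; apply: sum_psd.
  by move=> r rr; rewrite gg // eqxx.
by move=> r rr; rewrite hornerM hornerX -expr2 sqr_ge0.
Qed.

Lemma jsquares_dot_ge0 p q : C p -> C q -> 0 <= '[p, q].
Proof.
by move=> [a _ <-] Cq; rewrite dotM jmulC dotC jsquares_psd.
Qed.

(** A polynomial that is nonnegative on the spectrum of x agrees there with the
    square of another one. *)
Lemma jsquares_calculus x : exists rs : seq R,
  [/\ uniq rs, forall p, (forall r, r \in rs -> 0 <= p.[r]) -> C (jhorner J p x),
      forall p, (forall r, r \in rs -> p.[r] = 0) -> jhorner J p x = 0 &
      forall p, jhorner J p x = 0 -> (forall r, r \in rs -> p.[r] = 0)].
Proof.
have [rs [urs rsP]] := spectrum J x; exists rs; split=> //.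
- move=> p p0; have [f fP] := interpolation (fun r => Num.sqrt p.[r]) urs.
  exists (jhorner J f x) => //=; rewrite -jhornerM; apply/eqP.
  rewrite -subr_eq0 -jhornerB; apply/eqP/rsP/allP => r rr.
  by rewrite /root !hornerE fP // -expr2 sqr_sqrtr ?p0 // subrr.
- by move=> p p0; apply/rsP/allP => r rr; rewrite /root p0.
- by move=> p /rsP/allP h r /h /eqP.
Qed.

(** Positive and negative part of x, by functional calculus. *)
Lemma jordan_decomposition x : exists p q,
  [/\ C p, C q, '[p, q] = 0 & x = p - q].
Proof.
have [rs [urs Cr z0 _]] := jsquares_calculus x.
have [f fP] := interpolation (fun r => Num.max r 0) urs.
exists (jhorner J f x), (jhorner J (f - 'X) x); split.
- by apply: Cr => r rr; rewrite fP // le_max lexx orbT.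
- by apply: Cr => r rr; rewrite !hornerE fP // subr_ge0 le_max lexx.
- rewrite dot_jhorner z0 ?dot0l // => r rr; rewrite !hornerE fP //.
  by case: (leP r 0) => h; rewrite ?mul0r ?subrr ?mulr0.
- by rewrite -jhornerB opprB addrC subrK jhornerX.
Qed.

(** Self-duality of the cone. If x = p - q with p, q orthogonal elements of the
    cone, then pairing with q gives - |q|^2 >= 0. *)
Lemma jsquaresP x : C x <-> forall q, C q -> 0 <= '[x, q].
Proof.
split=> [Cx q Cq|h]; first exact: jsquares_dot_ge0.
have [p [q [Cp Cq pq xE]]] := jordan_decomposition x.
have := h q Cq; rewrite xE dotDl pq dotNl add0r oppr_ge0 => /dot_le0 q0.
by rewrite q0 subr0.
Qed.

Lemma jsquaresD x y : C x -> C y -> C (x + y).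
Proof.
move=> /jsquaresP hx /jsquaresP hy; apply/jsquaresP => q Cq.
by rewrite dotDl addr_ge0 ?hx ?hy.
Qed.

Lemma jsquaresZ a x : 0 <= a -> C x -> C (a *: x).
Proof.
by move=> a0 /jsquaresP hx; apply/jsquaresP => q Cq; rewrite dotZl mulr_ge0 ?hx.
Qed.

Lemma jsquares_idem c : c ∘ c = c -> C c.
Proof. by move=> cc; exists c. Qed.

Lemma jsquares1 : C e. Proof. by apply: jsquares_idem; rewrite jmul1x. Qed.

Lemma jsquares0 : C 0. Proof. by apply: jsquares_idem; rewrite jmul0l. Qed.

(** The eigenvalues of p are bounded, so some multiple of p exceeds p^2. *)
Lemma jsquares_bound p : C p -> exists2 M, 0 <= M & C (M *: p - p ∘ p).
Proof.
move=> [a _ <-]; have [rs [urs Cr _ _]] := jsquares_calculus a.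
pose M : R := \sum_(r <- rs) r ^+ 2.
have M0 : 0 <= M by apply: sumr_ge0 => r _; exact: sqr_ge0.
exists M => //.
have -> : M *: (a ∘ a) - (a ∘ a) ∘ (a ∘ a) =
    jhorner J (M *: ('X * 'X) - ('X * 'X) * ('X * 'X)) a.
  by rewrite jhornerB jhorner_scale !jhornerM !jhornerX.
apply: Cr => r rr; rewrite hornerD hornerN hornerZ !hornerM hornerX -expr2.
rewrite -mulrBl mulr_ge0 ?sqr_ge0 // subr_ge0 /M (big_rem r) //= lerDl; apply: sumr_ge0 => s _; exact: sqr_ge0.
Qed.

(** A positive semidefinite form that vanishes at y is minimal there, so its
    gradient vanishes; the test vector is a small step along - T y. *)
Lemma psd_kernel (T : V -> V) y : (forall a u v, T (a *: u + v) = a *: T u + T v) ->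
  (forall u v, '[T u, v] = '[u, T v]) -> (forall u, 0 <= '[T u, u]) ->
  '[T y, y] = 0 -> T y = 0.
Proof.
move=> Tlin Tsym Tpos Ty; apply: (@dot_le0 _ _ J); rewrite leNgt; apply/negP => h.
set d := '[T y, y] in Ty *; set b := '[_, _] in h.
pose k := '[T (T y), T y].
have k0 : 0 <= k := Tpos _.
have := Tpos (- (b / (k + 1)) *: T y + y).
rewrite Tlin !dotE -/k (Tsym (T y) y) -/b -/d Ty.
set t := b / (k + 1) => h1.
have t0 : 0 < t by rewrite divr_gt0 // ltr_wpDl.
have tE : t * (k + 1) = b by rewrite divfK // gt_eqF // ltr_wpDl.
nra.
Qed.

(** Orthogonality to q passes from p to p^2, because <M p - p^2, q> >= 0. Then
    <q p, p> = 0, and multiplication by q is positive semidefinite. *)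
Lemma jsquares_orth p q : C p -> C q -> '[p, q] = 0 -> p ∘ q = 0.
Proof.
move=> Cp Cq pq; have [M M0 CM] := jsquares_bound Cp.
have : '[p ∘ p, q] = 0.
  apply/eqP; rewrite eq_le jsquares_dot_ge0 ?andbT; last 2 first.
  - by exists p.
  - by [].
  have := jsquares_dot_ge0 CM Cq; rewrite !dotE pq; lra.
move=> h; rewrite jmulC.
apply: (@psd_kernel (fun y => q ∘ y)) => //.
- by move=> a u v; rewrite jmulDr jmulZr.
- by move=> u v; rewrite dotM.
- by move=> u; apply: jsquares_psd.
- by rewrite jmulC dotM dotC.
Qed.
End SquareCone.

(** * The matrix exponential *)

Section MatrixExponential.
Variable R : realType.

Definition mexp n (M : 'M[R]_n) : 'M[R]_n :=
  limn (series (fun k => k`!%:R^-1 *: M ^+ k)).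

Lemma cvg_sum_ord n (u : 'I_n -> nat -> R) (l : 'I_n -> R) :
  (forall i, u i @ \oo --> l i) -> (fun k => \sum_i u i k) @ \oo --> \sum_i l i.
Proof.
by move=> ul; apply: cvg_big => [|i _]; [exact: add_continuous | exact: ul].
Qed.

Lemma exp_partial_le (c : R) n : 0 <= c -> series (exp_coeff c) n <= expR c.
Proof.
move=> c0; apply: nondecreasing_cvgn_le; last exact: is_cvg_series_exp_coeff.
by apply: nondecreasing_series => k _ _; exact: exp_coeff_ge0.
Qed.

Lemma mx_entry_cvg m n (u : nat -> 'M[R]_(m, n)) (L : 'M[R]_(m, n)) :
  (forall i j, (fun k => u k i j) @ \oo --> L i j) -> u @ \oo --> L.
Proof.
move=> h; apply/cvg_ballP => eps eps0.
have : \forall k \near \oo, forall i j, ball (L i j) eps (u k i j).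
  apply: filter_forall => i; apply: filter_forall => j.
  by move: (h i j) => /cvg_ballP/(_ _ eps0).
by apply: filterS => k hk; split.
Qed.

Lemma exp_dominated_cvg (c d : R) (m : nat -> R) : 0 <= c ->
  (forall k, `|m k| <= d * c ^+ k) ->
  cvgn (series (fun k => k`!%:R^-1 * m k)).
Proof.
move=> c0 hm; apply: normed_cvg.
have d0 : 0 <= d by have := hm 0%N; rewrite expr0 mulr1; apply: le_trans.
apply: (@series_le_cvg _ _ (d *: exp_coeff c)).
- by move=> k /=; exact: normr_ge0.
- by move=> k; rewrite /= mulr_ge0 // exp_coeff_ge0.
- move=> k; rewrite /= normrM ger0_norm ?invr_ge0 // /exp_coeff /=.
  by rewrite [leRHS]mulrA mulrC; apply: ler_wpM2r; rewrite ?invr_ge0.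
- by apply: is_cvg_seriesZ; exact: is_cvg_series_exp_coeff.
Qed.

Lemma mx_pow_bound n (M : 'M[R]_n) :
  exists2 c : R, 0 <= c & forall k i j, `|(M ^+ k) i j| <= c ^+ k.
Proof.
exists (\sum_i \sum_j `|M i j|) => [|k].
  by apply: sumr_ge0 => i _; apply: sumr_ge0.
elim: k => [|k IH] i j.
  by rewrite expr0 mxE; case: (i == j); rewrite ?normr1 ?normr0.
rewrite exprS mxE (le_trans (ler_norm_sum _ _ _)) //.
rewrite [leRHS]exprS [X in _ <= X * _](bigD1 i) //= mulrDl ler_wpDr ?mulr_ge0 ?exprn_ge0 //.
- by apply: sumr_ge0 => ? _; apply: sumr_ge0.
- by apply: sumr_ge0 => ? _; apply: sumr_ge0.
- by rewrite mulr_suml ler_sum // => l _; rewrite normrM ler_wpM2l.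
Qed.

Lemma mexp_entry n (M : 'M[R]_n) i j :
  series (fun k => k`!%:R^-1 * (M ^+ k) i j) @ \oo --> mexp M i j.
Proof.
have [c c0 hc] := mx_pow_bound M.
have cv i' j' : cvgn (series (fun k => k`!%:R^-1 * (M ^+ k) i' j')).
  by apply: (@exp_dominated_cvg c 1) => // k; rewrite mul1r.
pose L := \matrix_(i, j) limn (series (fun k => k`!%:R^-1 * (M ^+ k) i j)).
have LM : series (fun k => k`!%:R^-1 *: M ^+ k) @ \oo --> L.
  apply: mx_entry_cvg => i' j'; rewrite mxE.
  rewrite (_ : (fun _ => _) = series (fun k => k`!%:R^-1 * (M ^+ k) i' j')).
    exact: cv.
  apply/funext => k; rewrite /series /= summxE.
  by apply: eq_bigr => l _; rewrite mxE.
have -> : mexp M = L by apply/cvg_lim.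
by rewrite mxE; exact: cv.
Qed.

Definition exp_poly N (s : R) : {poly R} := \poly_(i < N) (i`!%:R^-1 * s ^+ i).

Lemma exp_poly_defect N (s t : R) k :
  (exp_poly N s * exp_poly N t - exp_poly N (s + t))`_k =
  if (k < N)%N then 0 else (exp_poly N s * exp_poly N t)`_k.
Proof.
rewrite coefB [(exp_poly N (s + t))`_k]coef_poly; case: ltnP => kN; last by rewrite subr0.
rewrite coefM addrC exprDn mulr_sumr; apply/eqP; rewrite addrC subr_eq0; apply/eqP.
rewrite (reindex_inj rev_ord_inj) /=; apply: eq_bigr => i _.
have ik : (i <= k)%N by rewrite -ltnS.
rewrite !coef_poly subSS subKn // (leq_ltn_trans (leq_subr _ _) kN) (leq_trans (ltn_ord i) kN).
have -> : k`!%:R = 'C(k, i)%:R * (i`!%:R * (k - i)`!%:R) :> R.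
  by rewrite -!natrM bin_fact.
rewrite -mulr_natr.
have h1 : i`!%:R != 0 :> R by rewrite pnatr_eq0 -lt0n fact_gt0.
have h2 : (k - i)`!%:R != 0 :> R by rewrite pnatr_eq0 -lt0n fact_gt0.
have h3 : 'C(k, i)%:R != 0 :> R by rewrite pnatr_eq0 -lt0n bin_gt0.
by field; rewrite h1 h2.
Qed.

(** The product of two truncated exponentials differs from the truncated
    exponential of the sum only by terms of high degree, and these are dominated
    by the same terms for the absolute values. *)
Lemma exp_poly_defect_norm N (s t : R) k :
  `|(exp_poly N s * exp_poly N t - exp_poly N (s + t))`_k| <=
  (exp_poly N `|s| * exp_poly N `|t| - exp_poly N (`|s| + `|t|))`_k.
Proof.
rewrite !exp_poly_defect; case: ltnP => kN; first by rewrite normr0.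
rewrite !coefM (le_trans (ler_norm_sum _ _ _)) // ler_sum // => i _.
have nc u l : `|(exp_poly N u)`_l| = (exp_poly N `|u|)`_l.
  rewrite !coef_poly; case: ifP => _; last by rewrite normr0.
  by rewrite normrM normrX ger0_norm // invr_ge0.
by rewrite normrM !nc.
Qed.

Lemma exp_poly_horner N (s c : R) :
  (exp_poly N s).[c] = series (exp_coeff (s * c)) N.
Proof.
rewrite horner_poly /series /= big_mkord; apply: eq_bigr => i _.
by rewrite /exp_coeff /= exprMn mulrC -!mulrA mulrC mulrA; ring.
Qed.

Lemma horner_mx_entry n (M : 'M[R]_n.+1) (p : {poly R}) N i j : (size p <= N)%N ->
  (horner_mx M p) i j = \sum_(k < N) p`_k * (M ^+ k) i j.
Proof.
move=> sp; rewrite -[p in LHS]coefK poly_def rmorph_sum summxE.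
rewrite (big_ord_widen N (fun k => (horner_mx M (p`_k *: 'X^k)) i j)) // big_mkcond.
apply: eq_bigr => k _; case: ltnP => h; last by rewrite nth_default ?mul0r.
by rewrite linearZ /= rmorphXn /= horner_mx_X mxE.
Qed.

(** The entries of the difference between the product of the partial sums and the
    partial sum for s + t are bounded by the corresponding scalar difference,
    which tends to 0 by the functional equation of the real exponential. *)
Lemma mexpD n (M : 'M[R]_n) (s t : R) :
  mexp (s *: M) *m mexp (t *: M) = mexp ((s + t) *: M).
Proof.
case: n M => [|n] M; first by apply/matrixP => -[].
have [c c0 hc] := mx_pow_bound M.
have part u N i j : series (fun k => k`!%:R^-1 * ((u *: M) ^+ k) i j) N =
    (horner_mx M (exp_poly N u)) i j.
  rewrite (horner_mx_entry _ _ _ (size_poly _ _)) /series /= big_mkord.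
  by apply: eq_bigr => k _; rewrite exprZn mxE coef_poly ltn_ord mulrA.
apply/matrixP => i j; rewrite mxE.
pose D N := horner_mx M (exp_poly N s * exp_poly N t - exp_poly N (s + t)).
have D0 : (fun N => D N i j) @ \oo --> (0 : R).
  pose F N := series (exp_coeff (`|s| * c)) N * series (exp_coeff (`|t| * c)) N
     - series (exp_coeff ((`|s| + `|t|) * c)) N.
  have F0 : F @ \oo --> (0 : R).
    have -> : 0 = expR (`|s| * c) * expR (`|t| * c) - expR ((`|s| + `|t|) * c) :> R.
      by rewrite mulrDl expRD subrr.
    apply: cvgB; last exact: is_cvg_series_exp_coeff.
    by apply: cvgM; exact: is_cvg_series_exp_coeff.
  apply: (@squeeze_cvgr _ _ _ _ (- F) F _ _ 0) => //; last first.
    by rewrite -oppr0; apply: cvgN.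
  near=> N; rewrite -ler_norml.
  pose m := size (exp_poly N `|s| * exp_poly N `|t| - exp_poly N (`|s| + `|t|)).
  pose p := exp_poly N s * exp_poly N t - exp_poly N (s + t).
  pose N' := maxn (size p) m.
  rewrite /D (@horner_mx_entry _ _ _ N') ?leq_maxl //.
  rewrite /F -!exp_poly_horner -hornerM -hornerN -hornerD.
  rewrite (@horner_coef_wide _ N') ?leq_maxr //.
  rewrite (le_trans (ler_norm_sum _ _ _)) // ler_sum // => k _.
  by rewrite normrM ler_pM // exp_poly_defect_norm.
have DE N : D N i j = \sum_l (horner_mx M (exp_poly N s)) i l *
     (horner_mx M (exp_poly N t)) l j - (horner_mx M (exp_poly N (s + t))) i j.
  by rewrite /D rmorphB rmorphM /= !mxE.
have Dlim : (fun N => D N i j) @ \oo -->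
    \sum_l mexp (s *: M) i l * mexp (t *: M) l j - mexp ((s + t) *: M) i j.
  rewrite (funext DE); apply: cvgB.
    apply: cvg_sum_ord => l; apply: cvgM; under eq_fun do rewrite -part; exact: mexp_entry.
  by under eq_fun do rewrite -part; exact: mexp_entry.
by apply/eqP; rewrite -subr_eq0; apply/eqP; exact: (cvg_unique _ Dlim D0).
Unshelve. all: by end_near.
Qed.

Lemma mexp0 n : mexp (0 : 'M[R]_n) = 1%:M.
Proof.
apply/matrixP => i j; apply: (cvg_unique _ (@mexp_entry _ 0 i j)) => //.
apply: cvg_near_cst; near=> N.
rewrite /series /= -(@prednK N) ?big_nat_recl //=; last by near: N; exact: nbhs_infty_gt.
rewrite expr0 fact0 invr1 mul1r big1 ?addr0 // => k _.
by rewrite exprS mul0r mxE mulr0.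
Unshelve. all: by end_near.
Qed.
End MatrixExponential.

(** * The exponential of an endomorphism *)

Section Norm.
Variables (R : realType) (V : vectType R) (J : euclideanJordanAlgebra V).

Local Notation "''[' x , y ]" := (jdot J x y).
Local Notation v := (vbasis {:V}).
Local Notation n := (\dim {:V}).

Definition jnorm (x : V) := Num.sqrt '[x, x].

Lemma jnorm_ge0 x : 0 <= jnorm x. Proof. exact: sqrtr_ge0. Qed.

Lemma jnorm_sq x : jnorm x * jnorm x = '[x, x].
Proof. by rewrite -expr2 sqr_sqrtr ?dot_ge0. Qed.

Lemma dot_norm_le x y : `|'[x, y]| <= jnorm x * jnorm y.
Proof.
rewrite -(@ler_pXn2r _ 2) ?nnegrE ?mulr_ge0 ?jnorm_ge0 // real_normK ?num_real //.
by rewrite exprMn !sqr_sqrtr ?dot_ge0 // cauchy_schwarz.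
Qed.

(** In this form bounds on norms pass to limits that are only known after pairing. *)
Lemma jnorm_le_pairing x b : 0 <= b -> (forall q, `|'[x, q]| <= b * jnorm q) -> jnorm x <= b.
Proof.
move=> b0 h; have := h x; rewrite -jnorm_sq ger0_norm ?mulr_ge0 ?jnorm_ge0 //.
have [->//|x0] := eqVneq (jnorm x) 0.
by rewrite ler_pM2r // lt_def x0 jnorm_ge0.
Qed.

Lemma jnorm0 : jnorm 0 = 0. Proof. by rewrite /jnorm dot0l sqrtr0. Qed.

Lemma jnorm0_eq0 x : jnorm x = 0 -> x = 0.
Proof.
by move=> h; apply: (@dot_eq0 _ _ J); rewrite -jnorm_sq h mul0r.
Qed.

Lemma jnorm_congr x y : '[x, x] = '[y, y] -> jnorm x = jnorm y.
Proof. by rewrite /jnorm => ->. Qed.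

Lemma jnormD x y : jnorm (x + y) <= jnorm x + jnorm y.
Proof.
apply: jnorm_le_pairing => [|q]; first by rewrite addr_ge0 ?jnorm_ge0.
by rewrite dotDl mulrDl (le_trans (ler_normD _ _)) // lerD ?dot_norm_le.
Qed.

Lemma jnormZ a x : jnorm (a *: x) = `|a| * jnorm x.
Proof. by rewrite /jnorm dotZl dotZr mulrA -expr2 sqrtrM ?sqr_ge0 // sqrtr_sqr. Qed.

Lemma jnormN x : jnorm (- x) = jnorm x.
Proof. by rewrite -scaleN1r jnormZ normrN1 mul1r. Qed.

Lemma jnormB x y : jnorm (x - y) <= jnorm x + jnorm y.
Proof. by rewrite -(jnormN y) jnormD. Qed.

(** The coordinate functionals are represented by vectors because the Gram
    operator of a basis is injective. Adjoints and operator bounds are read off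
    from it. *)
Lemma dual_basis : exists z : 'I_n -> V, forall x, x = \sum_i '[x, z i] *: v`_i.
Proof.
pose g w := \sum_(i < n) '[w, v`_i] *: v`_i.
have glin : linear g.
  move=> a x y; rewrite /g scaler_sumr -big_split; apply: eq_bigr => i _ /=.
  by rewrite dotDl dotZl scalerDl scalerA.
pose gm := GRing.isLinear.Build R V V _ g glin.
pose gl : {linear V -> V} := HB.pack g gm.
pose f := linfun gl.
have bv := vbasisP {:V}.
have fv x i : coord v i (f x) = '[x, v`_i].
  by rewrite lfunE /= coord_sum_free // (basis_free bv).
have kf : lker f == 0%VS.
  apply/eqP/vspaceP => x; rewrite memv_ker memv0; apply/eqP/eqP => [fx|->]; last by rewrite linear0.
  apply: (@dot_eq0 _ _ J); rewrite [X in '[_, X]](coord_basis bv) ?memvf //.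
  by rewrite dot_sumr big1 // => i _; rewrite dotZr -fv fx linear0 mulr0.
exists (fun i => (f^-1)%VF v`_i) => x.
rewrite {1}[x](coord_basis bv) ?memvf //; apply: eq_bigr => i _; congr (_ *: _).
rewrite [in RHS](coord_basis bv (memvf x)) dot_suml (bigD1 i) //= big1 ?addr0 => [|j ji].
  rewrite dotZl dotC -fv (lker0_lfunVK kf) coord_free ?(basis_free bv) //.
  by rewrite eqxx mulr1.
rewrite dotZl dotC -fv (lker0_lfunVK kf) coord_free ?(basis_free bv) //.
by rewrite eq_sym (negbTE ji) mulr0.
Qed.

Lemma adjoint_exists (A : 'End(V)) :
  exists B : 'End(V), forall x y, '[A x, y] = '[x, B y].
Proof.
have [z zE] := dual_basis.
pose g w := \sum_(i < n) '[A v`_i, w] *: z i.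
have glin : linear g.
  move=> a x y; rewrite /g scaler_sumr -big_split; apply: eq_bigr => i _ /=.
  by rewrite dotDr dotZr scalerDl scalerA.
pose gm := GRing.isLinear.Build R V V _ g glin.
pose gl : {linear V -> V} := HB.pack g gm.
exists (linfun gl) => x y; rewrite lfunE /= /g dot_sumr {1}[x]zE linear_sum dot_suml.
by apply: eq_bigr => i _; rewrite linearZ dotZl dotZr mulrC.
Qed.

Lemma lfun_bounded (A : 'End(V)) :
  exists2 K, 0 <= K & forall x, jnorm (A x) <= K * jnorm x.
Proof.
have [z zE] := dual_basis; exists (\sum_i jnorm (z i) * jnorm (A v`_i)) => [|x].
  by apply: sumr_ge0 => i _; rewrite mulr_ge0 ?jnorm_ge0.
apply: jnorm_le_pairing => [|q].
  by rewrite mulr_ge0 ?jnorm_ge0 ?sumr_ge0 // => i _; rewrite mulr_ge0 ?jnorm_ge0.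
rewrite {1}[x]zE linear_sum dot_suml !mulr_suml (le_trans (ler_norm_sum _ _ _)) //.
apply: ler_sum => i _; rewrite linearZ dotZl normrM mulrAC mulrC.
rewrite [X in _ <= X](_ : _ = (jnorm (A v`_i) * jnorm q) * (jnorm x * jnorm (z i))); last by ring.
by rewrite ler_pM ?dot_norm_le.
Qed.
End Norm.

Section ExpEnd.
Variables (R : realType) (V : vectType R) (J : euclideanJordanAlgebra V).

Local Notation "''[' x , y ]" := (jdot J x y).
Local Notation v := (vbasis {:V}).
Local Notation jnorm := (jnorm J).

Lemma expEndE (A : 'End(V)) : expEnd A = hommx v v (mexp (mxof v v A)).
Proof. by []. Qed.

Lemma expEndD (A : 'End(V)) s t x :
  expEnd (s *: A) (expEnd (t *: A) x) = expEnd ((s + t) *: A) x.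
Proof.
have bv := vbasisP {:V}.
by rewrite !expEndE !linearZ /= addrC -mexpD (hommx_mul bv bv bv) comp_lfunE.
Qed.

Lemma expEnd0 (A : 'End(V)) x : expEnd (0 *: A) x = x.
Proof.
have bv := vbasisP {:V}.
by rewrite expEndE !scale0r linear0 mexp0 hommxE // mulmx1 rVofK.
Qed.

(** The growth estimates for the exponential are derived from these scalar limits,
    which make no reference to the basis in its definition. *)
Lemma expEnd_cvg (A : 'End(V)) x q :
  series (fun k => k`!%:R^-1 * '[iter k A x, q]) @ \oo --> '[expEnd A x, q].
Proof.
have bv := vbasisP {:V}; set M := mxof v v A.
have dE (N : 'M[R]_(\dim {:V})) y : '[vecof v (y *m N), q] =
    \sum_(j < \dim {:V}) \sum_i y 0 i * '[v`_j, q] * N i j.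
  rewrite /vecof dot_suml; apply: eq_bigr => j _.
  by rewrite dotZl mxE mulr_suml; apply: eq_bigr => i _; rewrite mulrAC.
have kE k : '[iter k A x, q] = '[vecof v (rVof v x *m M ^+ k), q].
  congr ('[_, q]); apply: (can_inj (rVofK bv)); rewrite vecofK //.
  elim: k => [|k IH]; first by rewrite expr0 mulmx1.
  by rewrite iterS (rVof_app v bv) IH -mulmxA exprSr.
rewrite expEndE hommxE // dE.
rewrite (_ : series _ = fun N => \sum_(j < \dim {:V}) \sum_i rVof v x 0 i * '[v`_j, q] *
    series (fun k => k`!%:R^-1 * (M ^+ k) i j) N); last first.
  apply/funext => N; rewrite /series /=.
  under eq_bigr do rewrite kE dE mulr_sumr.
  rewrite exchange_big; apply: eq_bigr => j _ /=.
  under eq_bigr do rewrite mulr_sumr.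
  rewrite exchange_big; apply: eq_bigr => i _ /=.
  by rewrite mulr_sumr; apply: eq_bigr => k _; rewrite mulrCA.
apply: cvg_sum_ord => j; apply: cvg_sum_ord => i.
by apply: cvgMl_tmp; exact: mexp_entry.
Qed.

Lemma iter_scale (A : 'End(V)) t k x : iter k (t *: A) x = t ^+ k *: iter k A x.
Proof.
elim: k => [|k IH]; first by rewrite expr0 scale1r.
by rewrite !iterS IH linearZ /= lfunE /= scalerA exprSr.
Qed.

Section Bounds.
Variables (A : 'End(V)) (K : R).
Hypotheses (K0 : 0 <= K) (hK : forall x, jnorm (A x) <= K * jnorm x).

Lemma iter_bound k x : jnorm (iter k A x) <= K ^+ k * jnorm x.
Proof.
elim: k => [|k IH]; first by rewrite expr0 mul1r.
by rewrite iterS exprS -mulrA (le_trans (hK _)) // ler_wpM2l.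
Qed.

Lemma expEnd_norm t x : `|t| <= 1 -> jnorm (expEnd (t *: A) x) <= expR K * jnorm x.
Proof.
move=> t1; apply: jnorm_le_pairing => [|q]; first by rewrite mulr_ge0 ?expR_ge0 ?jnorm_ge0.
have := @expEnd_cvg (t *: A) x q => /cvg_norm /cvgr_to_le; apply; near=> N.
rewrite /= /series /= (le_trans (ler_norm_sum _ _ _)) //.
rewrite -mulrA (@le_trans _ _ (series (exp_coeff K) N * (jnorm x * jnorm q))) //; last first.
  by rewrite ler_wpM2r ?mulr_ge0 ?jnorm_ge0 ?exp_partial_le.
rewrite /series /= mulr_suml ler_sum // => k _.
rewrite iter_scale dotZl /exp_coeff /= normrM ger0_norm ?invr_ge0 //.
rewrite [X in _ <= X * _]mulrC -mulrA ler_wpM2l ?invr_ge0 // normrM normrX.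
rewrite (@le_trans _ _ (1 * `|'[iter k A x, q]|)) ?ler_wpM2r ?exprn_ile1 //.
rewrite mul1r (le_trans (dot_norm_le _ _ _)) // mulrA ler_wpM2r ?jnorm_ge0 //.
exact: iter_bound.
Unshelve. all: by end_near.
Qed.

Lemma expEnd_taylor t x : `|t| <= 1 ->
  jnorm (expEnd (t *: A) x - x - t *: A x) <= t ^+ 2 * expR K * jnorm x.
Proof.
move=> t1; apply: jnorm_le_pairing => [|q].
  by rewrite mulr_ge0 ?jnorm_ge0 // mulr_ge0 ?sqr_ge0 ?expR_ge0.
rewrite !dotDl !dotNl dotZl.
have : (fun N => series (fun k => k`!%:R^-1 * '[iter k (t *: A) x, q]) N - '[x, q]
    - t * '[A x, q]) @ \oo --> '[expEnd (t *: A) x, q] - '[x, q] - t * '[A x, q].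
  by apply: cvgB; [apply: cvgB; [exact: expEnd_cvg|exact: cvg_cst]|exact: cvg_cst].
move=> /cvg_norm /cvgr_to_le; apply; near=> N.
have N2 : (2 <= N)%N by near: N; exact: nbhs_infty_ge.
rewrite /= /series /=.
have -> : \sum_(0 <= k < N) k`!%:R^-1 * '[iter k (t *: A) x, q] - '[x, q] - t * '[A x, q]
   = \sum_(2 <= k < N) k`!%:R^-1 * '[iter k (t *: A) x, q].
  rewrite (@big_cat_nat _ _ _ 2) //= !big_nat_recr // big_geq //= add0r.
  rewrite fact0 invr1 !mul1r lfunE /= dotZl; ring.
have a0 : 0 <= t ^+ 2 by exact: sqr_ge0.
have ta k : (2 <= k)%N -> `|t| ^+ k <= t ^+ 2.
  move=> k2; rewrite -(subnKC k2) exprD -[leRHS]mulr1 -(real_normK (num_real t)).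
  by rewrite ler_wpM2l ?exprn_ge0 ?exprn_ile1.
move: (t ^+ 2) a0 ta => a a0 ta.
have b0 : 0 <= jnorm x * jnorm q by rewrite mulr_ge0 ?jnorm_ge0.
have tm k : (2 <= k < N)%N -> `|k`!%:R^-1 * '[iter k (t *: A) x, q]| <=
    a * (jnorm x * jnorm q) * exp_coeff K k.
  move=> /andP [k2 _]; rewrite iter_scale dotZl /exp_coeff /= normrM.
  rewrite ger0_norm ?invr_ge0 // mulrA [leRHS]mulrC ler_wpM2l ?invr_ge0 //.
  rewrite normrM normrX [leRHS]mulrAC -mulrA ler_pM ?exprn_ge0 ?ta //.
  by rewrite (le_trans (dot_norm_le _ _ _)) // mulrA ler_wpM2r ?jnorm_ge0 ?iter_bound.
rewrite (le_trans (ler_norm_sum _ _ _)) //.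
rewrite (le_trans (ler_sum_nat tm)) // -mulr_sumr.
have -> : a * expR K * jnorm x * jnorm q = a * (jnorm x * jnorm q) * expR K by ring.
rewrite ler_wpM2l ?(mulr_ge0 a0) // (le_trans _ (exp_partial_le N K0)) //.
rewrite /series /= [leRHS](@big_cat_nat _ _ _ 2) //= ler_wpDl //.
by apply: sumr_ge0 => k _; exact: exp_coeff_ge0.
Unshelve. all: by end_near.
Qed.
End Bounds.
End ExpEnd.

#[local] Opaque expEnd.

(** * Infinitesimal description of the two cones of operators *)

Section CrossPositive.
Variables (R : realType) (V : vectType R) (J : euclideanJordanAlgebra V).

Local Notation "''[' x , y ]" := (jdot J x y).
Local Notation jnorm := (jnorm J).
Local Notation C := (jsquares J).

(** The infinitesimal form of preserving the cone: at a boundary point p, with q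
    normal to a supporting hyperplane, the velocity A p does not point outwards. *)
Definition cross_positive (A : 'End(V)) :=
  forall p q, C p -> C q -> '[p, q] = 0 -> 0 <= '[A p, q].

(** The function t |-> <exp(tA) p, q> is nonnegative for t >= 0 and vanishes at 0,
    so its derivative there is nonnegative. *)
Lemma cone_s_cross_positive A : cone_s C A -> cross_positive A.
Proof.
move=> sA p q Cp Cq pq; have [K K0 hK] := lfun_bounded J A.
pose c := expR K * jnorm p * jnorm q.
have c0 : 0 <= c by rewrite !mulr_ge0 ?expR_ge0 ?jnorm_ge0.
have h t : 0 < t -> t <= 1 -> - (c * t) <= '[A p, q].
  move=> t0 t1.
  have e0 : 0 <= '[expEnd (t *: A) p, q].
    by apply: jsquares_dot_ge0 => //; apply: (sA t (ltW t0)); exists p.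
  have := expEnd_taylor K0 hK p (t := t); rewrite ger0_norm ?(ltW t0) // => /(_ t1) h1.
  have := dot_norm_le J (expEnd (t *: A) p - p - t *: A p) q.
  move=> /(le_trans) /(_ (ler_wpM2r (jnorm_ge0 J q) h1)).
  rewrite !dotE pq oppr0 addr0 => /(le_trans (ler_norm _)) h2.
  have {}h2 : 0 <= t * ('[A p, q] + c * t).
    by move: h2; rewrite /c expr2; move: e0; nra.
  by move: h2; rewrite pmulr_rge0 //; lra.
rewrite leNgt; apply/negP => neg.
pose t := Num.min 1 (- '[A p, q] / (2 * (c + 1))).
have c1 : 0 < c + 1 by rewrite ltr_wpDl.
have t0 : 0 < t by rewrite lt_min ltr01 divr_gt0 ?oppr_gt0 // mulr_gt0.
have := h t t0; rewrite ge_min lexx => /(_ isT).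
have : t * (2 * (c + 1)) <= - '[A p, q].
  by rewrite -ler_pdivlMr ?mulr_gt0 // ge_min lexx orbT.
nra.
Qed.

Section Resolvent.
Variables (A : 'End(V)) (K h : R).
Hypotheses (K0 : 0 <= K) (hK : forall x, jnorm (A x) <= K * jnorm x).
Hypotheses (h0 : 0 <= h) (hK2 : 2 * (h * K) <= 1).

Definition resolvent : 'End(V) := ((\1 - h *: A)^-1)%VF.

Lemma resolvent_norm x : jnorm x <= (1 + 2 * (h * K)) * jnorm (x - h *: A x).
Proof.
have hx : jnorm x <= jnorm (x - h *: A x) + h * K * jnorm x.
  have := jnormD J (x - h *: A x) (h *: A x); rewrite subrK => /le_trans; apply.
  by rewrite lerD2l jnormZ ger0_norm // -mulrA ler_wpM2l.
have := jnorm_ge0 J x; have := jnorm_ge0 J (x - h *: A x).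
have : 0 <= h * K by rewrite mulr_ge0.
move: hK2 hx; set a := jnorm x; set b := jnorm _.
move: (h * K) => k k2 ab k0 b0 a0.
have : 0 <= (1 + 2 * k) * (b + k * a - a) by rewrite mulr_ge0; lra.
have : 0 <= k * (1 - 2 * k) * a by rewrite !mulr_ge0 // subr_ge0.
lra.
Qed.

Lemma resolventK x : resolvent x - h *: A (resolvent x) = x.
Proof.
have kf : lker (\1 - h *: A)%VF == 0%VS.
  apply/eqP/vspaceP => y; rewrite memv_ker memv0; apply/eqP/eqP => [|->]; last by rewrite linear0.
  rewrite add_lfunE opp_lfunE scale_lfunE id_lfunE => y0.
  have := resolvent_norm y; rewrite y0 jnorm0 mulr0 => y1.
  by apply: (@jnorm0_eq0 _ _ J); apply/eqP; rewrite eq_le y1 jnorm_ge0.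
by have := lker0_lfunVK kf x; rewrite add_lfunE opp_lfunE scale_lfunE id_lfunE.
Qed.

(** Write y = (1 - hA)^-1 x as p - q with p, q orthogonal in the cone. Pairing x =
    y - hAy with q yields 0 <= - |q|^2 - h <A p, q> + h <A q, q>, where the middle
    term is nonpositive and the last one is at most |q|^2 / 2. *)
Lemma resolvent_cone x : cross_positive A -> C x -> C (resolvent x).
Proof.
move=> cA Cx; set y := resolvent x; have yx : y - h *: A y = x := resolventK x.
have [p [q [Cp Cq pq yE]]] := jordan_decomposition J y.
suff q0 : q = 0 by rewrite yE q0 subr0.
move: Cx; rewrite -yx => Cx; have := jsquares_dot_ge0 Cx Cq.
have := cA p q Cp Cq pq; have := dot_norm_le J (A q) q.
rewrite yE !linearB /= !dotE pq => h1 h2 h3.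
have h4 : `|'[A q, q]| <= K * '[q, q].
  by rewrite (le_trans h1) // -jnorm_sq mulrA ler_wpM2r ?jnorm_ge0.
have := ler_norm '[A q, q]; move=> h5; apply: (@dot_le0 _ _ J).
have := dot_ge0 J q; move: h2 h3 h4 h5 hK2 h0 K0.
set a := '[A p, q]; set b := '[A q, q]; set d := '[q, q] => *; nra.
Qed.

(** One step of the implicit Euler scheme has an error of second order. *)
Lemma exp_resolvent x : h <= 1 -> jnorm (expEnd (h *: A) x - resolvent x) <=
  h ^+ 2 * ((expR K + (expR K + K) * K) * (1 + 2 * (h * K))) * jnorm x.
Proof.
move=> h1; set z := resolvent x; have zx : z - h *: A z = x := resolventK x.
have hz : jnorm z <= (1 + 2 * (h * K)) * jnorm x by rewrite -zx resolvent_norm.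
have habs : `|h| <= 1 by rewrite ger0_norm.
have -> : expEnd (h *: A) x - z = (expEnd (h *: A) z - z - h *: A z)
   - h *: ((expEnd (h *: A) (A z) - A z - h *: A (A z)) + h *: A (A z)).
  apply: (@dot_ext _ _ J) => q.
  by rewrite -[in LHS]zx linearB linearZ /= !dotE; ring.
have b1 := expEnd_taylor K0 hK z habs.
have b2 := expEnd_taylor K0 hK (A z) habs.
have b3 : jnorm (A (A z)) <= K * (K * jnorm z).
  by rewrite (le_trans (hK _)) // ler_wpM2l.
rewrite (le_trans (jnormB _ _ _)) // jnormZ ger0_norm //.
have b4 := jnormD J (expEnd (h *: A) (A z) - A z - h *: A (A z)) (h *: A (A z)).
rewrite jnormZ ger0_norm // in b4.
have e0 := expR_ge0 K; have z0 := jnorm_ge0 J z; have x0 := jnorm_ge0 J x.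
have hAz := hK z.
have b5 : jnorm (expEnd (h *: A) (A z) - A z - h *: A (A z) + h *: A (A z)) <=
   h * ((expR K + K) * K * jnorm z).
  rewrite (le_trans b4) // [_ + K]addrC !mulrDl mulrDr addrC lerD //.
    by rewrite ler_wpM2l // (le_trans b3) // mulrA.
  rewrite (le_trans b2) // expr2 -!mulrA ler_wpM2l //.
  rewrite -[leRHS]mul1r ler_pM ?mulr_ge0 ?jnorm_ge0 //.
  by rewrite ler_wpM2l.
rewrite (@le_trans _ _ (h ^+ 2 * (expR K + (expR K + K) * K) * jnorm z)) //.
  rewrite mulrDr mulrDl lerD // expr2 -!mulrA ler_wpM2l // (le_trans b5) //.
  by rewrite !mulrA.
rewrite -!mulrA ler_wpM2l ?sqr_ge0 // ler_wpM2l //.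
by rewrite ler_wpM2l // addr_ge0 // mulr_ge0 // addr_ge0.
Qed.

(** The errors of m steps add up, each one amplified by at most the norms of the
    other factors. *)
Lemma exp_resolvent_iter m x : h * m%:R <= 1 ->
  jnorm (expEnd ((h * m%:R) *: A) x - iter m resolvent x) <=
  m%:R * (h ^+ 2 * (expR K * (expR K + (expR K + K) * K))) *
    (1 + 2 * (h * K)) ^+ m * jnorm x.
Proof.
elim: m x => [|m IH] x hm.
  by rewrite mulr0 expEnd0 subrr jnorm0 !mul0r.
have hm' : h * m%:R <= 1.
  by rewrite (le_trans _ hm) // ler_wpM2l // ler_nat.
have h1 : h <= 1.
  by rewrite (le_trans _ hm) // ler_peMr // ler1n.
have hm0 : 0 <= h * m%:R by rewrite mulr_ge0.
have -> : expEnd ((h * m.+1%:R) *: A) x - iter m.+1 resolvent x =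
   expEnd ((h * m%:R) *: A) (expEnd (h *: A) x - resolvent x) +
   (expEnd ((h * m%:R) *: A) (resolvent x) - iter m resolvent (resolvent x)).
  have -> : h * m.+1%:R = h * m%:R + h by rewrite -natr1 mulrDr mulr1.
  have -> : iter m.+1 resolvent x = iter m resolvent (resolvent x) := iterSr _ _ _.
  move: (h * m%:R) (iter m resolvent (resolvent x)) => s w.
  transitivity (expEnd (s *: A) (expEnd (h *: A) x) - w).
    by congr (_ - _); exact: esym (expEndD A s h x).
  have split_at (E : 'End(V)) (u r y : V) : E u - y = E (u - r) + (E r - y).
    by rewrite linearB addrA subrK.
  exact: split_at.
rewrite (le_trans (jnormD _ _ _)) //.
have c1 : 1 <= 1 + 2 * (h * K) by rewrite lerDl !mulr_ge0.
have c0 : 0 <= 1 + 2 * (h * K) by rewrite (le_trans ler01).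
have e0 := expR_ge0 K.
have x0 := jnorm_ge0 J x.
have hR : jnorm (resolvent x) <= (1 + 2 * (h * K)) * jnorm x.
  by have := resolvent_norm (resolvent x); rewrite resolventK.
have t1 := expEnd_norm K0 hK (expEnd (h *: A) x - resolvent x) (t := h * m%:R).
rewrite ger0_norm // in t1; have {}t1 := t1 hm'.
have t2 := exp_resolvent x h1; have t3 := IH (resolvent x) hm'.
rewrite -natr1 mulrDl mulrDl mulrDl mul1r addrC lerD //.
  have mono (a r u w : R) : 0 <= a -> 0 <= r -> u <= r * w ->
      a * r ^+ m * u <= a * r ^+ m.+1 * w.
    move=> a0 r0 uw; rewrite exprSr -!mulrA ler_wpM2l // ler_wpM2l ?exprn_ge0 //.
  rewrite (le_trans t3) // mono // mulr_ge0 // mulr_ge0 ?sqr_ge0 //.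
  by rewrite mulr_ge0 // addr_ge0 // mulr_ge0 // addr_ge0.
rewrite (le_trans t1) // (@le_trans _ _ (expR K * (h ^+ 2 *
   ((expR K + (expR K + K) * K) * (1 + 2 * (h * K))) * jnorm x))) ?ler_wpM2l //.
set B := expR K + _; have B0 : 0 <= B by rewrite /B ?addr_ge0 ?mulr_ge0 ?addr_ge0.
rewrite (_ : expR K * _ = h ^+ 2 * (expR K * B) * (1 + 2 * (h * K)) * jnorm x); last by ring.
rewrite ler_wpM2r // ler_wpM2l ?mulr_ge0 ?sqr_ge0 //.
by rewrite exprS ler_peMr // exprn_ege1.
Qed.
End Resolvent.

(** The exponential is the limit of the powers of the resolvents (1 - A/n)^-1,
    which preserve the cone, and the cone is closed, being defined by the
    inequalities of jsquaresP. *)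
Lemma cross_positive_exp A x : cross_positive A -> C x -> C (expEnd A x).
Proof.
move=> cA Cx; have [K K0 hK] := lfun_bounded J A.
apply/jsquaresP => q Cq.
pose D := (expR K * (expR K + (expR K + K) * K)) * expR (2 * K) * jnorm x * jnorm q.
have D0 : 0 <= D by rewrite !mulr_ge0 ?expR_ge0 ?jnorm_ge0 ?addr_ge0 ?mulr_ge0 ?addr_ge0 ?expR_ge0.
have main n : (2 * K <= n.+1%:R) -> - D <= n.+1%:R * '[expEnd A x, q].
  move=> nK; pose h : R := n.+1%:R^-1.
  have h0 : 0 <= h by rewrite invr_ge0.
  have hn : h * n.+1%:R = 1 by rewrite mulVf // pnatr_eq0.
  have hK2 : 2 * (h * K) <= 1.
    by rewrite mulrCA mulrC /h ler_pdivrMr // mul1r.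
  have Ci m : C (iter m (resolvent A h) x).
    by elim: m => //= m IH; apply: (resolvent_cone K0 hK h0 hK2).
  have := exp_resolvent_iter K0 hK h0 hK2 x (m := n.+1); rewrite hn => /(_ (lexx _)).
  rewrite scale1r => b1.
  have b2 : (1 + 2 * (h * K)) ^+ n.+1 <= expR (2 * K).
    have -> : 2 * K = n.+1%:R * (2 * (h * K)).
      by rewrite mulrCA [n.+1%:R * _]mulrA [n.+1%:R * h]mulrC hn mul1r.
    rewrite expRM_natl lerXn2r ?nnegrE ?expR_ge0 ?expR_ge1Dx //.
    by rewrite addr_ge0 // !mulr_ge0.
  have := dot_norm_le J (expEnd A x - iter n.+1 (resolvent A h) x) q.
  move=> /le_trans/(_ (ler_wpM2r (jnorm_ge0 J q) b1)).
  rewrite dotDl dotNl => b3.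
  have b4 := jsquares_dot_ge0 (Ci n.+1) Cq.
  have b5 : n.+1%:R * (h ^+ 2 * (expR K * (expR K + (expR K + K) * K))) *
     (1 + 2 * (h * K)) ^+ n.+1 * jnorm x * jnorm q <= h * D.
    rewrite expr2 -(mulrA h h) (mulrA n.+1%:R h) (mulrC n.+1%:R h) hn mul1r /D.
    rewrite -!(mulrA h) ler_wpM2l // ler_wpM2r ?jnorm_ge0 // ler_wpM2r ?jnorm_ge0 //.
    by rewrite ler_wpM2l // mulr_ge0 ?expR_ge0 ?addr_ge0 ?mulr_ge0 ?addr_ge0 ?expR_ge0.
  have {b3}b3 := le_trans b3 b5; rewrite ler_norml in b3; case/andP: b3 => b3 _.
  have : n.+1%:R * (- (h * D)) <= n.+1%:R * '[expEnd A x, q] by rewrite ler_wpM2l //; lra.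
  by rewrite mulrN mulrA (mulrC _ h) hn mul1r.
rewrite leNgt; apply/negP => neg.
pose b := Num.max (2 * K) ((D + 1) / - '[expEnd A x, q]).
have [n nb] : exists n, b <= n.+1%:R.
  exists (Num.truncn b); exact/ltW/truncnS_gt.
move: nb; rewrite ge_max => /andP [n1 n2].
have := main n n1; move: n2; rewrite ler_pdivrMr ?oppr_gt0 // mulrN; lra.
Qed.

Lemma cross_positiveZ A t : 0 <= t -> cross_positive A -> cross_positive (t *: A).
Proof.
by move=> t0 cA p q Cp Cq pq; rewrite lfunE /= dotZl mulr_ge0 // cA.
Qed.

Lemma cone_sE A : cone_s C A <-> cross_positive A.
Proof.
split; first exact: cone_s_cross_positive.
move=> cA t t0 _ [x Cx <-]; apply: cross_positive_exp => //.
exact: cross_positiveZ.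
Qed.

Definition cross_zero (A : 'End(V)) :=
  forall p q, C p -> C q -> '[p, q] = 0 -> '[A p, q] = 0.

Lemma cone_gE A : cone_g C A <-> cross_zero A.
Proof.
split=> [gA|zA].
  have h B : (forall t, coneG C (expEnd (t *: B))) -> cross_positive B.
    move=> hB; apply: cone_s_cross_positive => t _; case: (hB t) => _ eC.
    by rewrite /coneEnd /mkset eC.
  have h1 := h A gA; have h2 : cross_positive (- A).
    by apply: h => t; rewrite scalerN -scaleNr.
  move=> p q Cp Cq pq; apply/eqP; rewrite eq_le h1 // andbT.
  by have := h2 p q Cp Cq pq; rewrite opp_lfunE dotNl oppr_ge0.
have sub t : [set expEnd (t *: A) x | x in C] `<=` C.
  move=> _ [x Cx <-]; apply: cross_positive_exp => // p q Cp Cq pq.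
  by rewrite lfunE /= dotZl zA // mulr0.
have inv t x : expEnd (t *: A) (expEnd (- t *: A) x) = x.
  by rewrite expEndD subrr expEnd0.
move=> t; split.
  exists (expEnd (- t *: A)) => x; last exact: inv.
  by have := inv (- t) x; rewrite opprK.
apply/seteqP; split=> [|x Cx]; first exact: sub.
exists (expEnd (- t *: A) x); last exact: inv.
by apply: (sub (- t)); exists x.
Qed.

Lemma coneEnd_cross_positive A : coneEnd C A -> cross_positive A.
Proof.
by move=> EA p q Cp Cq _; apply: jsquares_dot_ge0 => //; apply: EA; exists p.
Qed.

Lemma coneEnd_addg_sub :
  [set A1 + A2 | A1 in coneEnd C & A2 in cone_g C] `<=` cone_s C.
Proof.
move=> _ [A1 E1 [A2 /cone_gE g2 <-]]; apply/cone_sE => p q Cp Cq pq.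
by rewrite add_lfunE dotDl g2 // addr0 (coneEnd_cross_positive E1).
Qed.
End CrossPositive.

(** * Operators of rank one *)

Section RankOne.
Variables (R : realType) (V : vectType R) (J : euclideanJordanAlgebra V).
Definition dot_scale (a b x : V) := jdot J x a *: b.

Lemma dot_scale_linear a b : linear (dot_scale a b).
Proof. by move=> k x y; rewrite /dot_scale !dotE scalerDl scalerA. Qed.

HB.instance Definition _ a b := GRing.isLinear.Build R V V _ (dot_scale a b)
  (@dot_scale_linear a b).

Definition dyad a b : 'End(V) := linfun (dot_scale a b).

Lemma dyadE a b x : dyad a b x = jdot J x a *: b.
Proof. by rewrite lfunE. Qed.
End RankOne.

(** * Rank at most two: the Lorentz cone *)

(** The scalar part of spin_null_image. The last hypothesis is the positivity of S
    at the point with parameter t = 1/c of the null curve; for c large its terms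
    of second and higher order in t are at most t o. *)
Lemma null_curve_estimate (R : realFieldType) (K c n f o r Tx Sww Swx Ssx : R) :
  0 <= K -> 1 + 2 * K + K ^+ 2 + K ^+ 3 <= c -> 0 < n ->
  0 <= o -> o <= K ^+ 2 * (2 * n) -> r * (4 * n) = c^-1 ^+ 2 * o ->
  Tx <= K * (2 * n) -> - Sww <= K * o -> Swx <= K ^+ 2 * (2 * n) ->
  Ssx <= K * (2 * n) ->
  0 <= f - 2 * c^-1 * o + 2 * r * Tx - c^-1 ^+ 2 * Sww + 2 * c^-1 * r * Swx
     + r ^+ 2 * Ssx ->
  o <= c * f.
Proof.
move=> K0 hc n0 o0 oK rE b1 b2 b3 b4.
have c1 : 1 <= c.
  by rewrite (le_trans _ hc) // -!addrA lerDl !addr_ge0 ?exprn_ge0 ?mulr_ge0.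
have c0 : 0 < c := lt_le_trans ltr01 c1.
set t := c^-1 in rE *; have ct : c * t = 1 by rewrite mulfV // gt_eqF.
have t0 : 0 <= t by rewrite invr_ge0 ltW.
have t1 : t <= 1 by rewrite invf_le1.
clearbody t => hz.
have r0 : 0 <= r.
  by rewrite -(@pmulr_lge0 _ (4 * n)) ?mulr_gt0 // rE mulr_ge0 // sqr_ge0.
pose Q := t ^+ 2 * o.
have Q0 : 0 <= Q by rewrite mulr_ge0 ?sqr_ge0.
have Qo : Q <= o by rewrite ler_piMl // exprn_ile1.
have rQ m : r * (m * (2 * n)) = Q * m / 2.
  by rewrite /Q -rE; field.
have i1 : 2 * r * Tx <= Q * K.
  by have := ler_wpM2l r0 b1; rewrite rQ; clear; lra.
have i2 : t ^+ 2 * - Sww <= Q * K.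
  by have := ler_wpM2l (sqr_ge0 t) b2; rewrite /Q; clear; lra.
have i3 : 2 * t * r * Swx <= Q * K ^+ 2.
  have := ler_wpM2l r0 b3; rewrite rQ => j1.
  have j2 : t * (r * Swx) <= t * (Q * K ^+ 2 / 2) by rewrite ler_wpM2l.
  have j3 : t * (Q * K ^+ 2) <= Q * K ^+ 2 by rewrite ler_piMl // mulr_ge0 // sqr_ge0.
  by move: j2 j3; clear; lra.
have i4 : r ^+ 2 * Ssx <= Q * K ^+ 3.
  have rK : r <= K ^+ 2 / 2.
    rewrite -(@ler_pM2r _ (4 * n)) ?mulr_gt0 // rE (le_trans Qo) //.
    by rewrite (le_trans oK) //; clear; lra.
  have := ler_wpM2l r0 (ler_wpM2l r0 b4); rewrite rQ => j1.
  have j2 : r * (Q * K / 2) <= K ^+ 2 / 2 * (Q * K / 2).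
    by rewrite ler_wpM2r // divr_ge0 // mulr_ge0.
  have j3 : 0 <= Q * K ^+ 3 by rewrite mulr_ge0 // exprn_ge0.
  have -> : r ^+ 2 * Ssx = r * (r * Ssx) by ring.
  rewrite (le_trans j1) // (le_trans j2) //.
  have -> : K ^+ 2 / 2 * (Q * K / 2) = Q * K ^+ 3 / 4 by field.
  by move: j3; clear; lra.
have h4 : Q * (2 * K + K ^+ 2 + K ^+ 3) <= Q * c.
  by rewrite ler_wpM2l //; move: hc; clear; lra.
have h5 : Q * c = t * o by rewrite /Q -[RHS]mul1r -ct; ring.
have h6 : t * o <= f.
  by move: hz i1 i2 i3 i4 h4; rewrite h5; clear; lra.
by have := ler_wpM2l (ltW c0) h6; rewrite mulrA ct mul1r.
Qed.

Section RankTwo.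
Variables (R : realType) (V : vectType R) (J : euclideanJordanAlgebra V).

Local Notation "x ∘ y" := (jmul J x y) (at level 40, left associativity).
Local Notation "''[' x , y ]" := (jdot J x y).
Local Notation jnorm := (jnorm J).
Local Notation e := (jone J).
Local Notation C := (jsquares J).
Local Notation N0 := '[e, e].

Lemma jrank_le2_sq x : (jrank J <= 2)%N -> exists a b, x ∘ x = a *: x + b *: e.
Proof.
have [p pP] := jminpoly_exists J x; case: (pP) => pm p0 _.
have sp0 : (0 < size p)%N by rewrite size_poly_gt0 monic_neq0.
rewrite /jrank; case: ex_maxnP => d _ dmax d2.
have sp : (size p <= 3)%N.
  rewrite -(prednK sp0) ltnS (leq_trans _ d2) // dmax //.
  by apply/asboolP; exists x, p; rewrite prednK.
pose q := p * 'X^(3 - size p).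
have qm : q \is monic by rewrite monicMr ?monicXn.
have sq : size q = 3%N by rewrite size_Mmonic ?monic_neq0 ?monicXn // size_polyXn; lia.
have q2 : q`_2 = 1 by move: qm; rewrite monicE lead_coefE sq => /eqP.
have : jhorner J q x = 0 by rewrite jhornerM p0 jmul0l.
rewrite (@jhornerE _ _ _ 3) ?sq // !big_ord_recl big_ord0 /= /bump /= q2 scale1r /jpow /=.
rewrite jmulx1 addr0 => h; exists (- q`_1), (- q`_0).
apply: (@dot_ext _ _ J) => y; have := congr1 (jdot J ^~ y) h.
rewrite /= addn0 !dotE; lra.
Qed.

Hypothesis Jsimple : jsimple J.
Hypothesis sq_span : forall x, exists a b, x ∘ x = a *: x + b *: e.

(** Let w^2 = a w + b e with w orthogonal to e; one has to show a = 0. If some v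
    is orthogonal to both e and w, then comparing the squares of w, v and w + v
    shows that a is the coefficient of v in v^2 and likewise that of -v in (-v)^2,
    which is its opposite. Otherwise e and w span V, and a root of T^2 - a T - b
    gives an eigenvector of multiplication by w, hence a proper ideal. *)
Lemma traceless_sq w : '[w, e] = 0 -> w ∘ w = ('[w, w] / N0) *: e.
Proof.
move=> we; have [->|w0] := eqVneq w 0; first by rewrite dot0l mul0r jmul0l scale0r.
have wp := dot_gt0 J w0.
have e0 : e != 0 by apply: contraNneq w0 => e0; rewrite -(jmul1x J w) e0 jmul0l.
have ep := dot_gt0 J e0.
have [a [b ab]] := sq_span w.
have bE : '[w, w] = b * N0.
  have := congr1 (jdot J ^~ e) ab; rewrite /= dotM jmulx1 => ->.
  by rewrite !dotE we mulr0 add0r.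
have key v a' b' : v != 0 -> '[v, e] = 0 -> '[v, w] = 0 ->
    v ∘ v = a' *: v + b' *: e -> a = a'.
  move=> v0 ve vw vv; have vp := dot_gt0 J v0.
  have [a1 [b1]] := sq_span (w + v); rewrite !jmulE (jmulC J v w) ab vv => h.
  have hw := congr1 (jdot J ^~ w) h; have hv := congr1 (jdot J ^~ v) h.
  have xw : '[w ∘ v, w] = 0 by rewrite dotM dotC ab !dotE dotC vw dotC ve; ring.
  have xv : '[w ∘ v, v] = 0 by rewrite jmulC dotM dotC vv !dotE vw dotC we; ring.
  move: hw hv; rewrite /= !dotE xw xv vw (dotC J w v) vw (dotC J e) we (dotC J e) ve.
  rewrite !mulr0 !addr0 !add0r => /(mulIf (lt0r_neq0 wp)) -> .
  by move=> /(mulIf (lt0r_neq0 vp)) ->.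
have -> : '[w, w] / N0 = b by rewrite bE mulfK // gt_eqF.
suff a0 : a = 0 by rewrite ab a0 scale0r add0r.
have [[v [v0 ve vw]]|nov] := pselect (exists v, [/\ v != 0, '[v, e] = 0 & '[v, w] = 0]).
  have [a' [b' vv]] := sq_span v.
  have h1 := key v a' b' v0 ve vw vv.
  have h2 : a = - a'.
    apply: (key (- v) (- a') b'); rewrite ?oppr_eq0 ?dotNl ?ve ?vw ?oppr0 //.
    by rewrite jmulNl jmulNr opprK vv scalerN scaleNr opprK.
  by lra.
exfalso.
pose D := a ^+ 2 + 4 * b.
have b0 : 0 < b by move: wp; rewrite bE pmulr_lgt0.
have D0 : 0 <= D by rewrite addr_ge0 ?sqr_ge0 // mulr_ge0 // ltW.
pose s := Num.sqrt D; have ss : s * s = D by rewrite -expr2 sqr_sqrtr.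
pose r1 := (a + s) / 2; pose r2 := (a - s) / 2.
pose g := w - r2 *: e.
have rs : a - r2 = r1 by rewrite /r1 /r2; lra.
have rr : b = - r1 * r2 by move: ss; rewrite /r1 /r2 /D; nra.
have wg : w ∘ g = r1 *: g.
  rewrite /g jmulDr ab jmulNr jmulZr jmulx1 scalerBr scalerA -rs rr -rs.
  by rewrite mulNr scaleNr scalerBl addrAC.
have span x : x = ('[x, e] / N0) *: e + ('[x, w] / '[w, w]) *: w.
  apply/eqP; rewrite -subr_eq0; apply: contrapT => /negP x0; apply: nov.
  exists (x - (('[x, e] / N0) *: e + ('[x, w] / '[w, w]) *: w)); split=> //.
    by rewrite !dotE we mulr0 addr0 divfK ?subrr // gt_eqF.
  by rewrite !dotE (dotC J e) we mulr0 add0r divfK ?subrr // gt_eqF.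
have id_g : jideal J <[g]>%VS.
  move=> x _ /vlineP [k ->]; rewrite jmulZr memvZ //.
  rewrite [x in x ∘ _]span jmulDl !jmulZl jmul1x wg scalerA -scalerDl.
  by rewrite memvZ // memv_line.
have gw : '[g, w] = '[w, w] by rewrite !dotE (dotC J e) we mulr0 oppr0 addr0.
case: (Jsimple id_g) => [g0|gV].
  have : g \in 0%VS by rewrite -g0 memv_line.
  by rewrite memv0 => /eqP g00; move: wp; rewrite -gw g00 dot0l ltxx.
have : e \in <[g]>%VS by rewrite gV memvf.
move=> /vlineP [k ek]; have := congr1 (jdot J ^~ w) ek.
rewrite /= dotZl gw dotC we => /esym/eqP; rewrite mulf_eq0 (gt_eqF wp) orbF => /eqP k0.
by move: e0; rewrite ek k0 scale0r eqxx.
Qed.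

Hypothesis e0 : e != 0.

Let ep : 0 < N0. Proof. exact: dot_gt0. Qed.

(** The inequality says that x has an angle of at most 45 degrees with e: the cone
    is a Lorentz cone. *)
Lemma spin_cone x : C x <-> 0 <= '[x, e] /\ N0 * '[x, x] <= 2 * '[x, e] ^+ 2.
Proof.
have nec y : C y -> 0 <= '[y, e] /\ N0 * '[y, y] <= 2 * '[y, e] ^+ 2.
  move=> Cy; split; first by apply: jsquares_dot_ge0 => //; exact: jsquares1.
  case: Cy => z _ <-; pose l := '[z, e] / N0; pose u := z - l *: e.
  have ue : '[u, e] = 0 by rewrite !dotE divfK ?subrr // gt_eqF.
  have zE : z = l *: e + u by rewrite addrC subrK.
  have uu := traceless_sq ue; clearbody u.
  have zz : z ∘ z = (l ^+ 2 + '[u, u] / N0) *: e + (2 * l) *: u.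
    rewrite zE !jmulE uu; apply: (@dot_ext _ _ J) => q; rewrite !dotE; ring.
  rewrite zz !dotE ue (dotC J e u) ue.
  have : '[u, u] / N0 * N0 = '[u, u] by rewrite divfK // gt_eqF.
  set k := '[u, u] / N0 => <-; rewrite -subr_ge0.
  rewrite [X in 0 <= X](_ : _ = (N0 * (l ^+ 2 - k)) ^+ 2); last by ring.
  exact: sqr_ge0.
split=> [/nec//|[x0 xx]]; apply/jsquaresP => q /nec [q0 qq].
pose u := N0 *: x - '[x, e] *: e; pose v := N0 *: q - '[q, e] *: e.
have uE : '[u, u] = N0 * (N0 * '[x, x] - '[x, e] ^+ 2).
  by rewrite !dotE (dotC J e x); ring.
have vE : '[v, v] = N0 * (N0 * '[q, q] - '[q, e] ^+ 2).
  by rewrite !dotE (dotC J e q); ring.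
have uvE : '[u, v] = N0 * (N0 * '[x, q] - '[x, e] * '[q, e]).
  by rewrite !dotE (dotC J e q); ring.
have v0 := dot_ge0 J v.
have := cauchy_schwarz J u v; rewrite {}uE {}uvE vE; rewrite vE in v0 *.
clear u v vE.
move: ep x0 q0 xx qq; set n := N0; set X := '[x, e]; set Q := '[q, e].
set xx := '[x, x]; set qq := '[q, q]; set xq := '[x, q] => n0 X0 Q0 hx hq h.
rewrite leNgt; apply/negP => neg.
have n2 : 0 < n ^+ 2 by rewrite exprn_gt0.
have h' : (n * xq - X * Q) ^+ 2 <= (n * xx - X ^+ 2) * (n * qq - Q ^+ 2).
  by rewrite -(ler_pM2l n2); apply: le_trans (le_trans h _); rewrite le_eqVlt; apply/orP; left; apply/eqP; ring.
have h1 : (n * xx - X ^+ 2) * (n * qq - Q ^+ 2) <= X ^+ 2 * Q ^+ 2.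
  have [p1|p1] := leP 0 (n * xx - X ^+ 2); have [p2|p2] := leP 0 (n * qq - Q ^+ 2).
  - by apply: ler_pM => //; lra.
  - by rewrite (@le_trans _ _ 0) ?mulr_ge0 ?sqr_ge0 // mulr_ge0_le0 // ltW.
  - by rewrite (@le_trans _ _ 0) ?mulr_ge0 ?sqr_ge0 // mulr_le0_ge0 // ltW.
  - by move: v0; rewrite pmulr_rge0 // leNgt p2.
have XQ : 0 <= X * Q by rewrite mulr_ge0.
have nx : 0 < n * - xq by rewrite mulr_gt0 // oppr_gt0.
have : (X * Q) ^+ 2 < (n * xq - X * Q) ^+ 2 by rewrite !expr2; nra.
by rewrite ltNge exprMn (le_trans h' h1).
Qed.

(** The reflection that fixes e and changes the sign of its orthogonal complement;
    it exchanges the two eigenvalues of an element. *)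
Definition spin_conj x := (2 * '[x, e] / N0) *: e - x.
Local Notation sig := spin_conj.

Lemma spin_conjE x : sig x = (2 * '[x, e] / N0) *: e - x. Proof. by []. Qed.

Let sigE x y : '[x, sig y] = 2 * '[x, e] * '[y, e] / N0 - '[x, y].
Proof. by rewrite spin_conjE !dotE; ring. Qed.

Let sigC x y : '[x, sig y] = '[sig x, y].
Proof. by rewrite (dotC J (sig x)) !sigE (dotC J x y); ring. Qed.

Let sigK x : sig (sig x) = x.
Proof.
apply: (@dot_ext _ _ J) => q; rewrite -!sigC !sigE.
rewrite spin_conjE !dotE; move: (lt0r_neq0 ep) => n0; field; exact: n0.
Qed.

Let sigD x y : sig (x + y) = sig x + sig y.
Proof. by apply: (@dot_ext _ _ J) => q; rewrite !spin_conjE !dotE; ring. Qed.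

Let sigZ a x : sig (a *: x) = a *: sig x.
Proof. by apply: (@dot_ext _ _ J) => q; rewrite !spin_conjE !dotE; ring. Qed.

#[local] Opaque spin_conj.

(** Equality in the Cauchy-Schwarz inequality for the components orthogonal to e:
    the only elements of a Lorentz cone orthogonal to a boundary ray are those of
    the conjugate ray. *)
Lemma spin_orth p q : C p -> C q -> '[p, q] = 0 -> p = 0 \/ exists k, q = k *: sig p.
Proof.
move=> /spin_cone [p0 pp] /spin_cone [q0 qq] pq.
pose u := N0 *: p - '[p, e] *: e; pose v := N0 *: q - '[q, e] *: e.
have uE : '[u, u] = N0 * (N0 * '[p, p] - '[p, e] ^+ 2).
  by rewrite !dotE (dotC J e p); ring.
have vE : '[v, v] = N0 * (N0 * '[q, q] - '[q, e] ^+ 2).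
  by rewrite !dotE (dotC J e q); ring.
have uvE : '[u, v] = - N0 * ('[p, e] * '[q, e]).
  by rewrite !dotE pq (dotC J e q); ring.
have hu y : '[u, y] = N0 * '[p, y] - '[p, e] * '[e, y] by rewrite !dotE; ring.
have hv y : '[v, y] = N0 * '[q, y] - '[q, e] * '[e, y] by rewrite !dotE; ring.
clearbody u v.
have [P0|P0] := eqVneq '[p, e] 0.
  left; move: pp; rewrite P0 expr0n mulr0 pmulr_rle0 //.
  exact: dot_le0.
have z0 : '[q, e] *: u + '[p, e] *: v = 0.
  apply: (@dot_le0 _ _ J); rewrite !dotE (dotC J v u) uE vE uvE.
  move: pp qq ep; set n := N0; set P := '[p, e]; set Q := '[q, e].
  set P2 := '[p, p]; set Q2 := '[q, q] => pp qq n0.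
  rewrite [X in X <= 0](_ : _ = n * (Q ^+ 2 * (n * P2 - 2 * P ^+ 2) +
    P ^+ 2 * (n * Q2 - 2 * Q ^+ 2))); last by ring.
  rewrite pmulr_rle0 // -oppr_ge0 opprD -!mulrN addr_ge0 // mulr_ge0 ?sqr_ge0 //; lra.
right; exists ('[q, e] / '[p, e]); apply: (@dot_ext _ _ J) => y.
have := congr1 (jdot J ^~ y) z0; rewrite spin_conjE /= !dotE hu hv.
move: (lt0r_neq0 ep); set n := N0; set P := '[p, e] in P0 *; set Q := '[q, e].
set py := '[p, y]; set qy := '[q, y]; set ey := '[e, y] => n0 h.
apply: (mulfI n0); apply: (mulfI P0).
have -> : P * (n * (Q / P * (2 * P / n * ey - py))) = Q * (2 * P * ey - n * py).
  by field; rewrite n0 P0.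
lra.
Qed.

(** The spectral decomposition in the spin factor: every element of the cone is a
    nonnegative combination of two conjugate null vectors. *)
Lemma spin_null_decomposition w0 x : '[w0, e] = 0 -> w0 != 0 -> C x ->
  exists a b u, [/\ 0 <= a, 0 <= b, '[u, e] = 0, '[u, u] = N0 &
    x = a *: (e + u) + b *: (e - u)].
Proof.
move=> w0e w00 /spin_cone [x0 xx].
have unit w : '[w, e] = 0 -> w != 0 -> exists2 k, 0 < k & '[k *: w, k *: w] = N0.
  move=> we wn0; exists (Num.sqrt (N0 / '[w, w])).
    by rewrite sqrtr_gt0 divr_gt0 // dot_gt0.
  rewrite !dotE mulrA -expr2 sqr_sqrtr ?divr_ge0 ?dot_ge0 //.
  by rewrite divfK // gt_eqF // dot_gt0.
pose l := '[x, e] / N0; have l0 : 0 <= l by rewrite divr_ge0 // ltW.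
have lE : l * N0 = '[x, e] by rewrite divfK // gt_eqF.
pose w := x - l *: e.
have we : '[w, e] = 0 by rewrite !dotE lE subrr.
have xE : x = l *: e + w by rewrite addrC subrK.
have wwE : '[w, w] = '[x, x] - 2 * l * '[x, e] + l ^+ 2 * N0.
  by rewrite !dotE (dotC J e x); ring.
clearbody l w.
have ww : '[w, w] <= l ^+ 2 * N0.
  rewrite wwE -lE; move: xx ep; rewrite -lE.
  set n := N0; set k := '[x, x] => h n0.
  have : k <= 2 * l ^+ 2 * n by rewrite -(ler_pM2l n0); nra.
  nra.
have [wz|wn0] := eqVneq w 0.
  have [k k0 kw] := unit _ w0e w00.
  exists (l / 2), (l / 2), (k *: w0); split=> //; rewrite ?divr_ge0 //.
    by rewrite dotZl w0e mulr0.
  rewrite xE wz addr0; apply: (@dot_ext _ _ J) => q; rewrite !dotE; lra.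
have [k k0 kw] := unit _ we wn0.
have ki : k^-1 <= l.
  rewrite -(ler_pXn2r (n := 2)) ?nnegrE ?invr_ge0 ?(ltW k0) //.
  rewrite -(ler_pM2r ep) -[in leLHS]kw !dotE mulrA -expr2 mulrA -exprMn mulVf ?gt_eqF //.
  by rewrite expr1n mul1r.
exists ((l + k^-1) / 2), ((l - k^-1) / 2), (k *: w); split=> //.
- by rewrite divr_ge0 // addr_ge0 // invr_ge0 ltW.
- by rewrite divr_ge0 // subr_ge0.
- by rewrite dotZl we mulr0.
rewrite {1}xE; apply: (@dot_ext _ _ J) => q; rewrite !dotE.
set eq := '[e, q]; set wq := '[w, q].
by have kk : k != 0 := lt0r_neq0 k0; field.
Qed.

Section Decomposition.
Variables (S : 'End(V)) (K : R).
Hypotheses (Ssym : forall x y, '[S x, sig y] = '[S y, sig x]).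
Hypotheses (K0 : 0 <= K) (SK : forall x, jnorm (S x) <= K * jnorm x).
Hypothesis Spos : forall x, C x -> '[x, sig x] = 0 -> 0 <= '[S x, sig x].

(** For x = e + u null, write S x = b x + g sig x + w with w orthogonal to x and
    sig x. The points z = x + t w + (t^2 |w|^2 / 4 |e|^2) sig x are null, and
    <S z, sig z> >= 0 for small t bounds |w|^2 by a multiple of g. That bound is
    exactly what places S x + alpha x in the Lorentz cone, with alpha independent
    of u. *)
Lemma spin_null_image c u : 1 + 2 * K + K ^+ 2 + K ^+ 3 <= c ->
  '[u, e] = 0 -> '[u, u] = N0 -> C (S (e + u) + (2 * K + c) *: (e + u)).
Proof.
move=> hc.
have c1 : 1 <= c.
  by rewrite (le_trans _ hc) // -!addrA lerDl !addr_ge0 ?exprn_ge0 ?mulr_ge0.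
have [alpha alphaE] : {alpha | alpha = 2 * K + c} by exists (2 * K + c).
rewrite -alphaE.
move=> ue uu; pose x := e + u; pose T := S x; have TE' : T = S x by [].
have xe : '[x, e] = N0 by rewrite !dotE ue addr0.
have xx : '[x, x] = 2 * N0 by rewrite !dotE uu ue (dotC J e u) ue; ring.
have n0 := lt0r_neq0 ep.
have sx : sig x = e - u.
  rewrite spin_conjE xe mulfK // /x scaler_nat mulr2n opprD addrA addrK //.
have sxe : '[sig x, e] = N0 by rewrite sx !dotE ue subr0.
have eE : e = 2^-1 *: (x + sig x).
  by apply: (@dot_ext _ _ J) => q; rewrite sx !dotE; lra.
rewrite -/x -/T; clearbody T x.
have xs : '[x, sig x] = 0 by rewrite sigE xe xx; field.
have ss : '[sig x, sig x] = 2 * N0 by rewrite -sigC sigK.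
have sK : sig (sig x) = x := sigK x.
have [s xs' ] : {s | sig x = s} by exists (sig x).
rewrite xs' in sx sxe eE xs ss sK.
pose f := '[T, s]; have fE : '[T, s] = f by [].
 pose b := '[T, x] / (2 * N0); pose g := f / (2 * N0).
have bE : '[T, x] = b * (2 * N0) by rewrite divfK // mulf_neq0.
have gE : f = g * (2 * N0) by rewrite divfK // mulf_neq0.
pose w := T - b *: x - g *: s; clearbody f b g.
have wx : '[w, x] = 0 by rewrite !dotE bE xx (dotC J s) xs; ring.
have ws : '[w, s] = 0 by rewrite !dotE fE gE ss xs; ring.
have we : '[w, e] = 0.
  by rewrite eE dotZr dotDr wx ws addr0 mulr0.
have sw : sig w = - w by rewrite spin_conjE we mulr0 mul0r scale0r add0r.
have TE : T = b *: x + g *: s + w.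
  by apply: (@dot_ext _ _ J) => q; rewrite /w !dotE; ring.
clearbody w.
pose o := '[w, w]; have o0 : 0 <= o := dot_ge0 J w.
have Tw : '[T, w] = o by rewrite TE !dotE (dotC J x) wx (dotC J s) ws -/o; ring.
have TT : '[T, T] = 2 * N0 * (b ^+ 2 + g ^+ 2) + o.
  by rewrite {2}TE !dotE Tw bE fE gE; ring.
have TK : '[T, T] <= K ^+ 2 * (2 * N0).
  have := ler_pM (jnorm_ge0 J T) (jnorm_ge0 J T); rewrite jnorm_sq.
  by rewrite TE' => /(_ _ _ (SK x) (SK x)); rewrite mulrACA jnorm_sq xx expr2.
have oK : o <= K ^+ 2 * (2 * N0).
  rewrite (le_trans _ TK) // TT lerDr mulr_ge0 ?addr_ge0 ?sqr_ge0 //.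
  by rewrite mulr_ge0 // ltW.
have bd y z : jnorm y * jnorm z <= 2 * N0 -> '[S y, z] <= K * (2 * N0).
  move=> yz; rewrite (le_trans (ler_norm _)) // (le_trans (dot_norm_le _ _ _)) //.
  rewrite (@le_trans _ _ (K * (jnorm y * jnorm z))) ?ler_wpM2l //.
  by rewrite mulrA ler_wpM2r ?jnorm_ge0.
have nx : jnorm x * jnorm x = 2 * N0 by rewrite jnorm_sq.
have nsx : jnorm s = jnorm x by apply: jnorm_congr; rewrite ss xx.
have f0 : 0 <= f.
  rewrite -fE TE' -xs'; apply: Spos; last by rewrite xs'.
  by apply/spin_cone; rewrite xe xx expr2; split; [exact: ltW | rewrite mulrCA].
(* Positivity of S at a point z of the null curve through x with velocity w. *)
have fo : o <= c * f.
  pose t := c^-1; have c0 : 0 < c := lt_le_trans ltr01 c1.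
  have t0 : 0 < t by rewrite invr_gt0.
  have t1 : t <= 1 by rewrite invf_le1.
  pose r := t ^+ 2 * o / (4 * N0).
  have rE : r * (4 * N0) = t ^+ 2 * o by rewrite divfK // mulf_neq0.
  have r0 : 0 <= r by rewrite divr_ge0 ?mulr_ge0 ?sqr_ge0 // ltW.
  pose z := x + t *: w + r *: s.
  have ze : '[z, e] = N0 + r * N0 by rewrite !dotE xe we sxe; ring.
  have sz : sig z = s - t *: w + r *: x.
    by rewrite /z !sigD !sigZ xs' sw sK scalerN.
  have zs : '[z, sig z] = 0.
    rewrite sz /z !dotE xs xx wx ws ss (dotC J x w) wx (dotC J s w) ws.
    rewrite (dotC J s x) xs -/o; lra.
  have zz : N0 * '[z, z] = 2 * '[z, e] ^+ 2.
    move: zs; rewrite sigE => /eqP; rewrite subr_eq0 => /eqP <-.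
    by field.
  have Cz : C z.
    apply/spin_cone; rewrite zz; split=> //.
    by rewrite ze; exact: addr_ge0 (ltW ep) (mulr_ge0 r0 (ltW ep)).
  have := Spos Cz zs; rewrite sz /z !linearD !linearZ /= -TE'.
  rewrite !dotE fE Tw -/o.
  have h1 : '[S w, s] = - o by rewrite -xs' Ssym sw dotNr -TE' Tw.
  have h2 : '[S s, s] = '[T, x] by rewrite -{2}xs' Ssym sK TE'.
  have h3 : '[S s, w] = - '[S w, x].
    by have := Ssym s w; rewrite sw sK dotNr => <-; rewrite opprK.
  have b1 : '[T, x] <= K * (2 * N0) by rewrite TE'; apply: bd; rewrite nx.
  have b2 : - '[S w, w] <= K * o.
    rewrite (le_trans (ler_norm _)) // normrN (le_trans (dot_norm_le _ _ _)) //.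
    by rewrite /o -jnorm_sq mulrA ler_wpM2r ?jnorm_ge0.
  have nw : jnorm w <= K * jnorm x.
    rewrite -(ler_pXn2r (n := 2)) ?nnegrE ?mulr_ge0 ?jnorm_ge0 //.
    by rewrite exprMn !expr2 nx jnorm_sq -/o -expr2.
  have b3 : '[S w, x] <= K ^+ 2 * (2 * N0).
    rewrite (le_trans (ler_norm _)) // (le_trans (dot_norm_le _ _ _)) // -nx.
    rewrite mulrA ler_wpM2r ?jnorm_ge0 // (le_trans (SK _)) //.
    by rewrite expr2 -mulrA ler_wpM2l.
  have b4 : '[S s, x] <= K * (2 * N0) by apply: bd; rewrite nsx nx.
  rewrite h1 h2 h3.
  set Tx := '[T, x] in b1 *; set Sww := '[S w, w] in b2 *.
  set Swx := '[S w, x] in b3 *; set Ssx := '[S s, x] in b4 *.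
  move=> hz.
  apply: (null_curve_estimate K0 hc ep o0 oK rE b1 b2 b3 b4).
  by rewrite -/t; move: hz; lra.
have bK : `|b| <= K.
  have p2 : 0 < 2 * N0 by rewrite mulr_gt0.
  have : `|b * (2 * N0)| <= K * (2 * N0).
    rewrite -bE (le_trans (dot_norm_le _ _ _)) // -nx mulrA ler_wpM2r ?jnorm_ge0 //.
    by rewrite TE' SK.
  by rewrite normrM (gtr0_norm p2) ler_pM2r.
have al0 : 0 <= alpha by rewrite alphaE addr_ge0 ?mulr_ge0 // (le_trans ler01).
pose y := T + alpha *: x.
have Te : '[T, e] = (b + g) * N0.
  rewrite TE !dotE xe sxe we; ring.
have gg : 0 <= g by move: f0; rewrite gE pmulr_lge0 // mulr_gt0.
have ye : 0 <= '[y, e].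
  rewrite !dotE Te xe -mulrDl mulr_ge0 ?(ltW ep) //.
  by move: bK; rewrite ler_norml => /andP [bK _]; rewrite alphaE; lra.
have ys : 0 <= '[y, sig y].
  have sy : sig y = b *: s + g *: x - w + alpha *: s.
    by rewrite /y TE !sigD !sigZ xs' sw sK.
  rewrite sy /y !dotE fE bE Tw xs xx (dotC J x w) wx gE.
  have ho : o <= c * (g * (2 * N0)) by rewrite -gE.
  move: bK; rewrite ler_norml => /andP [bK _].
  have gn : 0 <= g * (2 * N0) by rewrite -gE.
  rewrite (mulrCA g b); move: (g * (2 * N0)) gn ho => G G0 ho.
  have h1 : 0 <= (2 * b + 2 * alpha - c) * G.
    by rewrite mulr_ge0 // alphaE; lra.
  by move: h1 ho; lra.
apply/spin_cone; rewrite -/y; split=> //.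
move: ys; rewrite sigE subr_ge0 => h.
have := ler_wpM2l (ltW ep) h.
by rewrite [X in _ <= X]mulrC divfK // expr2 mulrA.
Qed.
End Decomposition.

(** With B the adjoint of A, the operator S = (A + sig B sig) / 2 is the part of A
    that is symmetric for the form <., sig .>. The rest is skew, so it is
    cross-zero by spin_orth, and the multiple of the identity that moves S into
    End(C) is cross-zero as well. *)
Lemma spin_split A w0 : '[w0, e] = 0 -> w0 != 0 -> cross_positive J A ->
  exists A1 A2, [/\ coneEnd C A1, cross_zero J A2 & A1 + A2 = A].
Proof.
move=> w0e w00 cA; have [B BE] := adjoint_exists J A.
pose sigL := (2 / N0) *: dyad J e e - \1%VF.
have sigLE x : sigL x = sig x.
  rewrite spin_conjE !lfunE /= lfunE /= dyadE lfunE /= id_lfunE scalerA.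
  by congr (_ *: _ - _); ring.
pose S := 2^-1 *: (A + (sigL \o (B \o sigL)))%VF.
have SE x : S x = 2^-1 *: (A x + sig (B (sig x))).
  by rewrite !lfunE /= lfunE /= !comp_lfunE !sigLE.
have Sform x y : '[S x, sig y] = 2^-1 * ('[A x, sig y] + '[A y, sig x]).
  rewrite SE dotZl dotDl -[in X in _ + X]sigC sigK (dotC J (B _)) -BE //.
have Ssym x y : '[S x, sig y] = '[S y, sig x] by rewrite !Sform addrC.
have Sdiag x : '[S x, sig x] = '[A x, sig x] by rewrite Sform; lra.
have Spos x : C x -> '[x, sig x] = 0 -> 0 <= '[S x, sig x].
  move=> Cx xs; rewrite Sdiag; apply: cA => //; move: Cx => /spin_cone [x0 xx].
  apply/spin_cone; have -> : '[sig x, sig x] = '[x, x] by rewrite -sigC sigK.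
  have -> // : '[sig x, e] = '[x, e].
  by rewrite spin_conjE !dotE divfK ?gt_eqF // mulrC; ring.
clearbody S; have [K K0 SK] := lfun_bounded J S.
pose al := 2 * K + (1 + 2 * K + K ^+ 2 + K ^+ 3).
pose A1 := S + al *: \1%VF.
have A1E x : A1 x = S x + al *: x by rewrite add_lfunE scale_lfunE id_lfunE.
clearbody A1; exists A1, (A - A1); split; last by rewrite addrC subrK.
  move=> _ [x Cx <-].
  have [a [b [u [a0 b0 ue uu ->]]]] := spin_null_decomposition w0e w00 Cx.
  have im u' : '[u', e] = 0 -> '[u', u'] = N0 -> C (A1 (e + u')).
    by move=> ? ?; rewrite A1E; apply: spin_null_image.
  rewrite linearD !linearZ /=; apply: jsquaresD; apply: jsquaresZ => //; first exact: im.
  by apply: im; rewrite ?dotNl ?dotNr ?ue ?oppr0 ?opprK.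
move=> p q Cp Cq pq; have [->|[k qE]] := spin_orth Cp Cq pq.
  by rewrite linear0 dot0l.
move: pq; rewrite qE !dotZr => pq.
rewrite add_lfunE opp_lfunE A1E; move: (Sdiag p) pq; move: (sig p) => s Ss pq.
have -> : k * '[A p - (S p + al *: p), s] = - al * (k * '[p, s]).
  by rewrite !dotE Ss; ring.
by rewrite pq mulr0.
Qed.
End RankTwo.

Lemma rank_le2_split (R : realType) (V : vectType R) (J : euclideanJordanAlgebra V) :
  jsimple J -> (jrank J <= 2)%N -> forall A, cross_positive J A ->
  exists A1 A2, [/\ coneEnd (jsquares J) A1, cross_zero J A2 & A1 + A2 = A].
Proof.
move=> Js J2 A cA.
have [[w0 [w0e w00]]|nw] := pselect (exists w, jdot J w (jone J) = 0 /\ w != 0).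
  apply: (spin_split Js (fun x => jrank_le2_sq x J2) _ w0e w00 cA).
  by apply: contraNneq w00 => e0; rewrite -(jmul1x J w0) e0 jmul0l.
(* Now V is spanned by e, and every operator is cross-zero. *)
have w0 w : jdot J w (jone J) = 0 -> w = 0.
  by move=> we; apply/eqP; apply: contrapT => /negP wn0; apply: nw; exists w.
exists 0, A; split; last by rewrite add0r.
  by move=> _ [x _ <-]; rewrite zero_lfunE; exact: jsquares0.
have [e0|e0] := eqVneq (jone J) 0.
  by move=> p q _ _ _; rewrite (w0 p) ?linear0 ?dot0l // e0 dot0r.
have ep := dot_gt0 J e0.
have line x : x = (jdot J x (jone J) / jdot J (jone J) (jone J)) *: jone J.
  by apply/eqP; rewrite -subr_eq0; apply/eqP/w0; rewrite !dotE divfK ?subrr ?gt_eqF.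
move=> p q _ _; rewrite [p]line [q]line !dotE => /eqP.
rewrite mulrA mulf_eq0 (gt_eqF ep) orbF mulf_eq0 => /orP[]/eqP->.
  by rewrite scale0r linear0 dot0l mulr0.
by rewrite !mul0r.
Qed.

(** * Peirce calculus and the triangle of idempotents *)

Lemma one_neq_half (F : realFieldType) : 1 != 2^-1 :> F.
Proof. by apply/eqP => h; lra. Qed.

Section Peirce.
Variables (R : realType) (V : vectType R) (J : euclideanJordanAlgebra V).
Local Notation "x ∘ y" := (jmul J x y) (at level 40, left associativity).
Local Notation "''[' x , y ]" := (jdot J x y) : ring_scope.
Local Notation e := (jone J).
Local Notation C := (jsquares J).

(** Multiplication by an element of V_1(c) or V_0(c) preserves the Peirce spaces;
    the eigenvalue l = 1/2 is excluded because the identity degenerates there. *)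
Lemma peirce_mul c l m y z : c ∘ c = c -> l != 2^-1 ->
  c ∘ y = l *: y -> c ∘ z = m *: z -> c ∘ (y ∘ z) = m *: (y ∘ z).
Proof.
move=> cc l2 cy cz; have := jordan_lin J c c y z.
rewrite cc [y ∘ c]jmulC cy cz !jmulE [z ∘ y]jmulC [y ∘ z ∘ c]jmulC => h.
have h' : (2 * l - 1) *: (c ∘ (y ∘ z)) = (2 * l - 1) *: (m *: (y ∘ z)).
  by apply: (@dot_ext _ _ J) => q; have /(congr1 (fun v => '[v, q])) := h;
    rewrite !dotE => hq; lra.
by apply: (scalerI _ h'); apply: contra l2 => /eqP hl; apply/eqP; lra.
Qed.

(** By peirce_mul, the product is an eigenvector of multiplication by c for the
    eigenvalues 1 and 0 at the same time. *)
Lemma peirce10_mul c y z : c ∘ c = c -> c ∘ y = y -> c ∘ z = 0 -> y ∘ z = 0.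
Proof.
move=> cc cy cz.
have h1 : c ∘ (y ∘ z) = 1 *: (y ∘ z).
  rewrite [y ∘ z]jmulC; apply: (@peirce_mul _ 0) => //; rewrite ?scale1r ?scale0r //.
  by rewrite eq_sym invr_eq0 pnatr_eq0.
have h0 : c ∘ (y ∘ z) = 0 *: (y ∘ z).
  apply: (@peirce_mul _ 1) => //; rewrite ?scale1r ?scale0r //.
  exact: one_neq_half.
by rewrite -[LHS]scale1r -h1 h0 scale0r.
Qed.

(** The square of an element of V_1/2(c) has no component in V_1/2(c). *)
Lemma peirce_half_sq c x : c ∘ c = c -> c ∘ x = 2^-1 *: x ->
  c ∘ (c ∘ (x ∘ x)) = c ∘ (x ∘ x).
Proof.
move=> cc cx; have := jordan_lin J x x c c.
rewrite cc [x ∘ c]jmulC cx !jmulE [x ∘ x ∘ c]jmulC ?cx ![_ ∘ c]jmulC ?jmulE ?cx ?jmulE.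
move=> h; apply: (@dot_ext _ _ J) => q.
by have /(congr1 (fun v => '[v, q])) := h; rewrite !dotE => hq; lra.
Qed.

(** On V_1/2(c), the map u |-> 2 L(u) from V_1(c) preserves squares. *)
Lemma peirce_half_sqact c u w : c ∘ c = c -> c ∘ u = u -> c ∘ w = 2^-1 *: w ->
  u ∘ (u ∘ w) = 2^-1 *: ((u ∘ u) ∘ w).
Proof.
move=> cc cu cw.
have l1 := one_neq_half R.
have cu' : c ∘ u = 1 *: u by rewrite scale1r.
have cuu : c ∘ (u ∘ u) = u ∘ u by rewrite (peirce_mul cc l1 cu' cu') scale1r.
have cuw : c ∘ (u ∘ w) = 2^-1 *: (u ∘ w) by exact: peirce_mul cc l1 cu' cw.
have := jordan_lin J u u w c.
rewrite [u ∘ u ∘ c]jmulC cuu [w ∘ u]jmulC [u ∘ w ∘ c]jmulC cuw [u ∘ c]jmulC cu.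
rewrite [w ∘ c]jmulC cw !jmulE [u ∘ w ∘ u]jmulC.
move=> h; apply: (@dot_ext _ _ J) => q.
by have /(congr1 (fun v => '[v, q])) := h; rewrite !dotE => hq; lra.
Qed.

Lemma idempotent_dot1 c : c ∘ c = c -> '[c, e] = '[c, c].
Proof. by move=> cc; rewrite -{1}cc dotM jmulx1. Qed.

Lemma idempotent_orth c d : c ∘ c = c -> c ∘ d = 0 -> '[c, d] = 0.
Proof. by move=> cc cd; rewrite -cc dotM cd dot0r. Qed.

Lemma idempotent_compl c : c ∘ c = c -> (e - c) ∘ (e - c) = e - c.
Proof. by move=> cc; rewrite !jmulE cc !subrr subr0. Qed.

(** If 1/2 were not an eigenvalue of multiplication by c, then V = V_1(c) + V_0(c)
    would be a decomposition into ideals. *)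
Lemma simple_half c : jsimple J -> c ∘ c = c -> c != 0 -> c != e ->
  exists2 x, x != 0 & c ∘ x = 2^-1 *: x.
Proof.
move=> Js cc c0 ce; apply: contrapT => nx.
have cK y : c ∘ (c ∘ y) = c ∘ y.
  apply: contrapT => ny; apply: nx; exists (c ∘ y - c ∘ (c ∘ y)).
    by rewrite subr_eq0 eq_sym; apply/eqP.
  rewrite !jmulE (idempotent_cubic _ cc).
  by apply: (@dot_ext _ _ J) => q; rewrite !dotE; lra.
pose I := lker (linfun (jmul J c) - \1%VF).
have inI y : (y \in I) = (c ∘ y == y).
  by rewrite memv_ker add_lfunE opp_lfunE id_lfunE lfunE subr_eq0.
have idI : jideal J I.
  move=> x y; rewrite !inI => /eqP cy; apply/eqP.
  have cz : c ∘ (x - c ∘ x) = 0 by rewrite !jmulE cK subrr.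
  have -> : x ∘ y = (c ∘ x) ∘ y.
    by apply/eqP; rewrite -subr_eq0 -jmulNl -jmulDl jmulC (peirce10_mul cc cy cz).
  have l1 := one_neq_half R.
  rewrite (@peirce_mul c 1 1 _ _ cc l1) ?scale1r //.
case: (Js _ idI) => hI.
- by move: c0; rewrite -memv0 -hI inI cc eqxx.
- by move/negP: ce; apply; move: (memvf e); rewrite -hI inI jmulx1.
Qed.

(** Let x^2 = al c + b with b in V_0(c). The Jordan identity gives x^3 = al x, so
    x^2 / al is an idempotent above c, and f is its difference with c. Here c is
    primitive in the sense that V_1(c) is the line through c; f has the norm of c
    since both pair with x^2 in the same way. *)
Lemma connect c x : c ∘ c = c -> (forall y, c ∘ y = y -> exists a, y = a *: c) ->
  x != 0 -> c ∘ x = 2^-1 *: x ->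
  exists k f, k != 0 /\ [/\ (k *: x) ∘ (k *: x) = c + f, f ∘ f = f, c ∘ f = 0,
    f ∘ x = 2^-1 *: x & '[f, f] = '[c, c]].
Proof.
move=> cc prim x0 cx.
have [al cxx] := prim _ (peirce_half_sq cc cx).
have c_gt : 0 < '[c, c].
  apply: dot_gt0; apply: contra x0 => /eqP c0; move: cx; rewrite c0 jmul0l => /esym/eqP.
  by rewrite scaler_eq0 invr_eq0 pnatr_eq0.
have xx_gt := dot_gt0 J x0.
have alN : al * '[c, c] = 2^-1 * '[x, x].
  rewrite -(idempotent_dot1 cc) -dotZl -cxx.
  by rewrite dotM jmulx1 dotM [x ∘ c]jmulC cx dotZr.
have al_gt : 0 < al.
  by rewrite -(pmulr_lgt0 _ c_gt) alN mulr_gt0 ?invr_gt0 ?ltr0n.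
have al0 : al != 0 by rewrite gt_eqF.
have x3 : (x ∘ x) ∘ x = al *: x.
  have := jordan_lin J x x x c.
  rewrite [x ∘ x ∘ c]jmulC cxx [x ∘ c]jmulC !jmulE cx !jmulE.
  move=> h; apply: (@dot_ext _ _ J) => q.
  by have /(congr1 (fun v => '[v, q])) := h; rewrite !dotE => hq; lra.
have x4 : (x ∘ x) ∘ (x ∘ x) = al *: (x ∘ x).
  have := jordan_lin J x x x x; rewrite x3 jmulZl.
  move=> h; apply: (@dot_ext _ _ J) => q.
  by have /(congr1 (fun v => '[v, q])) := h; rewrite !dotE => hq; lra.
pose f := al^-1 *: (x ∘ x) - c.
have cf : c ∘ f = 0 by rewrite /f !jmulE cxx cc scalerA mulVf // scale1r subrr.
exists (Num.sqrt al)^-1, f; split; first by rewrite invr_eq0 gt_eqF // sqrtr_gt0.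
have fx2 : '[f, e] = '[c, c].
  rewrite /f !dotE (idempotent_dot1 cc) dotM jmulx1.
  apply: (mulfI al0); rewrite mulrBr mulrA divff // mul1r alN; lra.
have ff : f ∘ f = f.
  rewrite {1}/f jmulDl jmulNl cf subr0 /f !jmulE x4 [x ∘ x ∘ c]jmulC cxx !scalerA.
  by rewrite divfK // mulVf // scale1r.
split=> //.
- rewrite !jmulE scalerA -invfM -expr2 sqr_sqrtr ?ltW // /f addrC subrK //.
- rewrite /f !jmulE x3 cx scalerA mulVf // scale1r.
  by apply: (@dot_ext _ _ J) => q; rewrite !dotE; lra.
- by rewrite -(idempotent_dot1 ff).
Qed.

(** A spectral idempotent g of y for a nonzero eigenvalue lies in V_1(c), so |c|^2
    = |g|^2 + |c - g|^2, and minimality of |c|^2 leaves only g = c. *)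
Lemma prim_of_min N c y : 0 < N -> (forall d, d ∘ d = d -> d != 0 -> N <= '[d, d]) ->
  c ∘ c = c -> '[c, c] = N -> c ∘ y = y -> exists a, y = a *: c.
Proof.
move=> N0 minN cc cN cy; have [rs [g [urs g0 gg gh]]] := spectral_decomposition J y.
have gidem r : r \in rs -> g r ∘ g r = g r by move=> rrs; rewrite gg // eqxx.
have dd := idempotent_compl cc.
have cyy : c ∘ (y ∘ y) = y ∘ y.
  have l1 := one_neq_half R.
  by rewrite (@peirce_mul c 1 1 _ _ cc l1) ?scale1r.
have yy : y ∘ y = \sum_(r <- rs) r ^+ 2 *: g r.
  rewrite -{1 2}[y](jhornerX J) -jhornerM gh.
  by apply: eq_bigr => r _; rewrite hornerM !hornerX expr2.
have sum0 : \sum_(r <- rs) r ^+ 2 * '[g r, e - c] = 0.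
  transitivity '[y ∘ y, e - c].
    by rewrite yy dot_suml; apply: eq_bigr => r _; rewrite dotZl.
  by rewrite !dotE -{1}cyy dotM jmulx1 subrr.
have term_ge r : r \in rs -> 0 <= '[g r, e - c].
  by move=> rrs; apply: jsquares_dot_ge0; apply: jsquares_idem => //; exact: gidem.
have gc r : r \in rs -> r != 0 -> g r = c.
  move=> rrs r0.
  have h : '[g r, e - c] = 0.
    have /eqP := sum0; rewrite big_seq psumr_eq0 => [/allP /(_ r rrs)|s srs].
      by rewrite rrs /= mulf_eq0 sqrf_eq0 (negPf r0) => /eqP.
    by rewrite mulr_ge0 ?sqr_ge0 ?term_ge.
  have := jsquares_orth (jsquares_idem (gidem r rrs)) (jsquares_idem dd) h.
  rewrite !jmulE => /eqP; rewrite subr_eq0 => /eqP gcg.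
  have kk : (c - g r) ∘ (c - g r) = c - g r.
    rewrite !jmulE cc [c ∘ g r]jmulC -gcg gidem //.
    by rewrite subrr addr0.
  apply/eqP; rewrite eq_sym -subr_eq0; apply/negP => /negP k0.
  have := minN _ kk k0; rewrite -(idempotent_dot1 kk) !dotE.
  rewrite (idempotent_dot1 cc) (idempotent_dot1 (gidem r rrs)) cN.
  by have := dot_gt0 J (g0 r rrs); lra.
exists (\sum_(r <- rs | r != 0) r).
rewrite -[LHS](jhornerX J) gh scaler_suml [RHS]big_mkcond /= !big_seq.
apply: eq_bigr => r rrs; rewrite hornerX; case: eqVneq => [->|r0] /=; first by rewrite scale0r.
by rewrite gc.
Qed.

(** An element with minimal polynomial of degree at least three writes e as a sum
    of at least three nonzero orthogonal idempotents. *)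
Lemma rank_norm N : 0 < N -> (forall d, d ∘ d = d -> d != 0 -> N <= '[d, d]) ->
  (2 < jrank J)%N -> 3 * N <= '[e, e].
Proof.
move=> N0 minN; rewrite /jrank; case: ex_maxnP => d /asboolP [x [p [[_ _ pmin] sp]]] _ d3.
have [rs [g [urs g0 gg gh]]] := spectral_decomposition J x.
have s3 : (3 <= size rs)%N.
  have := pmin (\prod_(r <- rs) ('X - r%:P)); rewrite size_prod_XsubC sp ltnS => h.
  apply: leq_trans d3 (h _ _); first by rewrite monic_neq0 // monic_prod_XsubC.
  rewrite gh big_seq big1 // => r rrs.
  have /rootP -> : root (\prod_(s <- rs) ('X - s%:P)) r by rewrite root_prod_XsubC.
  by rewrite scale0r.
have gidem r : r \in rs -> g r ∘ g r = g r by move=> rrs; rewrite gg // eqxx.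
have -> : '[e, e] = \sum_(r <- rs) '[g r, g r].
  rewrite -{1}(jhorner1 J x) gh dot_suml !big_seq; apply: eq_bigr => r rrs.
  by rewrite hornerC dotZl mul1r (idempotent_dot1 (gidem r rrs)).
apply: (@le_trans _ _ (\sum_(r <- rs) N)).
  by rewrite big_const_seq count_predT iter_addr_0 -[leRHS]mulr_natl ler_pM2r // ler_nat.
rewrite big_seq [leRHS]big_seq; apply: ler_sum => r rrs.
by apply: minN; rewrite ?gidem ?g0.
Qed.

Lemma idempotent_kernel c y : c ∘ c = c -> '[c, y ∘ y] = 0 -> c ∘ y = 0.
Proof.
move=> cc cyy; apply: (@psd_kernel _ _ J (jmul J c)).
- by move=> a u v; rewrite !jmulE.
- by move=> u v; rewrite dotM.
- by move=> z; exact: idempotent_psd.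
- by rewrite jmulC dotM (dotC J) -cyy dotC.
Qed.

(** The multiplication table of the real symmetric 3x3 matrices: c_i is the matrix
    unit E_ii and u_ij is E_ij + E_ji. *)
Record triangle (N : R) (c1 c2 c3 u12 u13 u23 : V) : Prop := Triangle {
  tri11 : c1 ∘ c1 = c1; tri22 : c2 ∘ c2 = c2; tri33 : c3 ∘ c3 = c3;
  tri12 : c1 ∘ c2 = 0; tri13 : c1 ∘ c3 = 0; tri23 : c2 ∘ c3 = 0;
  triN1 : '[c1, c1] = N; triN2 : '[c2, c2] = N; triN3 : '[c3, c3] = N;
  tri1u : c1 ∘ u12 = 2^-1 *: u12; tri2u : c2 ∘ u12 = 2^-1 *: u12; tri3u : c3 ∘ u12 = 0;
  tri1w : c1 ∘ u13 = 2^-1 *: u13; tri2w : c2 ∘ u13 = 0; tri3w : c3 ∘ u13 = 2^-1 *: u13;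
  tri1v : c1 ∘ u23 = 0; tri2v : c2 ∘ u23 = 2^-1 *: u23; tri3v : c3 ∘ u23 = 2^-1 *: u23;
  triuu : u12 ∘ u12 = c1 + c2; triww : u13 ∘ u13 = c1 + c3; trivv : u23 ∘ u23 = c2 + c3;
  triuv : u12 ∘ u23 = 2^-1 *: u13; triuw : u12 ∘ u13 = 2^-1 *: u23;
  triwv : u13 ∘ u23 = 2^-1 *: u12 }.

(** The part of x that connects c1 to the outside of c1 + c2 yields, by connect, a
    third idempotent f and w with w^2 = c1 + f. The missing element, which joins
    c2 to f, is 2 u w. *)
Lemma triangle_of_half N c1 c2 u x :
  0 < N -> (forall d, d ∘ d = d -> d != 0 -> N <= '[d, d]) ->
  c1 ∘ c1 = c1 -> c2 ∘ c2 = c2 -> c1 ∘ c2 = 0 -> '[c1, c1] = N -> '[c2, c2] = N ->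
  u ∘ u = c1 + c2 -> c1 ∘ u = 2^-1 *: u -> c2 ∘ u = 2^-1 *: u ->
  (c1 + c2) ∘ x = 2^-1 *: x -> c1 ∘ x != 0 ->
  exists f v w, triangle N c1 c2 f u w v.
Proof.
move=> N0 minN c11 c22 c12 N1 N2 uu c1u c2u cx y0.
have l1 := one_neq_half R.
have c21 : c2 ∘ c1 = 0 by rewrite jmulC.
have dd : (c1 + c2) ∘ (c1 + c2) = c1 + c2.
  by rewrite !jmulE c11 c22 c12 c21 addr0 add0r.
have dc1 : (c1 + c2) ∘ c1 = c1 by rewrite !jmulE c11 c21 addr0.
have c1y : c1 ∘ (c1 ∘ x) = 2^-1 *: (c1 ∘ x).
  by rewrite (peirce_half_sqact dd dc1 cx) c11.
have c2y : c2 ∘ (c1 ∘ x) = 0.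
  have := @peirce_mul (c1 + c2) 1 2^-1 c1 x dd l1.
  rewrite scale1r => /(_ dc1 cx); rewrite jmulDl c1y => h.
  by apply: (addrI (2^-1 *: (c1 ∘ x))); rewrite h addr0.
have [k [f [k0 [ww ff c1f fw Nf]]]] :=
  connect c11 (fun z => prim_of_min N0 minN c11 N1) y0 c1y.
pose w := k *: (c1 ∘ x).
have {}ww : w ∘ w = c1 + f by [].
have c1w : c1 ∘ w = 2^-1 *: w by rewrite /w jmulZr c1y scalerA mulrC -scalerA.
have c2w : c2 ∘ w = 0 by rewrite /w jmulZr c2y scaler0.
have {}fw : f ∘ w = 2^-1 *: w by rewrite /w jmulZr fw scalerA mulrC -scalerA.
move: w ww c1w c2w fw => w ww c1w c2w fw.
have c2f : c2 ∘ f = 0.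
  have /peirce_mul : c2 ∘ c2 = c2 by [].
  move=> /(_ 0 0 w w); rewrite !scale0r => /(_ _ c2w c2w) h.
  have := h _; rewrite eq_sym invr_eq0 pnatr_eq0 => /(_ isT).
  by rewrite ww jmulDr c21 add0r.
have fc1 : f ∘ c1 = 0 by rewrite jmulC.
have fc2 : f ∘ c2 = 0 by rewrite jmulC.
have fu : f ∘ u = 0.
  apply: (idempotent_kernel ff); by rewrite uu dotDr !idempotent_orth ?addr0.
have d13 : (c1 + f) ∘ (c1 + f) = c1 + f by rewrite !jmulE c11 ff c1f fc1 addr0 add0r.
have d12w : (c1 + c2) ∘ w = 2^-1 *: w by rewrite jmulDl c1w c2w addr0.
have d12u : (c1 + c2) ∘ u = u.
  by rewrite jmulDl c1u c2u -scalerDl -[RHS]scale1r; congr (_ *: _); lra.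
have d13u : (c1 + f) ∘ u = 2^-1 *: u by rewrite jmulDl c1u fu addr0.
have d13w : (c1 + f) ∘ w = w.
  by rewrite jmulDl c1w fw -scalerDl -[RHS]scale1r; congr (_ *: _); lra.
have uuw : u ∘ (u ∘ w) = 4^-1 *: w.
  rewrite (peirce_half_sqact dd d12u d12w) uu d12w scalerA; congr (_ *: _); lra.
have wwu : w ∘ (w ∘ u) = 4^-1 *: u.
  rewrite (peirce_half_sqact d13 d13w d13u) ww d13u scalerA; congr (_ *: _); lra.
have d12uw : (c1 + c2) ∘ (u ∘ w) = 2^-1 *: (u ∘ w).
  by apply: (@peirce_mul _ 1) => //; rewrite ?scale1r.
have d13uw : (c1 + f) ∘ (u ∘ w) = 2^-1 *: (u ∘ w).
  by rewrite [u ∘ w]jmulC; apply: (@peirce_mul _ 1) => //; rewrite ?scale1r.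
have uw2 : (u ∘ w) ∘ (u ∘ w) = 4^-1 *: (c2 + f).
  have := jordan_lin J u w u w.
  rewrite uu ww [w ∘ u]jmulC [u ∘ w ∘ w]jmulC [u ∘ w]jmulC wwu d12w !jmulE.
  rewrite [w ∘ u]jmulC uu ww c11 c21 c1f c2f.
  move=> h; apply: (@dot_ext _ _ J) => q.
  by have /(congr1 (fun v => '[v, q])) := h; rewrite !dotE => hq; lra.
exists f, (2 *: (u ∘ w)), w.
have vv : (2 *: (u ∘ w)) ∘ (2 *: (u ∘ w)) = c2 + f.
  rewrite !jmulE uw2 !scalerA -[RHS]scale1r; congr (_ *: _); lra.
have c1v : c1 ∘ (2 *: (u ∘ w)) = 0.
  apply: (idempotent_kernel c11); by rewrite vv dotDr !idempotent_orth ?addr0.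
have c1uw : c1 ∘ (u ∘ w) = 0.
  by move/eqP: c1v; rewrite jmulZr scaler_eq0 pnatr_eq0 => /eqP.
split=> //.
- by rewrite Nf.
- by move: d12uw; rewrite jmulDl c1uw add0r jmulZr => ->; rewrite scalerA mulrC -scalerA.
- by move: d13uw; rewrite jmulDl c1uw add0r jmulZr => ->; rewrite scalerA mulrC -scalerA.
- rewrite jmulZr uuw scalerA; congr (_ *: _); lra.
- rewrite scalerA mulVf ?pnatr_eq0 // scale1r //.
- rewrite jmulZr [u ∘ w]jmulC wwu scalerA; congr (_ *: _); lra.
Qed.

(** Simplicity is used twice: for an element of V_1/2(c1), which gives c2, and for
    an element x of V_1/2(c1 + c2), which gives the third idempotent. As x has a
    nonzero component along c1 or along c2, the two may have to be exchanged. *)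
Lemma triangle_exists N c1 : jsimple J -> (2 < jrank J)%N ->
  0 < N -> (forall d, d ∘ d = d -> d != 0 -> N <= '[d, d]) ->
  c1 ∘ c1 = c1 -> '[c1, c1] = N ->
  exists a1 a2 a3 u v w, triangle N a1 a2 a3 u w v.
Proof.
move=> Js J2 N0 minN c11 N1; have eN := rank_norm N0 minN J2.
have nz d : '[d, d] = N -> d != 0.
  by move=> dN; apply/negP => /eqP d0; move: N0; rewrite -dN d0 dot0l ltxx.
have c1e : c1 != e by apply/negP => /eqP c1e; move: eN; rewrite -c1e N1; lra.
have [x x0 c1x] := simple_half Js c11 (nz _ N1) c1e.
have [k [c2 [k0 [uu c22 c12 c2x N2]]]] :=
  connect c11 (fun z => prim_of_min N0 minN c11 N1) x0 c1x.
have c1u : c1 ∘ (k *: x) = 2^-1 *: (k *: x) by rewrite jmulZr c1x scalerA mulrC -scalerA.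
have c2u : c2 ∘ (k *: x) = 2^-1 *: (k *: x) by rewrite jmulZr c2x scalerA mulrC -scalerA.
rewrite N1 in N2; move: (k *: x) uu c1u c2u => u uu c1u c2u.
have c21 : c2 ∘ c1 = 0 by rewrite jmulC.
have dd : (c1 + c2) ∘ (c1 + c2) = c1 + c2.
  by rewrite !jmulE c11 c22 c12 c21 addr0 add0r.
have Nd : '[c1 + c2, c1 + c2] = 2 * N.
  by rewrite -(idempotent_dot1 dd) dotDl !idempotent_dot1 // N1 N2 mulrDl mul1r.
have [||y y0 dy] := simple_half Js dd.
- by apply/negP => /eqP d0; move: Nd; rewrite d0 dot0l; lra.
- by apply/negP => /eqP de; move: eN; rewrite -de; lra.
have [c1y|c1y] := eqVneq (c1 ∘ y) 0; last first.
  have [f [v [w T]]] := triangle_of_half N0 minN c11 c22 c12 N1 N2 uu c1u c2u dy c1y.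
  by exists c1, c2, f, u, v, w.
have c2y : c2 ∘ y != 0.
  apply/negP => /eqP c2y; move: dy; rewrite jmulDl c1y c2y addr0 => /esym/eqP.
  by rewrite scaler_eq0 invr_eq0 pnatr_eq0 (negPf y0).
rewrite addrC in uu; rewrite addrC in dy.
have [f [v [w T]]] := triangle_of_half N0 minN c22 c11 c21 N2 N1 uu c2u c1u dy c2y.
by exists c2, c1, f, u, v, w.
Qed.
End Peirce.

(** * The twisted operator is cross-positive *)

Lemma amgm3 (F : realFieldType) (X Y Z a : F) : 0 <= X -> 0 <= Y -> 0 <= Z ->
  a ^+ 3 <= X * Y * Z -> 3 * a <= X + Y + Z.
Proof.
move=> X0 Y0 Z0 h; rewrite leNgt; apply/negP => lt.
have S0 : 0 <= X + Y + Z by rewrite !addr_ge0.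
have cube : 27 * (X * Y * Z) <= (X + Y + Z) ^+ 3.
  have hX : 0 <= X * (Y - Z) ^+ 2 by rewrite mulr_ge0 ?sqr_ge0.
  have hY : 0 <= Y * (Z - X) ^+ 2 by rewrite mulr_ge0 ?sqr_ge0.
  have hZ : 0 <= Z * (X - Y) ^+ 2 by rewrite mulr_ge0 ?sqr_ge0.
  have hS : 0 <= (X + Y + Z) * ((X - Y) ^+ 2 + (Y - Z) ^+ 2 + (Z - X) ^+ 2).
    by rewrite mulr_ge0 // !addr_ge0 ?sqr_ge0.
  rewrite -subr_ge0 (_ : _ - _ = 2^-1 * ((X + Y + Z) *
    ((X - Y) ^+ 2 + (Y - Z) ^+ 2 + (Z - X) ^+ 2)) + 3 * (X * (Y - Z) ^+ 2 +
    Y * (Z - X) ^+ 2 + Z * (X - Y) ^+ 2)); last by field.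
  by rewrite addr_ge0 // mulr_ge0 ?invr_ge0 ?ler0n // !addr_ge0.
have lt3 : (X + Y + Z) ^+ 3 < (3 * a) ^+ 3.
  by rewrite ltrXn2r.
have : (3 * a) ^+ 3 = 27 * a ^+ 3 by ring.
lra.
Qed.

Lemma amgm2 (F : realFieldType) (A B S : F) : 0 <= A -> 0 <= B -> 0 <= S ->
  S ^+ 2 <= A * B -> 2 * S <= A + B.
Proof.
move=> A0 B0 S0 SS; rewrite -(@ler_pXn2r _ 2) ?nnegrE ?addr_ge0 ?mulr_ge0 ?ler0n //.
have := sqr_ge0 (A - B); rewrite sqrrB sqrrD exprMn; lra.
Qed.

Lemma quadratic_const_ge0 (F : realFieldType) (a b c : F) :
  (forall r, 0 < r -> 0 <= a + r * b + r ^+ 2 * c) -> 0 <= a.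
Proof.
move=> h; rewrite leNgt; apply/negP => a0.
pose K := `|b| + `|c| + 1.
have K0 : 0 < K by rewrite ltr_wpDl ?addr_ge0.
pose r := Num.min 1 (- a / (2 * K)).
have r0 : 0 < r by rewrite lt_min ltr01 divr_gt0 ?oppr_gt0 // mulr_gt0.
have r1 : r <= 1 by rewrite ge_min lexx.
have rK : r * K <= - a / 2.
  have : r <= - a / (2 * K) by rewrite ge_min lexx orbT.
  by rewrite -ler_pdivlMr // -mulrA -invfM.
have := h r r0.
have : r * b <= r * `|b| by rewrite ler_pM2l // ler_norm.
have : r ^+ 2 * c <= r * `|c|.
  apply: (@le_trans _ _ (r ^+ 2 * `|c|)); first by rewrite ler_wpM2l ?sqr_ge0 ?ler_norm.
  by rewrite ler_wpM2r // expr2 ger_pMr.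
have : r * K = r * `|b| + r * `|c| + r by rewrite /K; ring.
lra.
Qed.

(** Think of S, T, U as the pairings of the Peirce components (1,2), (1,3), (2,3),
    each halved, and of - S - T, - S - U, - T - U as the pairings d1, d2, d3 of
    the diagonal ones. For S > 0 the quadratic polynomial in r gives T^2 <= d1 d3,
    which is equivalent to S^2 <= d1 d2; hence d3 = d1 + d2 + 2 S >= 4 S. The
    product of the three terms on the right is therefore at least (2 N S)^3. *)
Lemma triangle_scalar_bound (F : realFieldType) (N S T U t1 t2 t3 t1' t2' t3' : F) :
  0 < N -> 0 <= t1 -> 0 <= t2 -> 0 <= t3 -> 0 <= t1' -> 0 <= t2' -> 0 <= t3' ->
  0 <= - S - T -> 0 <= - S - U -> 0 <= - T - U ->
  N * (- S - T) <= t1 * t1' -> N * (- S - U) <= t2 * t2' -> N * (- T - U) <= t3 * t3' ->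
  (forall r, 0 < r -> 0 <= (- S - T) + r * (2 * T) + r ^+ 2 * (- T - U)) ->
  6 * N * S <= t1 * t3' + t3 * t2' + 2 * (t2 * t1').
Proof.
move=> N0 a1 a2 a3 b1 b2 b3 d1 d2 d3 h1 h2 h3 hr.
have rhs0 : 0 <= t1 * t3' + t3 * t2' + 2 * (t2 * t1').
  by rewrite !addr_ge0 ?mulr_ge0 ?ler0n.
have [S0|S0] := leP S 0.
  by apply: le_trans rhs0; rewrite mulr_ge0_le0 // mulr_ge0 ?ler0n ?ltW.
have d3_gt : 0 < - T - U by lra.
have TT : T ^+ 2 <= (- S - T) * (- T - U).
  have T0 : 0 < - T by lra.
  have := hr (- T / (- T - U)) (divr_gt0 T0 d3_gt).
  rewrite -(pmulr_rge0 _ d3_gt) => h.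
  rewrite -subr_ge0; apply: le_trans h _.
  rewrite le_eqVlt; apply/orP; left; apply/eqP; field; lra.
have SS : S ^+ 2 <= (- S - T) * (- S - U) by nra.
have d3S : 4 * S <= - T - U by have := amgm2 d1 d2 (ltW S0) SS; lra.
have dprod : 4 * S ^+ 3 <= (- S - T) * (- S - U) * (- T - U).
  rewrite (_ : 4 * S ^+ 3 = S ^+ 2 * (4 * S)); last by ring.
  by apply: ler_pM; rewrite ?sqr_ge0 // mulr_ge0 ?ler0n // ltW.
have Ndprod : N ^+ 3 * ((- S - T) * (- S - U) * (- T - U)) <=
    (t1 * t1') * (t2 * t2') * (t3 * t3').
  rewrite (_ : N ^+ 3 * _ = (N * (- S - T)) * (N * (- S - U)) * (N * (- T - U))); last by ring.
  have [e1 e2 e3] : [/\ 0 <= N * (- S - T), 0 <= N * (- S - U) & 0 <= N * (- T - U)].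
    by split; apply: mulr_ge0 => //; exact: ltW.
  by apply: ler_pM => //; [exact: mulr_ge0|exact: ler_pM].
rewrite (_ : 6 * N * S = 3 * (2 * N * S)); last by ring.
apply: amgm3; rewrite ?mulr_ge0 ?ler0n //.
rewrite (_ : (2 * N * S) ^+ 3 = 2 * (N ^+ 3 * (4 * S ^+ 3))); last by ring.
rewrite (_ : t1 * t3' * _ * _ = 2 * ((t1 * t1') * (t2 * t2') * (t3 * t3'))); last by ring.
rewrite ler_pM2l ?ltr0n //; apply: le_trans Ndprod.
by rewrite ler_pM2l // exprn_gt0.
Qed.

Section Compression.
Variables (R : realType) (V : vectType R) (J : euclideanJordanAlgebra V).
Local Notation "x ∘ y" := (jmul J x y) (at level 40, left associativity).
Local Notation "''[' x , y ]" := (jdot J x y) : ring_scope.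
Local Notation e := (jone J).
Local Notation C := (jsquares J).

Lemma expEnd_eigen (A : 'End(V)) l y : A y = l *: y -> expEnd A y = expR l *: y.
Proof.
move=> Ay; apply: (@dot_ext _ _ J) => q; rewrite dotZl.
have it k : iter k A y = l ^+ k *: y.
  by elim: k => [|k IH]; rewrite ?scale1r // iterS IH linearZ /= Ay scalerA exprSr.
have h := @expEnd_cvg _ _ J A y q.
apply: (cvg_unique _ h) => //.
have -> : series (fun k => k`!%:R^-1 * '[iter k A y, q]) =
    (fun n => series (exp_coeff l) n * '[y, q]).
  apply/funext => n; rewrite /series /= mulr_suml; apply: eq_bigr => k _.
  by rewrite it dotZl /exp_coeff /=; ring.
by apply: cvgMr_tmp; exact: is_cvg_series_exp_coeff.
Qed.

(** Multiplication by z = e - c is cross-zero, since <z p, q> = <z, p q> and p q =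
    0 for orthogonal p, q in the cone. At time 2 log r its flow acts on V_1(c),
    V_1/2(c), V_0(c) by 1, r, r^2. *)
Lemma cone_flow c y1 yh y0 r : c ∘ c = c ->
  c ∘ y1 = y1 -> c ∘ yh = 2^-1 *: yh -> c ∘ y0 = 0 -> 0 < r ->
  C (y1 + yh + y0) -> C (y1 + r *: yh + r ^+ 2 *: y0).
Proof.
move=> cc c1 ch c0 r0 Cy.
pose A : 'End(V) := linfun (jmul J (e - c)).
have AE y : A y = y - c ∘ y by rewrite lfunE /= !jmulE.
have cA : cross_positive J ((2 * ln r) *: A).
  move=> p q Cp Cq pq; rewrite lfunE /= dotZl lfunE /= jmulC dotM.
  by rewrite (jsquares_orth Cp Cq pq) dot0r mulr0.
have := cross_positive_exp cA Cy.
have eig y l : A y = l *: y -> expEnd ((2 * ln r) *: A) y = expR (2 * ln r * l) *: y.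
  by move=> Ay; apply: expEnd_eigen; rewrite lfunE /= Ay scalerA.
rewrite !linearD /= (eig y1 0) ?(eig yh 2^-1) ?(eig y0 1).
- rewrite mulr0 expR0 scale1r mulr1 [2 * ln r]mulrC mulfK ?pnatr_eq0 // lnK ?posrE //.
  by rewrite -(natr1 1) mulrDr mulr1 expRD lnK ?posrE // expr2.
- by rewrite AE c0 subr0 scale1r.
- by rewrite AE ch -{1}[yh]scale1r -scalerBl; congr (_ *: _); lra.
- by rewrite AE c1 subrr scale0r.
Qed.

(** The quadratic representation of the idempotent c, which is the projection onto
    V_1(c). *)
Definition compress c x := 2 *: (c ∘ (c ∘ x)) - c ∘ x.

Lemma compress_flow c x r : c ∘ c = c -> 0 < r -> C x ->
  C (compress c x + r *: (4 *: (c ∘ x - c ∘ (c ∘ x))) +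
     r ^+ 2 *: (x - 3 *: (c ∘ x) + 2 *: (c ∘ (c ∘ x)))).
Proof.
move=> cc r0 Cx; have c3 := idempotent_cubic x cc.
apply: (cone_flow cc) => //.
- rewrite /compress !jmulE c3.
  by apply: (@dot_ext _ _ J) => q; rewrite !dotE; lra.
- rewrite !jmulE c3.
  by apply: (@dot_ext _ _ J) => q; rewrite !dotE; lra.
- rewrite !jmulE c3.
  by apply: (@dot_ext _ _ J) => q; rewrite !dotE; lra.
rewrite [X in C X](_ : _ = x) // /compress.
by apply: (@dot_ext _ _ J) => q; rewrite !dotE; lra.
Qed.

(** The limit of compress_flow as r tends to 0. *)
Lemma compress_cone c x : c ∘ c = c -> C x -> C (compress c x).
Proof.
move=> cc Cx; apply/jsquaresP => q Cq.
apply: (@quadratic_const_ge0 R _ '[4 *: (c ∘ x - c ∘ (c ∘ x)), q]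
  '[x - 3 *: (c ∘ x) + 2 *: (c ∘ (c ∘ x)), q]) => r r0.
have := jsquares_dot_ge0 (compress_flow cc r0 Cx) Cq.
by rewrite dotDl dotDl (dotZl J r) (dotZl J (r ^+ 2)).
Qed.

Lemma compress_dot c x y : c ∘ c = c -> '[compress c x, compress c y] = '[compress c x, y].
Proof.
move=> cc; have c3 := idempotent_cubic x cc.
have cP : c ∘ compress c x = compress c x.
  rewrite /compress !jmulE c3.
  by apply: (@dot_ext _ _ J) => q; rewrite !dotE; lra.
rewrite {2}/compress dotDr dotNr dotZr !dotMr !cP; lra.
Qed.

Lemma compress_trace c x : c ∘ c = c -> '[compress c x, e] = '[x, c].
Proof.
by move=> cc; rewrite /compress !dotE !dotM !jmulE cc; lra.
Qed.

Lemma jsquares_idem_ind w : (forall d, d ∘ d = d -> d != 0 -> 0 <= '[w, d]) ->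
  forall x, C x -> 0 <= '[w, x].
Proof.
move=> h _ [a _ <-]; have [rs [g [urs g0 gg gh]]] := spectral_decomposition J a.
have -> : a ∘ a = \sum_(r <- rs) r ^+ 2 *: g r.
  rewrite -{1 2}[a](jhornerX J) -jhornerM gh.
  by apply: eq_bigr => r _; rewrite hornerM !hornerX expr2.
rewrite dot_sumr big_seq; apply: sumr_ge0 => r rrs; rewrite dotZr mulr_ge0 ?sqr_ge0 //.
by apply: h; rewrite ?g0 // gg // eqxx.
Qed.

(** Both sides are bilinear, so x and y may be taken idempotent, and then N <d, h>
    <= |d| |h| <d, h> <= |d|^2 |h|^2. *)
Lemma jsquares_dot_trace N x y : 0 < N ->
  (forall d, d ∘ d = d -> d != 0 -> N <= '[d, d]) ->
  C x -> C y -> N * '[x, y] <= '[x, e] * '[y, e].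
Proof.
move=> N0 minN Cx Cy.
have ww u v : '['[v, e] *: e - N *: v, u] = '[u, e] * '[v, e] - N * '[u, v].
  by rewrite !dotE (dotC J e) (dotC J v u); ring.
rewrite -subr_ge0 -ww; apply: (jsquares_idem_ind _ Cx) => d dd d0.
rewrite ww (_ : _ - _ = '['[d, e] *: e - N *: d, y]); last by rewrite ww (dotC J y d); ring.
apply: (jsquares_idem_ind _ Cy) => h hh h0.
rewrite ww !idempotent_dot1 //.
have k0 : 0 <= '[h, d] by apply: jsquares_dot_ge0; exact: jsquares_idem.
have kk := cauchy_schwarz J h d.
have Nd := minN d dd d0; have Nh := minN h hh h0.
move: kk k0 Nd Nh; move: '[h, d] '[d, d] '[h, h] => k a b kk k0 Na Nb.
have ab0 : 0 <= b * a by rewrite mulr_ge0 ?(le_trans (ltW N0)).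
have Nk0 : 0 <= N * k by rewrite mulr_ge0 // ltW.
rewrite subr_ge0 -(@ler_pXn2r _ 2) // exprMn; apply: (@le_trans _ _ (N ^+ 2 * (b * a))).
  by rewrite ler_wpM2l ?sqr_ge0.
by rewrite expr2 [leRHS]expr2 ler_wpM2r // ler_pM // ltW.
Qed.

Section Twist.
Variables (N : R) (c1 c2 : V).
Hypotheses (N0 : 0 < N) (minN : forall d, d ∘ d = d -> d != 0 -> N <= '[d, d]).
Hypotheses (c11 : c1 ∘ c1 = c1) (c22 : c2 ∘ c2 = c2) (c12 : c1 ∘ c2 = 0).

(** The first three terms are cyclic in the indices 1, 3, 2, which is the
    asymmetry that rules out a decomposition; the operator 4 c1 (c2 x) is the
    projection onto the Peirce space V_12. The factor 2 makes the constant 12 N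
    come out rational in the arithmetic-geometric mean inequality. *)
Definition twist : 'End(V) :=
  dyad J c1 (e - c1 - c2) + dyad J (e - c1 - c2) c2 + 2 *: dyad J c2 c1
  - (12 * N) *: (linfun (jmul J c1) \o linfun (jmul J c2))%VF.

Lemma twistE x : twist x = '[x, c1] *: (e - c1 - c2) + '[x, e - c1 - c2] *: c2 +
  (2 * '[x, c2]) *: c1 - (12 * N) *: (c1 ∘ (c2 ∘ x)).
Proof. by rewrite !(add_lfunE, opp_lfunE, scale_lfunE, comp_lfunE) !dyadE !lfunE /= scalerA. Qed.

Lemma orth_idem_double a b x : a ∘ a = a -> a ∘ b = 0 ->
  2 *: (a ∘ (b ∘ (a ∘ x))) = a ∘ (b ∘ x).
Proof.
move=> aa ab; have := jordan_lin J a a x b.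
rewrite aa ab jmul0l [x ∘ b]jmulC [x ∘ a]jmulC [_ ∘ a]jmulC ![_ ∘ b]jmulC jmulE.
move=> h.
by apply: (@dot_ext _ _ J) => q; have /(congr1 (fun v => '[v, q])) := h;
  rewrite !dotE => hq; lra.
Qed.

(** The operator on the left of orth_idem_double is symmetric for the scalar
    product, so the one on the right is. *)
Lemma orth_idem_comm a b x : a ∘ a = a -> a ∘ b = 0 -> a ∘ (b ∘ x) = b ∘ (a ∘ x).
Proof.
move=> aa ab; apply: (@dot_ext _ _ J) => q.
rewrite -[in LHS](orth_idem_double x aa ab) dotZl !dotM -dotZr.
by rewrite (orth_idem_double q aa ab).
Qed.

(** Since p q = 0, every <c p, q> vanishes, and the pairings of the Peirce
    components of p with q are expressed by those of c_i (c_j p). The hypotheses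
    of triangle_scalar_bound hold because the compressions of p to V_1(c_i) lie in
    the cone, with traces <p, c_i>, and because the compression to V_1(e - c2)
    followed by the flow of c1 stays in the cone. *)
Lemma twist_cross_positive : cross_positive J twist.
Proof.
move=> p q Cp Cq pq; rewrite twistE !dotE.
have pq0 := jsquares_orth Cp Cq pq.
have z0 z : '[z ∘ p, q] = 0 by rewrite jmulC dotM pq0 dot0r.
have c21 : c2 ∘ c1 = 0 by rewrite jmulC.
have dd : (c1 + c2) ∘ (c1 + c2) = c1 + c2.
  by rewrite !jmulE c11 c22 c12 c21 addr0 add0r.
have c33 : (e - c1 - c2) ∘ (e - c1 - c2) = e - c1 - c2.
  by rewrite -addrA -opprD; exact: idempotent_compl dd.
have comm x := orth_idem_comm x c11 c12.
have dbl1 x := orth_idem_double x c11 c12.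
have dbl2 x := orth_idem_double x c22 c21.
pose M12 := '[c1 ∘ (c2 ∘ p), q]; pose M11 := '[c1 ∘ (c1 ∘ p), q].
pose M22 := '[c2 ∘ (c2 ∘ p), q].
have bound c : c ∘ c = c -> N * '[compress c p, q] <= '[p, c] * '[q, c].
  move=> cc; rewrite -(compress_dot p q cc) -(compress_trace p cc) -(compress_trace q cc).
  by apply: jsquares_dot_trace => //; apply: compress_cone.
have pos c : c ∘ c = c -> 0 <= '[compress c p, q].
  by move=> cc; apply: jsquares_dot_ge0 => //; exact: compress_cone.
have t0 x c : C x -> c ∘ c = c -> 0 <= '[x, c].
  by move=> Cx cc; apply: jsquares_dot_ge0 => //; exact: jsquares_idem.
pose S := 2 * M12; pose T := - 2 * M11 - 2 * M12; pose U := - 2 * M22 - 2 * M12.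
have D1 : '[compress c1 p, q] = - S - T.
  by rewrite /compress !dotE z0 /S /T -/M11; ring.
have D2 : '[compress c2 p, q] = - S - U.
  by rewrite /compress !dotE z0 /S /U -/M22; ring.
have D3 : '[compress (e - c1 - c2) p, q] = - T - U.
  rewrite /compress !jmulE !dotE !z0 pq -/M11 -/M22 -comm -/M12 /T /U; ring.
have h : 6 * N * S <= '[p, c1] * '[q, e - c1 - c2] + '[p, e - c1 - c2] * '[q, c2]
    + 2 * ('[p, c2] * '[q, c1]).
  apply: (triangle_scalar_bound N0 (U := U) (T := T)); rewrite -?D1 -?D2 -?D3; auto.
  move=> r r0; have Cg := compress_cone (idempotent_compl c22) Cp.
  have := jsquares_dot_ge0 (compress_flow c11 r0 Cg) Cq.
  have c2c2 : 2 *: (c1 ∘ (c2 ∘ (c2 ∘ p))) = c1 ∘ (c2 ∘ p) by rewrite comm dbl2 comm.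
  have c1c1 : 2 *: (c1 ∘ (c1 ∘ (c2 ∘ p))) = c1 ∘ (c2 ∘ p) by rewrite (comm p) dbl1.
  have g0 : compress (e - c2) p = p - 3 *: (c2 ∘ p) + 2 *: (c2 ∘ (c2 ∘ p)).
    rewrite /compress !jmulE; apply: (@dot_ext _ _ J) => z; rewrite !dotE; ring.
  have g1 : c1 ∘ compress (e - c2) p = c1 ∘ p - 2 *: (c1 ∘ (c2 ∘ p)).
    rewrite g0 !jmulE c2c2; apply: (@dot_ext _ _ J) => z; rewrite !dotE; ring.
  have g2 : c1 ∘ (c1 ∘ compress (e - c2) p) = c1 ∘ (c1 ∘ p) - c1 ∘ (c2 ∘ p).
    by rewrite g1 !jmulE c1c1.
  rewrite {1}/compress g2 g1 g0.
  rewrite (_ : '[_, _] = (- S - T) + r * (2 * T) + r ^+ 2 * (- T - U)) ?D1 ?D3 //.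
  rewrite !dotE !z0 pq -/M11 -/M22 -/M12 /S /T /U; ring.
rewrite -/M12 (dotC J c1 q) (dotC J c2 q) (dotC J e q).
move: h; rewrite !dotE /S; lra.
Qed.
End Twist.
End Compression.

(** * The trace form *)

(** In a full rank factorization E = A B of an idempotent one has B A = 1. *)
Lemma mxtrace_idempotent (F : fieldType) n (E : 'M[F]_n) :
  E *m E = E -> \tr E = (\rank E)%:R.
Proof.
move=> EE; have CR := mulmx_base E.
suff RC : row_base E *m col_base E = 1%:M.
  by rewrite -{1}CR mxtrace_mulC RC mxtrace1.
apply: (row_full_inj (col_base_full E)); apply: (row_free_inj (row_base_free E)).
by rewrite /= mulmx1 mulmxA CR -mulmxA CR.
Qed.

Section TraceForm.
Variables (R : realType) (V : vectType R) (J : euclideanJordanAlgebra V).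
Local Notation "x ∘ y" := (jmul J x y) (at level 40, left associativity).
Local Notation "''[' x , y ]" := (jdot J x y) : ring_scope.
Local Notation e := (jone J).
Local Notation C := (jsquares J).
Local Notation v := (vbasis {:V}).
Local Notation L x := (linfun (jmul J x)).

Definition lfun_trace (A : 'End(V)) : R := \tr (mxof v v A).

Lemma lfun_traceD A B : lfun_trace (A + B) = lfun_trace A + lfun_trace B.
Proof. by rewrite /lfun_trace !linearD. Qed.

Lemma lfun_traceZ a A : lfun_trace (a *: A) = a * lfun_trace A.
Proof. by rewrite /lfun_trace !linearZ. Qed.

Lemma lfun_traceC A B : lfun_trace (A \o B)%VF = lfun_trace (B \o A)%VF.
Proof. by rewrite /lfun_trace !(mxof_comp _ _ (vbasisP {:V})) mxtrace_mulC. Qed.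

Lemma lfun_trace_idempotent A : (A \o A)%VF = A -> lfun_trace A = (\rank (mxof v v A))%:R.
Proof.
by move=> AA; rewrite /lfun_trace mxtrace_idempotent // -mxof_comp ?vbasisP // AA.
Qed.

Definition jtrace x := lfun_trace (L x).

Lemma jtrace_lin a x y : jtrace (a *: x + y) = a * jtrace x + jtrace y.
Proof.
rewrite /jtrace -lfun_traceZ -lfun_traceD; congr lfun_trace; apply/lfunP => z.
by rewrite add_lfunE scale_lfunE !lfunE /= !jmulE.
Qed.

Lemma jtraceZ a x : jtrace (a *: x) = a * jtrace x.
Proof.
by rewrite /jtrace -lfun_traceZ; congr lfun_trace; apply/lfunP => z;
  rewrite scale_lfunE !lfunE /= jmulZl.
Qed.

Lemma jtraceD x y : jtrace (x + y) = jtrace x + jtrace y.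
Proof. by rewrite -[x in LHS]scale1r jtrace_lin mul1r. Qed.

(** The trace of jmul_formula, seen as an identity between operators applied to b. *)
Lemma jtrace_mul3 x y z : jtrace ((x ∘ y) ∘ z) =
  lfun_trace (L (x ∘ z) \o L y)%VF + lfun_trace (L (y ∘ z) \o L x)%VF
  + lfun_trace (L (x ∘ y) \o L z)%VF
  - lfun_trace (L x \o (L z \o L y))%VF - lfun_trace (L y \o (L z \o L x))%VF.
Proof.
rewrite -[X in _ - X - _]mul1r -[X in _ - _ - X]mul1r -!mulNr -!lfun_traceZ -!lfun_traceD.
congr lfun_trace; apply/lfunP => b.
rewrite !add_lfunE !scale_lfunE !comp_lfunE !lfunE /= jmul_formula.
by rewrite !scaleN1r.
Qed.

(** By jtrace_mul3 and cyclicity of the trace, tr L((xy)z) is symmetric in y and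
    z. *)
Lemma jtrace_assoc x y z : jtrace ((x ∘ y) ∘ z) = jtrace (y ∘ (x ∘ z)).
Proof.
rewrite [y ∘ _]jmulC !jtrace_mul3 [z ∘ y]jmulC.
have c3 (A B D : 'End(V)) : lfun_trace (A \o (B \o D))%VF = lfun_trace (B \o (D \o A))%VF.
  by rewrite lfun_traceC comp_lfunA.
by rewrite (c3 (L x) (L y)) (c3 (L y) (L z)) -(c3 (L x) (L z)); ring.
Qed.

(** For L = L(c), the Peirce projections onto V_1/2 and V_1 are 4 (L - L^2) and 2
    L^2 - L, and 2 L is the first plus twice the second; their traces are their
    ranks. *)
Lemma jtrace_idempotent c : c ∘ c = c -> exists n : nat,
  2 * jtrace c = n%:R /\ (c != 0 -> (0 < n)%N).
Proof.
move=> cc.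
pose E1 : 'End(V) := 4 *: (L c - (L c \o L c)%VF).
pose E2 : 'End(V) := 2 *: (L c \o L c)%VF - L c.
have E1E x : E1 x = 4 *: (c ∘ x - c ∘ (c ∘ x)).
  by rewrite scale_lfunE add_lfunE opp_lfunE comp_lfunE !lfunE.
have E2E x : E2 x = 2 *: (c ∘ (c ∘ x)) - c ∘ x.
  by rewrite add_lfunE scale_lfunE opp_lfunE comp_lfunE !lfunE.
have E11 : (E1 \o E1)%VF = E1.
  apply/lfunP => x; rewrite comp_lfunE !E1E !jmulE !(idempotent_cubic _ cc) !jmulE.
  rewrite !(idempotent_cubic _ cc).
  by apply: (@dot_ext _ _ J) => q; rewrite !dotE; lra.
have E22 : (E2 \o E2)%VF = E2.
  apply/lfunP => x; rewrite comp_lfunE !E2E !jmulE !(idempotent_cubic _ cc) ?jmulE.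
  rewrite ?(idempotent_cubic _ cc).
  by apply: (@dot_ext _ _ J) => q; rewrite !dotE; lra.
exists (\rank (mxof v v E1) + 2 * \rank (mxof v v E2))%N; split.
  rewrite natrD natrM -!lfun_trace_idempotent // -!lfun_traceZ -lfun_traceD.
  congr lfun_trace; apply/lfunP => x.
  rewrite [LHS]scale_lfunE lfunE /= [RHS]add_lfunE [(2 *: E2) x]scale_lfunE E1E E2E.
  by apply: (@dot_ext _ _ J) => q; rewrite !dotE; lra.
move=> c0; rewrite addn_gt0 muln_gt0 /= orbC lt0n mxrank_eq0 mxof_eq0 ?vbasisP //.
apply/orP; left; apply: contra c0 => /eqP E20.
have := E2E c; rewrite E20 !lfunE /= !cc => /esym h.
apply/eqP; apply: (@dot_ext _ _ J) => q.
by have /(congr1 (fun v => '[v, q])) := h; rewrite !dotE => hq; lra.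
Qed.

Lemma jtrace_idempotent_gt0 c : c ∘ c = c -> c != 0 -> 0 < jtrace c.
Proof.
move=> cc c0; have [n [nE /(_ c0)]] := jtrace_idempotent cc.
by rewrite -(ltr_nat R) -nE pmulr_rgt0 ?ltr0n.
Qed.

Definition trace_dot x y := jtrace (x ∘ y).

Lemma trace_dot_bilinear : bilinear_for *%R (idfun \; *%R) trace_dot.
Proof.
split=> [y a x z|x a y z]; rewrite /trace_dot ?jmulDl ?jmulZl ?jmulDr ?jmulZr jtrace_lin //.
Qed.

HB.instance Definition _ :=
  bilinear_isBilinear.Build R V V R *%R (idfun \; *%R) trace_dot trace_dot_bilinear.

Lemma trace_dot_sym x y : trace_dot x y = (-1) ^+ false * idfun (trace_dot y x).
Proof. by rewrite /= expr0 mul1r /trace_dot jmulC. Qed.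

HB.instance Definition _ :=
  isHermitianSesquilinear.Build R V false idfun trace_dot trace_dot_sym.

Lemma trace_dot_gt0 x : x != 0 -> 0 < trace_dot x x.
Proof.
move=> x0; rewrite /trace_dot.
have [rs [g [urs g0 gg gh]]] := spectral_decomposition J x.
have gi r : r \in rs -> g r ∘ g r = g r by move=> rrs; rewrite gg // eqxx.
have -> : jtrace (x ∘ x) = \sum_(r <- rs) r ^+ 2 * jtrace (g r).
  rewrite -{1 2}[x](jhornerX J) -jhornerM gh.
  have t0 : jtrace 0 = 0 by rewrite -(scale0r 0) jtraceZ mul0r.
  rewrite (big_morph _ jtraceD t0); apply: eq_bigr => r _.
  by rewrite jtraceZ hornerM !hornerX expr2.
have tg r : r \in rs -> 0 <= r ^+ 2 * jtrace (g r).
  by move=> rrs; rewrite mulr_ge0 ?sqr_ge0 ?ltW // jtrace_idempotent_gt0 ?gi ?g0.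
rewrite lt_neqAle eq_sym big_seq sumr_ge0 // andbT psumr_eq0 //.
apply: contra x0 => /allP h; rewrite -[x](jhornerX J) gh big_seq big1 // => r rrs.
move: (h r rrs); rewrite rrs /= mulf_eq0 sqrf_eq0 (gt_eqF (jtrace_idempotent_gt0 _ _)) ?gi ?g0 //.
by rewrite orbF hornerX => /eqP ->; rewrite scale0r.
Qed.

HB.instance Definition _ := isDotProduct.Build R V trace_dot trace_dot_gt0.

(** The same product with the trace form as scalar product. Squares, ideals and
    rank depend on the product only. *)
Definition trace_algebra : euclideanJordanAlgebra V :=
  @EuclideanJordanAlgebra R V (jmul J) (jone J) trace_dot (@jmulC _ _ J)
    (@jmul_jordan _ _ J) (@jmul1x _ _ J) jtrace_assoc.

Lemma trace_algebra_rank : jrank trace_algebra = jrank J.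
Proof.
rewrite /jrank; case: ex_maxnP => m mP mmax; case: ex_maxnP => n nP nmax.
by apply/eqP; rewrite eqn_leq (nmax m mP) (mmax n nP).
Qed.

Lemma rank_one_neq0 : (2 < jrank J)%N -> e != 0.
Proof.
rewrite /jrank; case: ex_maxnP => d /asboolP [x [p [[_ _ pmin] sp]]] _ d3.
apply/negP => /eqP e0; have := pmin 1 (oner_neq0 _).
by rewrite jhorner1 e0 size_poly1 sp => /(_ erefl); case: d d3 {sp}.
Qed.

(** The doubled squared norms of idempotents are natural numbers, so a least
    positive one exists; this is the reason for passing to the trace form. *)
Lemma minimal_idempotent : (2 < jrank J)%N -> exists (N : R) c,
  [/\ 0 < N, c ∘ c = c, jdot trace_algebra c c = N &
    forall d, d ∘ d = d -> d != 0 -> N <= jdot trace_algebra d d].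
Proof.
move=> J2; have e0 := rank_one_neq0 J2.
pose P n := `[< exists d, [/\ d ∘ d = d, d != 0 & 2 * jtrace d = n%:R] >].
have exP : exists n, P n.
  have ee : e ∘ e = e by rewrite jmul1x.
  by have [n [nE _]] := jtrace_idempotent ee; exists n; apply/asboolP; exists e.
case: (ex_minnP exP) => n /asboolP [c [cc c0 cn]] nmin.
exists (jtrace c), c; split=> //.
- exact: jtrace_idempotent_gt0.
- by rewrite /= /trace_dot cc.
- move=> d dd d0; rewrite /= /trace_dot dd; have [k [kE _]] := jtrace_idempotent dd.
  have : (n <= k)%N by apply: nmin; apply/asboolP; exists d.
  by rewrite -(ler_nat R) -cn -kE ler_pM2l // ltr0n.
Qed.
End TraceForm.

(** * The twisted operator is not a sum *)

(** With s t fixed and t tending to 0, the left side is a quadratic polynomial in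
    s t that is nowhere positive and vanishes at s t = - 1, so it has a double
    root there. *)
Lemma edge_coefficients_eq (F : realFieldType) (k a b : F) :
  (forall s t, (1 + s * t) * (a + s * t * b) <= k * t ^+ 2) -> a = b.
Proof.
move=> h.
have nonpos r : r * (a - b + r * b) <= 0.
  rewrite -oppr_ge0; apply: (@quadratic_const_ge0 _ _ 0 k) => t t0.
  have := h ((r - 1) / t) t; rewrite divfK ?gt_eqF // => hr.
  rewrite mulr0 addr0 addrC subr_ge0 [t ^+ 2 * k]mulrC.
  by apply: le_trans hr; rewrite le_eqVlt; apply/orP; left; apply/eqP; ring.
apply/eqP; rewrite eq_le; apply/andP; split; rewrite -subr_ge0.
  apply: (@quadratic_const_ge0 _ _ (- b) 0) => r r0.
  have := nonpos r; rewrite pmulr_rle0 //; lra.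
apply: (@quadratic_const_ge0 _ _ (- b) 0) => r r0.
have := nonpos (- r); rewrite mulNr oppr_le0 pmulr_rge0 //; lra.
Qed.

(** Vectors supported on two indices give a1 = a3 and a2 = a3; the vectors (1, 1,
    x) and (1, 1, - x) with x^2 = 2 - z then contradict the inequality for small z
    > 0. *)
Lemma twist_scalar_obstruction (F : rcfType) (n a1 a2 a3 : F) : 0 < n ->
  ~ (forall a b c a' b' c', 0 < a ^+ 2 + b ^+ 2 + c ^+ 2 ->
     0 < a' ^+ 2 + b' ^+ 2 + c' ^+ 2 ->
     (a * a' + b * b' + c * c') * (a1 * (a * a') + a2 * (b * b') + a3 * (c * c')) <=
     n * (a ^+ 2 * c' ^+ 2 + 2 * (b ^+ 2 * a' ^+ 2) + c ^+ 2 * b' ^+ 2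
          - 6 * (a * a' * (b * b')))).
Proof.
move=> n0 h.
have one_gt (s : F) : 0 < 1 + s ^+ 2 by rewrite ltr_pwDl ?ltr01 ?sqr_ge0.
have E13 : a1 = a3.
  apply: (@edge_coefficients_eq _ n) => s t.
  have pos y : 0 < (1 : F) ^+ 2 + 0 ^+ 2 + y ^+ 2 by rewrite expr1n expr0n addr0.
  have := h 1 0 s 1 0 t (pos s) (pos t); lra.
have E23 : a2 = a3.
  apply: (@edge_coefficients_eq _ n) => s t.
  have pos y : 0 < (0 : F) ^+ 2 + 1 ^+ 2 + y ^+ 2 by rewrite expr1n expr0n add0r.
  have := h 0 1 t 0 1 s (pos t) (pos s); lra.
rewrite {}E13 {}E23 in h.
(* Small enough for z * |a3| <= n. *)
pose z := Num.min 1 (n / (`|a3| + 1)).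
have k0 : 0 < `|a3| + 1 by rewrite ltr_wpDl.
have z0 : 0 < z by rewrite lt_min ltr01 divr_gt0.
have z1 : z <= 1 by rewrite ge_min lexx.
have zn : z * (`|a3| + 1) <= n by rewrite -ler_pdivlMr // ge_min lexx orbT.
have z2 : 0 <= 2 - z by lra.
pose x := Num.sqrt (2 - z).
have xx : x * x = 2 - z by rewrite -expr2 sqr_sqrtr.
have pos y : 0 < (1 : F) ^+ 2 + 1 ^+ 2 + y ^+ 2 by rewrite expr1n -addrA addr_gt0.
have := h 1 1 x 1 1 (- x) (pos _) (pos _).
rewrite sqrrN !expr1n !mulr1 !mul1r mulrN !expr2 xx => hz.
have : z * (z * a3) <= z * (- (2 * n)) by lra.
rewrite ler_pM2l // => hz'.
have : - `|a3| <= a3 by rewrite lerNl -normrN ler_norm.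
nra.
Qed.

Section Obstruction.
Variables (R : realType) (V : vectType R) (J : euclideanJordanAlgebra V).
Local Notation "x ∘ y" := (jmul J x y) (at level 40, left associativity).
Local Notation "''[' x , y ]" := (jdot J x y) : ring_scope.
Local Notation e := (jone J).
Local Notation C := (jsquares J).
Variables (N : R) (c1 c2 c3 u w v : V).
Hypothesis T : triangle J N c1 c2 c3 u w v.

Definition tri_comb x1 x2 x3 y1 y2 y3 :=
  x1 *: c1 + x2 *: c2 + x3 *: c3 + y1 *: u + y2 *: w + y3 *: v.

Lemma tri_combD x1 x2 x3 y1 y2 y3 x1' x2' x3' y1' y2' y3' :
  tri_comb x1 x2 x3 y1 y2 y3 + tri_comb x1' x2' x3' y1' y2' y3' =
  tri_comb (x1 + x1') (x2 + x2') (x3 + x3') (y1 + y1') (y2 + y2') (y3 + y3').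
Proof. by apply: (@dot_ext _ _ J) => q; rewrite !dotE; ring. Qed.

Lemma tri_combZ k x1 x2 x3 y1 y2 y3 : k *: tri_comb x1 x2 x3 y1 y2 y3 =
  tri_comb (k * x1) (k * x2) (k * x3) (k * y1) (k * y2) (k * y3).
Proof. by apply: (@dot_ext _ _ J) => q; rewrite !dotE; ring. Qed.

Lemma tri_mul_comb x1 x2 x3 y1 y2 y3 (p := tri_comb x1 x2 x3 y1 y2 y3) :
  [/\ c1 ∘ p = tri_comb x1 0 0 (2^-1 * y1) (2^-1 * y2) 0,
      c2 ∘ p = tri_comb 0 x2 0 (2^-1 * y1) 0 (2^-1 * y3) &
      c3 ∘ p = tri_comb 0 0 x3 0 (2^-1 * y2) (2^-1 * y3)] /\
  [/\ u ∘ p = tri_comb y1 y1 0 (2^-1 * (x1 + x2)) (2^-1 * y3) (2^-1 * y2),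
      w ∘ p = tri_comb y2 0 y2 (2^-1 * y3) (2^-1 * (x1 + x3)) (2^-1 * y1) &
      v ∘ p = tri_comb 0 y3 y3 (2^-1 * y2) (2^-1 * y1) (2^-1 * (x2 + x3))].
Proof.
case: T => h11 h22 h33 h12 h13 h23 _ _ _ h1u h2u h3u h1w h2w h3w h1v h2v h3v uu ww vv uv uw wv.
have E b : b ∘ p = x1 *: (b ∘ c1) + x2 *: (b ∘ c2) + x3 *: (b ∘ c3) +
    y1 *: (b ∘ u) + y2 *: (b ∘ w) + y3 *: (b ∘ v) by rewrite !jmulDr !jmulZr.
rewrite !E [c2 ∘ c1]jmulC [c3 ∘ c1]jmulC [c3 ∘ c2]jmulC.
rewrite [u ∘ c1]jmulC [u ∘ c2]jmulC [u ∘ c3]jmulC.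
rewrite [w ∘ c1]jmulC [w ∘ c2]jmulC [w ∘ c3]jmulC [v ∘ c1]jmulC [v ∘ c2]jmulC [v ∘ c3]jmulC.
rewrite [w ∘ u]jmulC [v ∘ u]jmulC [v ∘ w]jmulC.
rewrite h11 h22 h33 h12 h13 h23 h1u h2u h3u h1w h2w h3w h1v h2v h3v uu ww vv uv uw wv.
by do 2!split; apply: (@dot_ext _ _ J) => q; rewrite !dotE; field.
Qed.

(** The rank one matrix with entries a_i a_j, in the copy of the symmetric
    matrices. *)
Definition tri_point a b c :=
  tri_comb (a ^+ 2) (b ^+ 2) (c ^+ 2) (a * b) (a * c) (b * c).

Lemma tri_mul a b c a' b' c' :
  tri_point a b c ∘ tri_point a' b' c' = (a * a' + b * b' + c * c') *:
    tri_comb (a * a') (b * b') (c * c') (2^-1 * (a * b' + a' * b))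
      (2^-1 * (a * c' + a' * c)) (2^-1 * (b * c' + b' * c)).
Proof.
have [[m1 m2 m3] [mu mw mv]] := tri_mul_comb (a' ^+ 2) (b' ^+ 2) (c' ^+ 2)
  (a' * b') (a' * c') (b' * c').
rewrite {1}/tri_point {1}/tri_comb !jmulDl !jmulZl m1 m2 m3 mu mw mv.
by rewrite !tri_combZ !tri_combD; congr tri_comb; field.
Qed.

(** A rank one symmetric matrix is a multiple of a projection. *)
Lemma tri_cone a b c : 0 < a ^+ 2 + b ^+ 2 + c ^+ 2 -> C (tri_point a b c).
Proof.
set k := _ + _ => k0.
have -> : tri_point a b c = k^-1 *: (tri_point a b c ∘ tri_point a b c).
  rewrite tri_mul scalerA -!expr2 -/k mulVf ?gt_eqF // scale1r /tri_point.
  by congr tri_comb; field.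
by apply: jsquaresZ; [rewrite invr_ge0 ltW | exists (tri_point a b c)].
Qed.

Lemma tri_orth a b c a' b' c' : a * a' + b * b' + c * c' = 0 ->
  '[tri_point a b c, tri_point a' b' c'] = 0.
Proof.
move=> h; rewrite (dotC J) -[X in '[_, X]](jmulx1 J) -dotM tri_mul h scale0r.
by rewrite dot0l.
Qed.

(** The mixed terms cancel when the signs of x and y vary and z carries their
    product. *)
Lemma sign_average (A : 'End(V)) d x y z d' x' y' z' :
  '[A (d + x + y + z), d' + x' + y' + z'] + '[A (d - x + y - z), d' - x' + y' - z']
  + '[A (d + x - y - z), d' + x' - y' - z'] + '[A (d - x - y + z), d' - x' - y' + z'] =
  4 * ('[A d, d'] + '[A x, x'] + '[A y, y'] + '[A z, z']).
Proof. by rewrite !(linearD, linearN) /= !dotE; ring. Qed.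

(** The average of <A p, q> over the rank one matrices p and q of (a, b, c) and
    (a', b', c') when the pair b, b' and the pair c, c' independently change sign. *)
Definition tri_form (A : 'End(V)) a b c a' b' c' :=
  a ^+ 2 * a' ^+ 2 * '[A c1, c1] + a ^+ 2 * b' ^+ 2 * '[A c1, c2]
    + a ^+ 2 * c' ^+ 2 * '[A c1, c3] + b ^+ 2 * a' ^+ 2 * '[A c2, c1]
    + b ^+ 2 * b' ^+ 2 * '[A c2, c2] + b ^+ 2 * c' ^+ 2 * '[A c2, c3]
    + c ^+ 2 * a' ^+ 2 * '[A c3, c1] + c ^+ 2 * b' ^+ 2 * '[A c3, c2]
    + c ^+ 2 * c' ^+ 2 * '[A c3, c3] + a * b * (a' * b') * '[A u, u]
    + a * c * (a' * c') * '[A w, w] + b * c * (b' * c') * '[A v, v].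

Lemma tri_average (A : 'End(V)) a b c a' b' c' :
  '[A (tri_point a b c), tri_point a' b' c']
  + '[A (tri_point a (- b) c), tri_point a' (- b') c']
  + '[A (tri_point a b (- c)), tri_point a' b' (- c')]
  + '[A (tri_point a (- b) (- c)), tri_point a' (- b') (- c')] =
  4 * tri_form A a b c a' b' c'.
Proof.
pose d a b c := a ^+ 2 *: c1 + b ^+ 2 *: c2 + c ^+ 2 *: c3.
have E x y z : tri_point x y z = d x y z + (x * y) *: u + (x * z) *: w + (y * z) *: v by [].
have N1 x y z : tri_point x (- y) z = d x y z - (x * y) *: u + (x * z) *: w - (y * z) *: v.
  by rewrite E /d sqrrN mulrN mulNr !scaleNr.
have N2 x y z : tri_point x y (- z) = d x y z + (x * y) *: u - (x * z) *: w - (y * z) *: v.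
  by rewrite E /d sqrrN !mulrN !scaleNr.
have N3 x y z : tri_point x (- y) (- z) = d x y z - (x * y) *: u - (x * z) *: w + (y * z) *: v.
  by rewrite N2 /d sqrrN mulrN mulNr !scaleNr opprK.
rewrite !N3 !N1 !N2 !E sign_average /d /tri_form !linearD !linearZ /= !dotE; ring.
Qed.

(** Orthogonal vectors give orthogonal rank one matrices. The coordinate vectors
    show that the off-diagonal values vanish, and then the pairs such as (1, 1, 0)
    and (1, -1, 0) give the other identities. *)
Lemma cross_zero_tri D : cross_zero J D ->
  [/\ '[D c1, c2] = 0, '[D c1, c3] = 0 & '[D c2, c1] = 0] /\
  [/\ '[D c2, c3] = 0, '[D c3, c1] = 0 & '[D c3, c2] = 0] /\
  [/\ '[D u, u] = '[D c1, c1] + '[D c2, c2], '[D w, w] = '[D c1, c1] + '[D c3, c3] &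
      '[D v, v] = '[D c2, c2] + '[D c3, c3]].
Proof.
move=> zD.
have z a b c a' b' c' : 0 < a ^+ 2 + b ^+ 2 + c ^+ 2 -> 0 < a' ^+ 2 + b' ^+ 2 + c' ^+ 2 ->
    a * a' + b * b' + c * c' = 0 -> '[D (tri_point a b c), tri_point a' b' c'] = 0.
  by move=> h h' o; apply: zD; [exact: tri_cone|exact: tri_cone|exact: tri_orth].
have f0 a b c a' b' c' : 0 < a ^+ 2 + b ^+ 2 + c ^+ 2 -> 0 < a' ^+ 2 + b' ^+ 2 + c' ^+ 2 ->
    a * a' + b * b' + c * c' = 0 -> tri_form D a b c a' b' c' = 0.
  move=> h h' o; apply: (mulfI (_ : 4 != 0)); rewrite ?pnatr_eq0 // -tri_average mulr0.
  by rewrite !z ?sqrrN ?mulrNN // !addr0.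
have := (f0 1 0 0 0 1 0, f0 1 0 0 0 0 1, f0 0 1 0 1 0 0, f0 0 1 0 0 0 1, f0 0 0 1 1 0 0,
  f0 0 0 1 0 1 0, f0 1 1 0 1 (-1) 0, f0 1 0 1 1 0 (-1), f0 0 1 1 0 1 (-1)).
rewrite /tri_form !sqrrN !(expr1n, expr0n) !(mul0r, mulr0, mul1r, mulr1, addr0, add0r, mulrN).
rewrite !(mulNr, mul1r, addrN, ltr01).
have two : 0 < (1 + 1 : R) by rewrite addr_gt0.
rewrite !two.
move=> [[[[[[[[h12 h13] h21] h23] h31] h32] hu] hw] hv].
move: (h12 isT isT erefl) (h13 isT isT erefl) (h21 isT isT erefl) (h23 isT isT erefl)
  (h31 isT isT erefl) (h32 isT isT erefl) (hu isT isT erefl) (hw isT isT erefl) (hv isT isT erefl).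
clear; move=> -> -> -> -> -> -> hu hw hv; do 3!split => //; lra.
Qed.

Lemma cross_zero_tri_form D : cross_zero J D -> exists a1 a2 a3, forall a b c a' b' c',
  tri_form D a b c a' b' c' =
  (a * a' + b * b' + c * c') * (a1 * (a * a') + a2 * (b * b') + a3 * (c * c')).
Proof.
move=> /cross_zero_tri [[d12 d13 d21] [[d23 d31 d32] [du dw dv]]].
exists '[D c1, c1], '[D c2, c2], '[D c3, c3] => a b c a' b' c'.
rewrite /tri_form d12 d13 d21 d23 d31 d32 du dw dv; ring.
Qed.

Lemma twist_tri_form a b c a' b' c' : tri_form (twist J N c1 c2) a b c a' b' c' =
  N ^+ 2 * (a ^+ 2 * c' ^+ 2 + 2 * (b ^+ 2 * a' ^+ 2) + c ^+ 2 * b' ^+ 2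
            - 6 * (a * a' * (b * b'))).
Proof.
case: T => h11 h22 h33 h12 h13 h23 n1 n2 n3 h1u h2u h3u h1w h2w h3w h1v h2v h3v uu ww vv _ _ _.
have tr0 d x : d ∘ d = d -> d ∘ x = 2^-1 *: x -> '[x, d] = 0.
  move=> dd dx; have : '[x, d] = 2^-1 * '[x, d] by rewrite -[in LHS]dd -dotM dx dotZl.
  lra.
have e0 d x : d ∘ d = d -> d ∘ x = 2^-1 *: x -> '[x, e] = 0.
  move=> dd dx; have := tr0 d x dd dx; rewrite -{1}[d](jmulx1 J) -dotM dx dotZl; lra.
have o x y : x ∘ x = x -> x ∘ y = 0 -> '[y, x] = 0.
  by move=> xx xy; rewrite (dotC J) (idempotent_orth xx xy).
have h21 : c2 ∘ c1 = 0 by rewrite jmulC.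
have h31 : c3 ∘ c1 = 0 by rewrite jmulC.
have h32 : c3 ∘ c2 = 0 by rewrite jmulC.
have nuu : '[u, u] = 2 * N.
  rewrite -{1}[u](jmulx1 J) dotM uu (dotC J) dotDl !idempotent_dot1 // n1 n2; ring.
have i1 := idempotent_dot1 h11; have i2 := idempotent_dot1 h22; have i3 := idempotent_dot1 h33.
have o12 := idempotent_orth h11 h12; have o13 := idempotent_orth h11 h13.
have o23 := idempotent_orth h22 h23; have o21 := idempotent_orth h22 h21.
have o31 := idempotent_orth h33 h31; have o32 := idempotent_orth h33 h32.
have A1 : twist J N c1 c2 c1 = N *: (e - c1 - c2).
  rewrite twistE h21 jmul0r scaler0 subr0 !dotDr !dotNr i1 o12 n1.
  by apply: (@dot_ext _ _ J) => q; rewrite !dotE; ring.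
have A2 : twist J N c1 c2 c2 = (2 * N) *: c1.
  rewrite twistE h22 h12 scaler0 subr0 !dotDr !dotNr i2 o21 n2.
  by apply: (@dot_ext _ _ J) => q; rewrite !dotE; ring.
have A3 : twist J N c1 c2 c3 = N *: c2.
  rewrite twistE h23 jmul0r scaler0 subr0 !dotDr !dotNr i3 o31 o32 n3.
  by apply: (@dot_ext _ _ J) => q; rewrite !dotE; ring.
have Au : twist J N c1 c2 u = (- (3 * N)) *: u.
  rewrite twistE h2u jmulZr h1u !dotDr !dotNr (e0 c1) ?(tr0 c1) ?(tr0 c2) //.
  by apply: (@dot_ext _ _ J) => q; rewrite !dotE; field.
have Aw : twist J N c1 c2 w = 0.
  rewrite twistE h2w jmul0r !dotDr !dotNr (e0 c1) ?(tr0 c1) ?(o c2) //.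
  by apply: (@dot_ext _ _ J) => q; rewrite !dotE; ring.
have Av : twist J N c1 c2 v = 0.
  rewrite twistE h2v jmulZr h1v !dotDr !dotNr (e0 c2) ?(tr0 c2) ?(o c1) //.
  by apply: (@dot_ext _ _ J) => q; rewrite !dotE; ring.
rewrite /tri_form A1 A2 A3 Au Aw Av !dotE nuu !(dotC J e) i1 i2 i3.
rewrite n1 n2 n3 o12 o13 o23 o21; ring.
Qed.

Lemma twist_not_sum A1 A2 : 0 < N -> coneEnd C A1 -> cross_zero J A2 ->
  A1 + A2 = twist J N c1 c2 -> False.
Proof.
move=> N0 cA1 zA2 E; have [a1 [a2 [a3 fE]]] := cross_zero_tri_form zA2.
apply: (@twist_scalar_obstruction R (N ^+ 2) a1 a2 a3); rewrite ?exprn_gt0 //.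
move=> a b c a' b' c' p0 p'0; rewrite -fE -twist_tri_form -E.
have -> : tri_form (A1 + A2) a b c a' b' c' =
    tri_form A1 a b c a' b' c' + tri_form A2 a b c a' b' c'.
  by rewrite /tri_form !add_lfunE !dotDl; ring.
rewrite lerDr -(pmulr_rge0 _ (_ : 0 < 4)) ?ltr0n // -tri_average.
have pos x y z x' y' z' : 0 < x ^+ 2 + y ^+ 2 + z ^+ 2 -> 0 < x' ^+ 2 + y' ^+ 2 + z' ^+ 2 ->
    0 <= '[A1 (tri_point x y z), tri_point x' y' z'].
  move=> h h'; apply: jsquares_dot_ge0; last exact: tri_cone.
  by apply: cA1; exists (tri_point x y z) => //; exact: tri_cone.
by rewrite !addr_ge0 // pos // ?sqrrN.
Qed.
End Obstruction.

Theorem theorem5 (R : realType) (V : vectType R) (J : euclideanJordanAlgebra V)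
    (J_simple : jsimple J) :
  let C := jsquares J in
  cone_s C = [set A1 + A2 | A1 in coneEnd C & A2 in cone_g C]
  <-> (jrank J <= 2)%N.
Proof.
move=> C; split=> [sE|J2]; last first.
  apply/seteqP; split; last exact: coneEnd_addg_sub.
  move=> A /cone_sE /(rank_le2_split J_simple J2) [A1 [A2 [cA1 zA2 <-]]].
  by exists A1 => //; exists A2 => //; apply/cone_gE.
rewrite leqNgt; apply/negP => J2.
have [N [c [N0 cc cN minN]]] := minimal_idempotent J2.
pose J' := trace_algebra J.
have J2' : (2 < jrank J')%N by rewrite trace_algebra_rank.
have [c1 [c2 [c3 [u12 [u13 [u23 T]]]]]] :=
  @triangle_exists _ _ J' N c J_simple J2' N0 minN cc cN.
have : cone_s C (twist J' N c1 c2).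
  apply/(@cone_sE _ _ J'); apply: twist_cross_positive => //.
  - exact: tri11 T.
  - exact: tri22 T.
  - exact: tri12 T.
rewrite sE => -[A1 cA1 [A2 gA2 E12]].
by apply: (twist_not_sum T N0 cA1 _ E12); apply/(@cone_gE _ _ J').
Qed.
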